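(* Let $0<m<n$ and let $r_m=s_{-m}s_{-m+1}\cdots s_{-1}\,s_{n-m-1}s_{n-m-2}\cdots s_1s_0\in\widetilde S_n$. In the algebra $\mathbb A_{m,n}$ one has $$\mathbf s^{(m,n)}_{r_m}=\sum_{v}A_v,$$ where $v$ runs over all $n$-connected ribbons $u_{J^c}d_J$ with $J\subsetneq\mathbb Z/n\mathbb Z$ and $|J|=n-m$. Consequently, $r_m$ is the unique $n$-connected ribbon which is $0$-Grassmannian and whose image $A_{r_m}$ in $\mathbb A_{m,n}$ is nonzero.
   Context: $\widetilde S_n$ is the affine symmetric group with generators $s_i$, $i\in\mathbb Z/n\mathbb Z$, and relations $s_i^2=1$, $s_is_{i+1}s_i=s_{i+1}s_is_{i+1}$, $s_is_j=s_js_i$ for $i-j\ne\pm1$ (indices mod $n$); $\ell$ is the length. $w$ is $0$-Grassmannian if every nonempty reduced word of $w$ ends with $s_0$ (the identity is $0$-Grassmannian); $\widetilde S_n^0$ denotes the set of these. For $J\subsetneq\mathbb Z/n\mathbb Z$, $d_J$ (resp. $u_J$) is the unique element of $\widetilde S_n$ that is a product of the $s_j$, $j\in J$, each exactly once, such that whenever $j,j+1\in J$ the factor $s_{j+1}$ stands to the left of $s_j$ (resp. $s_j$ to the left of $s_{j+1}$); these are the cyclically decreasing (resp. increasing) elements. An $n$-connected ribbon is an element $u_{J^c}d_J$ with $\emptyset\ne J\subsetneq\mathbb Z/n\mathbb Z$ and $J^c$ its complement. The affine nilCoxeter algebra $\mathbb A$ is the $\mathbb Z$-algebra generated by $A_i$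 ($i\in\mathbb Z/n\mathbb Z$) with $A_i^2=0$, $A_iA_{i+1}A_i=A_{i+1}A_iA_{i+1}$, $A_iA_j=A_jA_i$ for $i-j\ne\pm1$; $A_w=A_{i_1}\cdots A_{i_l}$ for a reduced word $s_{i_1}\cdots s_{i_l}$ of $w$. $\mathbb A_{m,n}$ is the quotient of $\mathbb A$ by the two-sided ideal generated by all $A_iA_{i+1}A_i$, all $A_w$ with $w$ cyclically decreasing of length $>n-m$, and all $A_w$ with $w$ cyclically increasing of length $>m$; images of $A_w$ are still denoted $A_w$. Let $k=n-1$, $\mathbf h_i=\sum_{J\subset\mathbb Z/n\mathbb Z,|J|=i}A_{d_J}$ for $1\le i\le k$, and $\mathbb B$ the subalgebra of $\mathbb A$ they generate. For $w\in\widetilde S_n^0$, the noncommutative $k$-Schur function $\mathbf s^{(k)}_w$ is the unique element of $\mathbb B$ whose expansion $\sum_v a_vA_v$ has $a_w=1$ and $a_v=0$ for every other $0$-Grassmannian $v$; $\mathbf s^{(m,n)}_w$ denotes its image in $\mathbb A_{m,n}$.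
   Formalization: For n = 2 the braid relation is dropped from the affine symmetric group (then infinite dihedral) and from the affine nilCoxeter algebra, since read literally it gives S_3, where the k-Schur function is not unique; for n > 2 nothing changes. *)

(* Defs.v *)
From HB Require Import structures.
From mathcomp Require Import boolp classical_sets.
From mathcomp Require Import all_boot all_algebra.
From mathcomp Require Import finmap.
From mathcomp.multinomials Require Import monalg.

Set Implicit Arguments.
Unset Strict Implicit.
Unset Printing Implicit Defensive.

Import GRing.Theory.

Local Open Scope quotient_scope.
Local Open Scope ring_scope.

(* [mathcomp.algebra.ring_quotient] only covers proper ideals of commutative
   rings; here the ideal is two-sided, given by generators, and not assumed to
   be proper, so the quotient is only a [pzRingType]. *)

Inductive two_sided_ideal (R : pzRingType) (G : R -> Prop) : R -> Prop :=
| Ideal_gen x : G x -> two_sided_ideal G x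
| Ideal_0 : two_sided_ideal G 0
| Ideal_B x y :
    two_sided_ideal G x -> two_sided_ideal G y -> two_sided_ideal G (x - y)
| Ideal_M a x b : two_sided_ideal G x -> two_sided_ideal G (a * x * b).

Section RingQuotient.
Variables (R : pzRingType) (G : R -> Prop).

Definition ideal_equiv : rel R := fun x y => `[< two_sided_ideal G (x - y) >].

Lemma two_sided_idealN x : two_sided_ideal G x -> two_sided_ideal G (- x).
Proof. by move=> Ix; rewrite -(sub0r x); apply: Ideal_B => //; exact: Ideal_0. Qed.

Lemma two_sided_idealD x y :
  two_sided_ideal G x -> two_sided_ideal G y -> two_sided_ideal G (x + y).
Proof.
by move=> Ix Iy; rewrite -(opprK y); apply/Ideal_B/two_sided_idealN.
Qed.

Lemma ideal_equivP : equiv_class_of ideal_equiv.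
Proof.
split=> [x | x y | y x z].
- by rewrite /ideal_equiv subrr; apply/asboolP; exact: Ideal_0.
- by apply/asboolP/asboolP => /two_sided_idealN; rewrite opprB.
- move=> /asboolP Ixy /asboolP Iyz; apply/asboolP.
  by rewrite -(subrKA y); apply: two_sided_idealD.
Qed.

Canonical ideal_equiv_rel := EquivRelPack ideal_equivP.

Definition ring_quot := {eq_quot ideal_equiv}.

HB.instance Definition _ := Choice.on ring_quot.

Definition to_quot (x : R) : ring_quot := \pi_({eq_quot ideal_equiv}) x.

Definition of_quot (x : ring_quot) : R :=
  repr (x : {eq_quot ideal_equiv}).

Lemma of_quotK : cancel of_quot to_quot.
Proof. exact: reprK. Qed.

Lemma eq_to_quot x y : to_quot x = to_quot y <-> two_sided_ideal G (x - y).
Proof.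
split=> [/eqquotP|] e; first exact/asboolP.
by apply/eqquotP/asboolP.
Qed.

Lemma to_quotK x : two_sided_ideal G (of_quot (to_quot x) - x).
Proof. by apply/eq_to_quot; rewrite of_quotK. Qed.

Definition add_quot x y := to_quot (of_quot x + of_quot y).
Definition opp_quot x := to_quot (- of_quot x).
Definition mul_quot x y := to_quot (of_quot x * of_quot y).

Lemma to_quotD x y : to_quot (x + y) = add_quot (to_quot x) (to_quot y).
Proof.
apply/esym/eq_to_quot; rewrite opprD addrACA.
by apply: two_sided_idealD; apply: to_quotK.
Qed.

Lemma to_quotN x : to_quot (- x) = opp_quot (to_quot x).
Proof. by apply/esym/eq_to_quot; rewrite -opprD; apply/two_sided_idealN/to_quotK. Qed.

Lemma to_quotM x y : to_quot (x * y) = mul_quot (to_quot x) (to_quot y).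
Proof.
apply/esym/eq_to_quot; set x' := of_quot _; set y' := of_quot _.
rewrite -(subrKA (x' * y)) -mulrBr -mulrBl; apply: two_sided_idealD.
  by rewrite -(mulr1 (_ * _)); apply/Ideal_M/to_quotK.
by rewrite -(mul1r (_ - _)); apply/Ideal_M/to_quotK.
Qed.

Lemma ring_quotW (P : ring_quot -> Prop) : (forall x, P (to_quot x)) -> forall x, P x.
Proof. by move=> h x; rewrite -(of_quotK x). Qed.

Lemma add_quotA : associative add_quot.
Proof. by elim/ring_quotW=> x; elim/ring_quotW=> y; elim/ring_quotW=> z; rewrite -!to_quotD addrA. Qed.

Lemma add_quotC : commutative add_quot.
Proof. by elim/ring_quotW=> x; elim/ring_quotW=> y; rewrite -!to_quotD addrC. Qed.

Lemma add_quot0 : left_id (to_quot 0) add_quot.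
Proof. by elim/ring_quotW=> x; rewrite -to_quotD add0r. Qed.

Lemma add_quotN : left_inverse (to_quot 0) opp_quot add_quot.
Proof. by elim/ring_quotW=> x; rewrite -to_quotN -to_quotD addNr. Qed.

HB.instance Definition _ :=
  GRing.isZmodule.Build ring_quot add_quotA add_quotC add_quot0 add_quotN.

Lemma mul_quotA : associative mul_quot.
Proof. by elim/ring_quotW=> x; elim/ring_quotW=> y; elim/ring_quotW=> z; rewrite -!to_quotM mulrA. Qed.

Lemma mul_1quot : left_id (to_quot 1) mul_quot.
Proof. by elim/ring_quotW=> x; rewrite -to_quotM mul1r. Qed.

Lemma mul_quot1 : right_id (to_quot 1) mul_quot.
Proof. by elim/ring_quotW=> x; rewrite -to_quotM mulr1. Qed.

Lemma mul_quotDl : left_distributive mul_quot (@GRing.add ring_quot).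
Proof.
elim/ring_quotW=> x; elim/ring_quotW=> y; elim/ring_quotW=> z.
by rewrite -[_ + _]to_quotD -!to_quotM -[RHS]to_quotD mulrDl.
Qed.

Lemma mul_quotDr : right_distributive mul_quot (@GRing.add ring_quot).
Proof.
elim/ring_quotW=> x; elim/ring_quotW=> y; elim/ring_quotW=> z.
by rewrite -[_ + _]to_quotD -!to_quotM -[RHS]to_quotD mulrDr.
Qed.

HB.instance Definition _ :=
  GRing.Zmodule_isPzRing.Build ring_quot
    mul_quotA mul_1quot mul_quot1 mul_quotDl mul_quotDr.

Lemma to_quot_is_zmod_morphism : zmod_morphism to_quot.
Proof. by move=> x y; rewrite to_quotD to_quotN. Qed.

HB.instance Definition _ :=
  GRing.isZmodMorphism.Build R ring_quot to_quot to_quot_is_zmod_morphism.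

Lemma to_quot_is_monoid_morphism : monoid_morphism to_quot.
Proof. by split=> // x y; rewrite to_quotM. Qed.

HB.instance Definition _ :=
  GRing.isMonoidMorphism.Build R ring_quot to_quot to_quot_is_monoid_morphism.

End RingQuotient.

Inductive subring_gen (R : pzRingType) (G : R -> Prop) : R -> Prop :=
| Subring_gen x : G x -> subring_gen G x
| Subring_1 : subring_gen G 1
| Subring_B x y : subring_gen G x -> subring_gen G y -> subring_gen G (x - y)
| Subring_M x y : subring_gen G x -> subring_gen G y -> subring_gen G (x * y).

(* Indices live in ['Z_n], which is Z/nZ only for [1 < n].  For [n = 2] we have
   [i + 1 = i - 1], and the affine symmetric group is the infinite dihedral
   group: the pair [s_0], [s_1] then satisfies no braid relation, whence the
   guard [2 < n] below and in [nilCoxeter_rel]. *)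

Inductive coxeter_rel (n : nat) : seq 'Z_n -> seq 'Z_n -> Prop :=
| Cox_sqr (i : 'Z_n) : coxeter_rel [:: i; i] [::]
| Cox_braid (i : 'Z_n) : (2 < n)%N -> coxeter_rel [:: i; i + 1; i] [:: i + 1; i; i + 1]
| Cox_comm (i j : 'Z_n) :
    i - j != 1 -> i - j != -1 -> coxeter_rel [:: i; j] [:: j; i].

Inductive coxeter_cong (n : nat) : seq 'Z_n -> seq 'Z_n -> Prop :=
| Cong_rel x l r y :
    coxeter_rel l r -> coxeter_cong (x ++ l ++ y) (x ++ r ++ y)
| Cong_refl x : coxeter_cong x x
| Cong_sym x y : coxeter_cong x y -> coxeter_cong y x
| Cong_trans x y z :
    coxeter_cong x y -> coxeter_cong y z -> coxeter_cong x z.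

Section AffineSymmetricGroup.
Variable n : nat.
Implicit Types w x y z : seq 'Z_n.

Definition coxeter_equiv : rel (seq 'Z_n) :=
  fun x y => `[< coxeter_cong x y >].

Lemma coxeter_equivP : equiv_class_of coxeter_equiv.
Proof.
split=> [x | x y | y x z].
- by apply/asboolP; exact: Cong_refl.
- by apply/asboolP/asboolP; exact: Cong_sym.
- by move=> /asboolP xy /asboolP yz; apply/asboolP/(Cong_trans xy).
Qed.

Canonical coxeter_equiv_rel := EquivRelPack coxeter_equivP.

(* As the generators are involutions, the monoid presented by the Coxeter
   relations is the group they present; inversion is reversal of words. *)
Definition affS := {eq_quot coxeter_equiv}.

HB.instance Definition _ := Choice.on affS.

Definition affS_class w : affS := \pi_({eq_quot coxeter_equiv}) w.

Definition affS_repr (v : affS) : seq 'Z_n :=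
  repr (v : {eq_quot coxeter_equiv}).

Lemma affS_reprK : cancel affS_repr affS_class.
Proof. exact: reprK. Qed.

Lemma eq_affS_class x y : affS_class x = affS_class y <-> coxeter_cong x y.
Proof.
split=> [/eqquotP|] e; first exact/asboolP.
by apply/eqquotP/asboolP.
Qed.

Lemma affS_classK x : coxeter_cong (affS_repr (affS_class x)) x.
Proof. by apply/eq_affS_class; rewrite affS_reprK. Qed.

Lemma coxeter_cong_cat2 a b x y :
  coxeter_cong x y -> coxeter_cong (a ++ x ++ b) (a ++ y ++ b).
Proof.
move=> xy; elim: xy a b => {x y} [x l r y lr|x|x y _ IH|x y z _ IHx _ IHy] a b.
- have E u : a ++ (x ++ u ++ y) ++ b = (a ++ x) ++ u ++ (y ++ b).
    by rewrite -!catA.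
  rewrite !E.
  exact: Cong_rel.
- exact: Cong_refl.
- exact/Cong_sym/IH.
- exact: Cong_trans (IHx a b) (IHy a b).
Qed.

Lemma coxeter_cong_cat x x' y y' :
  coxeter_cong x x' -> coxeter_cong y y' -> coxeter_cong (x ++ y) (x' ++ y').
Proof.
move=> xx yy; apply: (Cong_trans (coxeter_cong_cat2 [::] y xx)).
by have := coxeter_cong_cat2 x' [::] yy; rewrite !cats0.
Qed.

Lemma coxeter_cong_rev x y : coxeter_cong x y -> coxeter_cong (rev x) (rev y).
Proof.
elim=> {x y} [x l r y lr|x|x y _ IH|x y z _ IHx _ IHy].
- rewrite !rev_cat -!catA; case: lr => [i|i n2|i j ij ij'] /=.
  + exact: (Cong_rel (rev y) (rev x) (Cox_sqr i)).
  + exact: (Cong_rel (rev y) (rev x) (Cox_braid i n2)).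
  + exact/Cong_sym/(Cong_rel (rev y) (rev x) (Cox_comm ij ij')).
- exact: Cong_refl.
- exact/Cong_sym/IH.
- exact: Cong_trans IHx IHy.
Qed.

Lemma coxeter_cong_revK x : coxeter_cong (rev x ++ x) [::].
Proof.
elim: x => [|i x IH]; first exact: Cong_refl.
rewrite rev_cons cat_rcons; apply: Cong_trans IH.
exact: (Cong_rel (rev x) x (Cox_sqr i)).
Qed.

Definition affS_mul (u v : affS) : affS :=
  affS_class (affS_repr u ++ affS_repr v).
Definition affS_inv (v : affS) : affS := affS_class (rev (affS_repr v)).

Lemma affS_classM x y : affS_class (x ++ y) = affS_mul (affS_class x) (affS_class y).
Proof.
by apply/esym/eq_affS_class; apply: coxeter_cong_cat; apply: affS_classK.
Qed.

Lemma affS_classV x : affS_class (rev x) = affS_inv (affS_class x).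
Proof. by apply/esym/eq_affS_class/coxeter_cong_rev/affS_classK. Qed.

Lemma affSW (P : affS -> Prop) : (forall x, P (affS_class x)) -> forall v, P v.
Proof. by move=> h v; rewrite -(affS_reprK v). Qed.

Lemma affS_mulA : associative affS_mul.
Proof. by elim/affSW=> x; elim/affSW=> y; elim/affSW=> z; rewrite -!affS_classM catA. Qed.

Lemma affS_mul1 : left_id (affS_class [::]) affS_mul.
Proof. by elim/affSW=> x; rewrite -affS_classM. Qed.

Lemma affS_1mul : right_id (affS_class [::]) affS_mul.
Proof. by elim/affSW=> x; rewrite -affS_classM cats0. Qed.

Lemma affS_mulV : left_inverse (affS_class [::]) affS_inv affS_mul.
Proof.
elim/affSW=> x; rewrite -affS_classV -affS_classM.
exact/eq_affS_class/coxeter_cong_revK.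
Qed.

Lemma affS_Vmul : right_inverse (affS_class [::]) affS_inv affS_mul.
Proof.
elim/affSW=> x; rewrite -affS_classV -affS_classM -{1}[x]revK.
exact/eq_affS_class/coxeter_cong_revK.
Qed.

HB.instance Definition _ :=
  isGroup.Build affS affS_mulA affS_mul1 affS_1mul affS_mulV affS_Vmul.

Definition simple_refl (i : 'Z_n) : affS := affS_class [:: i].

Definition word_elt w : affS := (\prod_(i <- w) simple_refl i)%g.

Lemma word_eltE w : word_elt w = affS_class w.
Proof.
elim: w => [|i w IH]; rewrite /word_elt ?big_nil // big_cons.
by rewrite -/(word_elt w) IH -[LHS]affS_classM.
Qed.

Lemma word_elt_surj (v : affS) :
  exists l, `[< exists2 w, word_elt w = v & size w = l >].
Proof.
exists (size (affS_repr v)); apply/asboolP; exists (affS_repr v) => //.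
by rewrite word_eltE affS_reprK.
Qed.

Definition cox_length (v : affS) : nat := ex_minn (word_elt_surj v).

Definition reduced_word (v : affS) w : Prop :=
  word_elt w = v /\ size w = cox_length v.

Definition grassmannian0 (v : affS) : Prop :=
  forall w, reduced_word v w -> w <> [::] -> last 0 w = 0.

Definition is_decreasing_word (J : {set 'Z_n}) w : Prop :=
  perm_eq w (enum J) /\
  forall j, j \in J -> j + 1 \in J -> (index (j + 1)%R w < index j w)%N.

Definition is_increasing_word (J : {set 'Z_n}) w : Prop :=
  perm_eq w (enum J) /\
  forall j, j \in J -> j + 1 \in J -> (index j w < index (j + 1)%R w)%N.

(* For [J] a proper subset such words exist and all of them represent the same
   element; [J = setT] is excluded wherever [d_] and [u_] are used. *)
Definition d_ (J : {set 'Z_n}) : affS :=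
  word_elt (xget [::] [set w | is_decreasing_word J w]%classic).

Definition u_ (J : {set 'Z_n}) : affS :=
  word_elt (xget [::] [set w | is_increasing_word J w]%classic).

Definition cyclically_decreasing (v : affS) : Prop :=
  exists2 J : {set 'Z_n}, J != setT & v = d_ J.

Definition cyclically_increasing (v : affS) : Prop :=
  exists2 J : {set 'Z_n}, J != setT & v = u_ J.

Definition ribbon_of (J : {set 'Z_n}) : affS := (u_ (~: J) * d_ J)%g.

Definition connected_ribbon (v : affS) : Prop :=
  exists J : {set 'Z_n}, [/\ J != set0, J != setT & v = ribbon_of J].

(* A duplicate-free list, so that sums over it are sums over group elements. *)
Definition ribbons_of_size (l : nat) : seq affS :=
  undup [seq ribbon_of J | J : {set 'Z_n} in
          [pred J : {set 'Z_n} | [&& J != set0, J != setT & #|J| == l]]].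

(* s_{-m} s_{-m+1} ... s_{-1} s_{n-m-1} ... s_1 s_0 *)
Definition r_ (m : nat) : affS :=
  (\prod_(j <- rev (iota 1 m)) simple_refl (- j%:R) *
   \prod_(j <- rev (iota 0 (n - m))) simple_refl j%:R)%g.

(* [fmonom I] is the free monoid on [I], so this is the free ring on ['Z_n]. *)
Definition free_alg := {malg int[fmonom 'Z_n]}.

Definition free_gen (i : 'Z_n) : free_alg := << fmu i >>.

Inductive nilCoxeter_rel : free_alg -> Prop :=
| Nil_sqr i : nilCoxeter_rel (free_gen i * free_gen i)
| Nil_braid i : (2 < n)%N ->
    nilCoxeter_rel (free_gen i * free_gen (i + 1) * free_gen i
                    - free_gen (i + 1) * free_gen i * free_gen (i + 1))
| Nil_comm (i j : 'Z_n) : i - j != 1 -> i - j != -1 ->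
    nilCoxeter_rel (free_gen i * free_gen j - free_gen j * free_gen i).

Definition nilCoxeter := ring_quot nilCoxeter_rel.

HB.instance Definition _ := GRing.PzRing.on nilCoxeter.

Definition A_gen (i : 'Z_n) : nilCoxeter := to_quot nilCoxeter_rel (free_gen i).

(* The value does not depend on the chosen reduced word (Matsumoto). *)
Definition A_ (v : affS) : nilCoxeter :=
  \prod_(i <- xget [::] [set w | reduced_word v w]%classic) A_gen i.

Definition h_ (i : nat) : nilCoxeter := \sum_(J : {set 'Z_n} | #|J| == i) A_ (d_ J).

Definition fomin_stanley : nilCoxeter -> Prop :=
  subring_gen (fun x : nilCoxeter => exists2 i, (1 <= i <= n.-1)%N & x = h_ i).

Definition is_kSchur (w : affS) (s : nilCoxeter) : Prop :=
  fomin_stanley s /\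
  exists a : {fsfun affS -> int with 0},
    [/\ s = \sum_(v <- finsupp a) A_ v *~ a v,
        a w = 1 &
        forall v, grassmannian0 v -> v <> w -> a v = 0].

Definition kSchur (w : affS) : nilCoxeter := xget 0 [set s | is_kSchur w s]%classic.

Variable m : nat.

Inductive Amn_rel : nilCoxeter -> Prop :=
| Amn_braid i : Amn_rel (A_gen i * A_gen (i + 1) * A_gen i)
| Amn_dec v : cyclically_decreasing v -> (n - m < cox_length v)%N -> Amn_rel (A_ v)
| Amn_inc v : cyclically_increasing v -> (m < cox_length v)%N -> Amn_rel (A_ v).

Definition Amn := ring_quot Amn_rel.

HB.instance Definition _ := GRing.PzRing.on Amn.

Definition to_Amn : nilCoxeter -> Amn := to_quot Amn_rel.

Definition kSchur_mn (w : affS) : Amn := to_Amn (kSchur w).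

End AffineSymmetricGroup.

(* Main.v *)
From HB Require Import structures.
Require Import Defs.
From mathcomp Require Import boolp classical_sets.
From mathcomp Require Import all_boot all_algebra.
From mathcomp Require Import finmap.
From mathcomp.multinomials Require Import monalg.
From mathcomp Require Import fingroup perm zify.

Set Implicit Arguments.
Unset Strict Implicit.
Unset Printing Implicit Defensive.

Import GRing.Theory.
Local Open Scope ring_scope.

(** Write [e_r] for the sum of the [A_(u_K)] with [|K| = r].  If [t] lies in
    [K \cup J] and [t + 1] does not, then [t] can be moved between the two
    factors of [A_(u_K) A_(d_J)], and the product vanishes when [t] lies in both.
    This toggling gives [\sum_i (-1)^i e_i h_(r - i) = 0] for [0 < r < n], so that
    [e_m] lies in the Fomin-Stanley subalgebra.  It also shows that, modulo the
    ideal defining [Amn], the product [e_m h_(n-m)] reduces to its terms with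
    [K = J^c], that is, to the ribbons: a letter moved across a product with
    [K \cup J] proper makes one of the two factors too long.  Inspecting right
    descents, [r_m] is the only Grassmannian element in [e_m h_(n-m)], so this
    product is the k-Schur function of [r_m].

    For uniqueness, let [A_i] move a particle from site [i] to site [i + 1] of a
    cycle of [n] sites carrying [m] particles, a variable recording the number of
    moves.  On this module [e_r] commutes with every [h_j]: overlapping [K] and
    [J] act by zero, and for disjoint ones a rotation of [K \cup J] turns
    [u_K d_J] into a product [d_J' u_K'].  Grassmannian elements are the only ones
    acting nontrivially on the packed state (the vacuum), which generates the
    module under the [e_r] up to torsion, by induction on partitions, removing
    first columns.  Hence an element of the Fomin-Stanley subalgebra without
    Grassmannian terms acts by zero.  Finally the words acting by zero are in the
    ideal, and the others are determined by their action on a single state. *)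

(** * Reduced words and Matsumoto's theorem *)

(** The module is made to fit the ideal: with [m] particles and [n - m] holes, a cyclically
    increasing word needs a particle for each of its letters and a cyclically decreasing word a hole
    for each of its letters, so the lengths bounded in [Amn_rel] are the lengths at which these
    words act by zero. Particles may also run around the cycle and come back to the same state; only
    the exponent of the variable tells such words apart, and without it an element would not be
    determined by its action.

    The element [kSchur (r_ n m)] is a choice among those satisfying [is_kSchur]. The product
    [e_m h_(n-m)] shows that the choice is not void, and every other candidate is compared with this
    product modulo the ideal only, through the action on the module. The vacuum enters because [0]
    is the only letter that can move one of its particles, which is the Grassmannian condition on
    last letters. *)

Lemma braid_mulr (R : pzRingType) (a b c : R) :
  a * (b * a) = b * (a * b) -> a * (b * (a * c)) = b * (a * (b * c)).
Proof. by move=> e; rewrite !mulrA -(mulrA a) e !mulrA. Qed.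

Lemma Zn_two (n : nat) (k l : 'Z_n) : (n <= 2)%N -> k != l -> l = k + 1.
Proof.
by move: k l; case: n => [|[|[|//]]] [[|[|//]] hk] [[|[|//]] hl] // _ _; exact: val_inj.
Qed.

Section CoxeterTheory.
Variable n : nat.
Implicit Types (x y z : seq 'Z_n) (i j : 'Z_n) (t v w : affS n).

Local Notation s := (@simple_refl n).
Local Notation elt := (@word_elt n).

Lemma Zn_S_neq i : i + 1 != i.
Proof. by rewrite -subr_eq0 addrAC subrr add0r oner_neq0. Qed.

Lemma Zn_SS_neq i : (2 < n)%N -> i + 1 + 1 != i.
Proof.
move=> n2; rewrite -subr_eq0 -[i + 1 + 1]addrA (addrC _ (- i)) addKr.
by apply/eqP => /(congr1 val); rewrite -[1 + 1]/(2%:R : 'Z_n) [val _]val_Zp_nat ?modn_small // ltnW.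
Qed.

Lemma Zn_succ_closed (P : pred 'Z_n) i :
  P i -> (forall j, P j -> P (j + 1)) -> forall j, P j.
Proof.
move=> Pi PS j; suff H k : P (i + k%:R) by rewrite -[j](subrKC i) -(natr_Zp (j - i)).
by elim: k => [|k IH]; rewrite ?addr0 // -natr1 addrA; apply: PS.
Qed.

Lemma word_elt_nil : elt [::] = 1%g.
Proof. by rewrite /word_elt big_nil. Qed.

Lemma word_elt_cons i x : elt (i :: x) = (s i * elt x)%g.
Proof. by rewrite /word_elt big_cons. Qed.

Lemma word_elt_cat x y : elt (x ++ y) = (elt x * elt y)%g.
Proof. by rewrite /word_elt big_cat. Qed.

Lemma word_elt1 i : elt [:: i] = s i.
Proof. by rewrite /word_elt big_seq1. Qed.

Lemma word_elt_rcons x i : elt (rcons x i) = (elt x * s i)%g.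
Proof. by rewrite -cats1 word_elt_cat word_elt1. Qed.

Lemma word_elt_rev x : elt (rev x) = ((elt x)^-1)%g.
Proof. by rewrite !word_eltE; exact: affS_classV. Qed.

Lemma eq_word_elt x y : elt x = elt y <-> coxeter_cong x y.
Proof. by rewrite !word_eltE eq_affS_class. Qed.

Lemma coxeter_rel_elt x y : coxeter_rel x y -> elt x = elt y.
Proof.
move=> xy; apply/eq_word_elt.
by have := Cong_rel [::] [::] xy; rewrite !cats0.
Qed.

Lemma simple_refl_sqr i : (s i * s i = 1)%g.
Proof. by have := coxeter_rel_elt (Cox_sqr i); rewrite !word_elt_cons word_elt_nil mulg1. Qed.

Lemma simple_refl_inv i : ((s i)^-1 = s i)%g.
Proof. by apply: (mulgI (s i)); rewrite mulgV simple_refl_sqr. Qed.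

Lemma simple_reflK i v : (s i * (s i * v) = v)%g.
Proof. by rewrite mulgA simple_refl_sqr mul1g. Qed.

Lemma simple_refl_braid i : (2 < n)%N ->
  (s i * (s (i + 1) * s i) = s (i + 1) * (s i * s (i + 1)))%g.
Proof.
move=> n2; have := coxeter_rel_elt (Cox_braid i n2).
by rewrite !word_elt_cons word_elt_nil !mulg1.
Qed.

Definition adjacent i j := (i == j + 1) || (j == i + 1).

Lemma adjacentC i j : adjacent i j = adjacent j i.
Proof. by rewrite /adjacent orbC. Qed.

Lemma nadjacentP i j : ~~ adjacent i j -> i - j != 1 /\ i - j != -1.
Proof.
rewrite negb_or => /andP[ij ji]; split; rewrite subr_eq.
  by rewrite addrC.
by apply: contra ji => /eqP ->; rewrite addrAC addNr add0r.
Qed.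

Lemma simple_refl_comm i j : ~~ adjacent i j -> (s i * s j = s j * s i)%g.
Proof.
case/nadjacentP => h1 h2; have := coxeter_rel_elt (Cox_comm h1 h2).
by rewrite !word_elt_cons word_elt_nil !mulg1.
Qed.

(* The reflections [a s_i a^-1] read off a word, [a] ranging over its
   prefixes: their multiplicities modulo 2 depend only on the element. *)
Fixpoint refls x : seq (affS n) :=
  if x is i :: y then s i :: [seq s i * t * s i | t <- refls y]%g else [::].

Lemma refls_cat x y :
  refls (x ++ y) = refls x ++ [seq elt x * t * (elt x)^-1 | t <- refls y]%g.
Proof.
elim: x => [|i x IH] /=.
  rewrite word_elt_nil -[LHS]map_id; apply: eq_map => t.
  by rewrite mul1g invg1 mulg1.
rewrite IH map_cat -map_comp; congr (_ :: _ ++ _); apply: eq_map => t /=.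
by rewrite word_elt_cons invgM simple_refl_inv !mulgA.
Qed.

(** Both sides of a relation represent the same element, so a relation inside a word affects only
    the reflections it contributes itself: a square contributes one reflection twice, and the two
    sides of a braid or commutation relation contribute the same ones in another order. *)
Lemma odd_count_refls x y t : elt x = elt y ->
  odd (count_mem t (refls x)) = odd (count_mem t (refls y)).
Proof.
move/eq_word_elt => xy; elim: xy t => {x y} [x l r y lr|//|x y _ IH|x y z _ IH1 _ IH2] t.
- rewrite !refls_cat !map_cat -(coxeter_rel_elt lr) !count_cat !oddD.
  congr (_ (+) (_ (+) _)); case: lr => {l r} [i|i n2|i j ij ij'] /=.
  + by rewrite simple_refl_sqr mul1g; case: (_ == _).
  + set j := i + 1; have b := simple_refl_braid i n2; rewrite -/j in b.
    have -> : (s i * (s j * s i * s j) * s i = s j)%g.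
      by rewrite -!mulgA b !simple_reflK.
    have -> : (s j * (s i * s j * s i) * s j = s i)%g.
      by rewrite -!mulgA -b !simple_reflK.
    have -> : (s i * s j * s i = s j * s i * s j)%g by rewrite -!mulgA.
    by do !case: (_ == _).
  + have -> : (s i * s j * s i = s j)%g.
      have := coxeter_rel_elt (Cox_comm ij ij').
      rewrite !word_elt_cons word_elt_nil !mulg1 => ->.
      by rewrite -mulgA simple_refl_sqr mulg1.
    have -> : (s j * s i * s j = s i)%g.
      have := coxeter_rel_elt (Cox_comm ij ij').
      rewrite !word_elt_cons word_elt_nil !mulg1 => <-.
      by rewrite -mulgA simple_refl_sqr mulg1.
    by rewrite !addn0 addnC.
- by rewrite IH.
- by rewrite IH1.
Qed.

(** If [t] is read off at some position, multiplying by [t] cancels the letter at that position. *)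
Lemma refls_delete x t : t \in refls x ->
  exists y, [/\ subseq y x, size x = (size y).+1 & elt y = (t * elt x)%g].
Proof.
elim: x t => // i x IH t; rewrite [refls _]/= inE => /orP[/eqP->|/mapP[t' /IH[y [yx sz e]] ->]].
  by exists x; split; [exact: subseq_cons| |rewrite word_elt_cons simple_reflK].
exists (i :: y) => /=; rewrite eqxx sz; split=> //.
by rewrite !word_elt_cons e -!mulgA simple_reflK.
Qed.

Lemma cox_length_le x : (cox_length (elt x) <= size x)%N.
Proof. by rewrite /cox_length; case: ex_minnP => l _; apply; apply/asboolP; exists x. Qed.

Lemma reduced_word_exists v : exists x, reduced_word v x.
Proof.
rewrite /reduced_word /cox_length; case: ex_minnP => l /asboolP[x e sz] _.
by exists x.
Qed.

Definition reduced x := size x == cox_length (elt x).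

Lemma reducedP x : reduced x <-> forall y, elt y = elt x -> (size x <= size y)%N.
Proof.
split=> [/eqP -> y <-|H]; first exact: cox_length_le.
have [y [ey sy]] := reduced_word_exists (elt x).
by rewrite /reduced eqn_leq cox_length_le -sy H.
Qed.

Lemma reduced_eq x y : elt x = elt y -> size x = size y -> reduced x -> reduced y.
Proof. by rewrite /reduced => -> ->. Qed.

Lemma reduced_word_reduced v x : reduced_word v x -> reduced x.
Proof. by case=> <- sz; rewrite /reduced sz. Qed.

Lemma reduced_infix x y z : reduced (x ++ y ++ z) -> reduced y.
Proof.
move/reducedP => H; apply/reducedP => y' e.
have := H (x ++ y' ++ z); rewrite !word_elt_cat e !size_cat => /(_ erefl); lia.
Qed.

Lemma reduced_behead i x : reduced (i :: x) -> reduced x.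
Proof. by move=> r; apply: (@reduced_infix [:: i] x [::]); rewrite cats0. Qed.

(** If [s i] had even multiplicity in [refls x], it would have odd multiplicity for [i :: x], hence
    for a reduced word [y] of the same element. Deleting it from [y] would give a word for [elt x]
    shorter than [x]. *)
Lemma exchange i x : reduced x -> ~~ reduced (i :: x) -> s i \in refls x.
Proof.
move=> rx nr; case E: (odd (count_mem (s i) (refls x))).
  by rewrite -has_pred1 has_count; case: (count_mem _ _) E.
have [y [ey sy]] := reduced_word_exists (elt (i :: x)).
have ry : reduced y by rewrite /reduced ey sy.
have : odd (count_mem (s i) (refls y)).
  rewrite (odd_count_refls _ ey) /= eqxx count_map.
  rewrite (@eq_count _ _ (pred1 (s i))) ?oddD ?E // => t /=.
  apply/eqP/eqP => [e|->]; last by rewrite simple_refl_sqr mul1g.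
  by apply: (mulgI (s i)); apply: (mulIg (s i)); rewrite e simple_refl_sqr mul1g.
case C: (count_mem _ _) => [//|k] _.
have /refls_delete[z [_ sz ez]] : s i \in refls y.
  by rewrite -has_pred1 has_count C.
have : (size x <= size z)%N.
  by move/reducedP: rx; apply; rewrite ez ey word_elt_cons simple_reflK.
have := cox_length_le (i :: x); move: nr; rewrite /reduced -sy /= => nr le.
by move: nr; rewrite eqn_leq le andbT; lia.
Qed.

Lemma reduced_subseq x : exists y, [/\ subseq y x, reduced y & elt y = elt x].
Proof.
elim: x => [|i x [y [yx ry e]]]; first by exists [::]; split=> //; apply/reducedP.
case: (boolP (reduced (i :: y))) => [r|nr].
  by exists (i :: y); rewrite /= eqxx !word_elt_cons e.
have [z [zy sz ez]] := refls_delete (exchange ry nr).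
exists z; rewrite ez word_elt_cons e; split=> //.
  by apply: subseq_trans (subseq_cons x i); apply: subseq_trans yx.
apply/reducedP => u eu; move/reducedP: ry => /(_ (i :: u)).
by rewrite word_elt_cons eu ez simple_reflK => /(_ erefl); rewrite sz.
Qed.

(* Affine permutations acting on the lifts of the residues [p : 'Z_n] to the
   integers; the second component is the displacement. *)
Definition line_act i (q : 'Z_n * int) : 'Z_n * int :=
  if q.1 == i then (i + 1, q.2 + 1)
  else if q.1 == i + 1 then (i, q.2 - 1) else q.

Definition line_act_word x q := foldr line_act q x.

Lemma line_act_relE x y q : coxeter_rel x y -> line_act_word x q = line_act_word y q.
Proof.
case=> {x y} [i|i n2|i j h1 h2]; case: q => p d /=; rewrite /line_act /=.
- case: (eqVneq p i) => [->|pi] /=.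
    by rewrite (negPf (Zn_S_neq i)) eqxx addrK.
  case: (eqVneq p (i + 1)) => [->|pi1] /=; first by rewrite eqxx subrK.
  by rewrite (negPf pi) (negPf pi1).
- have a1 := negPf (Zn_S_neq i); have a2 := negPf (Zn_S_neq (i + 1)).
  have a3 := negPf (Zn_SS_neq i n2).
  have b1 : (i == i + 1) = false by rewrite eq_sym.
  have b2 : (i + 1 == i + 1 + 1) = false by rewrite eq_sym.
  have b3 : (i == i + 1 + 1) = false by rewrite eq_sym.
  have simp := (a1, a2, a3, b1, b2, b3, eqxx, addrK, subrK).
  case: (eqVneq p i) => [->|/negPf c1] /=; first by rewrite !simp.
  case: (eqVneq p (i + 1)) => [pi|/negPf c2] /=; first by rewrite ?pi; do !rewrite ?simp /=.
  case: (eqVneq p (i + 1 + 1)) => [pi|/negPf c3] /=; first by rewrite ?pi; do !rewrite ?simp /=.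
  by do !rewrite ?c1 ?c2 ?c3 /=.
- case: (eqVneq i j) => [->//|/negPf ij].
  have a1 : (i == j + 1) = false by apply/negP => /eqP e; rewrite e addrAC subrr add0r eqxx in h1.
  have a2 : (j == i + 1) = false by apply/negP => /eqP e; rewrite e opprD addNKr eqxx in h2.
  have a3 : (i + 1 == j + 1) = false by rewrite (inj_eq (addIr _)).
  have b0 : (j == i) = false by rewrite eq_sym.
  have b1 : (j + 1 == i) = false by rewrite eq_sym.
  have b2 : (i + 1 == j) = false by rewrite eq_sym.
  have b3 : (j + 1 == i + 1) = false by rewrite eq_sym.
  have simp := (negPf (Zn_S_neq i), negPf (Zn_S_neq j), ij, b0, a1, a2, a3, b1, b2, b3, eqxx).
  case: (eqVneq p i) => [pi|/negPf c1] /=; first by rewrite ?pi; do !rewrite ?simp /=.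
  case: (eqVneq p j) => [pi|/negPf c4] /=; first by rewrite ?pi; do !rewrite ?simp /=.
  case: (eqVneq p (i + 1)) => [pi|/negPf c2] /=; first by rewrite ?pi; do !rewrite ?simp /=.
  case: (eqVneq p (j + 1)) => [pi|/negPf c3] /=; first by rewrite ?pi; do !rewrite ?simp /=.
  by do !rewrite ?c1 ?c2 ?c3 ?c4 /=.
Qed.

Lemma line_act_wordE x y q : elt x = elt y -> line_act_word x q = line_act_word y q.
Proof.
move/eq_word_elt => xy; elim: xy q => {x y} [x l r y lr|//|x y _ IH|x y z _ IH1 _ IH2] q.
- by rewrite /line_act_word !foldr_cat; congr foldr; apply: line_act_relE.
- by rewrite IH.
- by rewrite IH1.
Qed.

(** The displacement matters for [n = 2], where both generators exchange the two residues. *)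
Lemma simple_refl_inj : injective s.
Proof.
move=> i j e; apply/eqP/negPn/negP => ij.
have /(line_act_wordE (i, 0)) : elt [:: i] = elt [:: j] by rewrite !word_elt1.
rewrite /line_act_word /= /line_act /= eqxx (negPf ij).
by case: ifP => _ [].
Qed.

Lemma simple_refl_neq1 i : s i <> 1%g.
Proof.
move=> e; have /(line_act_wordE (i, 0)) : elt [:: i] = elt [::].
  by rewrite word_elt1 word_elt_nil.
by rewrite /line_act_word /= /line_act /= eqxx => /(congr1 snd).
Qed.

(* For [n <= 2] reduced words alternate, hence act on the line by translating
   some point by their length. *)
Lemma reduced_head2 i j x y : (n <= 2)%N -> i != j ->
  reduced (i :: x) -> reduced (j :: y) -> elt (i :: x) = elt (j :: y) -> False.
Proof.
move=> n2 ij rx ry e.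
have two (k l : 'Z_n) : k != l -> l = k + 1 by exact: Zn_two.
have up k z : reduced (k :: z) -> line_act_word (k :: z) (last k z, 0) = (k + 1, (size z).+1%:Z).
  elim: z k => [|l z IH] k r; first by rewrite /= /line_act /= eqxx.
  rewrite -[LHS]/(line_act k (line_act_word (l :: z) (last l z, 0))) (IH _ (reduced_behead r)) /line_act /=.
  have -> : k = l + 1.
    apply: two; apply/eqP => kl; move/reducedP: r => /(_ z).
    by rewrite kl !word_elt_cons simple_reflK /= => /(_ erefl); lia.
  by rewrite eqxx; congr (_, _); lia.
have dn k z : reduced (k :: z) -> line_act_word (k :: z) (last k z + 1, 0) = (k, - (size z).+1%:Z).
  elim: z k => [|l z IH] k r; first by rewrite /= /line_act /= (negPf (Zn_S_neq k)) eqxx.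
  rewrite -[LHS]/(line_act k (line_act_word (l :: z) (last l z + 1, 0))) (IH _ (reduced_behead r)) /line_act /=.
  have kl : k != l.
    apply/eqP => kl; move/reducedP: r => /(_ z).
    by rewrite kl !word_elt_cons simple_reflK /= => /(_ erefl); lia.
  by rewrite (two _ _ kl) (negPf (Zn_S_neq k)) eqxx; congr (_, _); lia.
(* With equal last letters both words move the same point, to [i + 1] and to [j + 1]; with different
   ones they would move it in opposite directions. *)
have := up _ _ rx; rewrite (line_act_wordE _ e).
case: (eqVneq (last i x) (last j y)) => [->|ll].
  by rewrite (up _ _ ry) => /(congr1 fst)/= /addIr ji; rewrite ji eqxx in ij.
by rewrite (two (last j y) (last i x)) 1?eq_sym // (dn _ _ ry) => /(congr1 snd)/=; lia.
Qed.

Definition A_word x : nilCoxeter n := \prod_(i <- x) A_gen i.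

Lemma A_word_nil : A_word [::] = 1.
Proof. by rewrite /A_word big_nil. Qed.

Lemma A_word_cons i x : A_word (i :: x) = A_gen i * A_word x.
Proof. by rewrite /A_word big_cons. Qed.

Lemma A_word_cat x y : A_word (x ++ y) = A_word x * A_word y.
Proof. by rewrite /A_word big_cat. Qed.

Lemma A_word1 i : A_word [:: i] = A_gen i.
Proof. by rewrite /A_word big_seq1. Qed.

Let toM (a b : free_alg n) :
  to_quot (@nilCoxeter_rel n) (a * b) =
  (to_quot (@nilCoxeter_rel n) a : nilCoxeter n) * to_quot (@nilCoxeter_rel n) b
  := rmorphM (to_quot (@nilCoxeter_rel n)) a b.

Lemma A_gen_sqr i : A_gen i * A_gen i = 0 :> nilCoxeter n.
Proof.
rewrite -toM -[RHS](rmorph0 (to_quot (@nilCoxeter_rel n))).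
by apply/eq_to_quot; rewrite subr0; apply: Ideal_gen; constructor.
Qed.

Lemma A_gen_braid i : (2 < n)%N ->
  A_gen i * (A_gen (i + 1) * A_gen i) = A_gen (i + 1) * (A_gen i * A_gen (i + 1)) :> nilCoxeter n.
Proof.
move=> n2; rewrite /A_gen -!toM !mulrA.
by apply/eq_to_quot; apply: Ideal_gen; apply: Nil_braid.
Qed.

Lemma A_gen_comm i j : ~~ adjacent i j -> A_gen i * A_gen j = A_gen j * A_gen i :> nilCoxeter n.
Proof.
case/nadjacentP => h1 h2; rewrite /A_gen -!toM.
by apply/eq_to_quot; apply: Ideal_gen; apply: Nil_comm.
Qed.

Local Opaque A_gen.

Lemma A_gen_braid_adjacent i j : (2 < n)%N -> adjacent i j ->
  A_gen i * (A_gen j * A_gen i) = A_gen j * (A_gen i * A_gen j) :> nilCoxeter n.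
Proof. by move=> n2 /orP[] /eqP->; rewrite A_gen_braid. Qed.

Lemma simple_refl_braid_adjacent i j : (2 < n)%N -> adjacent i j ->
  (s i * (s j * s i) = s j * (s i * s j))%g.
Proof. by move=> n2 /orP[] /eqP->; rewrite simple_refl_braid. Qed.

Lemma refls_consP i x t : t \in refls (i :: x) -> t <> s i -> (s i * t * s i)%g \in refls x.
Proof.
rewrite inE => /orP[/eqP//|/mapP[u ux ->] _].
by rewrite -!mulgA simple_reflK simple_refl_sqr mulg1.
Qed.

Lemma refls_head i x y : reduced (i :: x) -> elt y = elt (i :: x) -> s i \in refls y.
Proof.
move=> r e; suff : odd (count_mem (s i) (refls y)).
  by rewrite -has_pred1 has_count; case: (count_mem _ _).
rewrite (odd_count_refls _ e) /= eqxx /=.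
rewrite (_ : count_mem _ _ = 0)%N //; apply/count_memPn/negP => /mapP[u ux].
move/(congr1 (fun t => s i * t)%g); rewrite simple_refl_sqr -!mulgA simple_reflK.
move/(congr1 (fun t => t * s i)%g); rewrite mul1g -mulgA simple_refl_sqr mulg1 => ui.
move: ux; rewrite -ui => /refls_delete[z [_ sz ez]].
move/reducedP: r => /(_ z); rewrite ez word_elt_cons => /(_ erefl) /=; lia.
Qed.

(** By induction on the length. If the first letters [i] and [j] differ, deletions produce a reduced
    word of the same element that begins with both sides available of the commutation or braid
    relation of [i] and [j]. Each given word agrees with one side by induction, after its first
    letter is removed, and the relation links the two sides. *)
Lemma matsumoto x y : reduced x -> reduced y -> elt x = elt y -> A_word x = A_word y.
Proof.
move: {2}(size x) (leqnn (size x)) => k; elim: k x y => [|k IH] x y.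
  rewrite leqn0 => /nilP -> _ ry e; suff -> : y = [::] by [].
  by move/reducedP: ry => /(_ [::] e); rewrite leqn0 => /nilP.
case: x y => [|i x] [|j y] // le rx ry e.
- by move/reducedP: ry => /(_ [::] e).
- by move/reducedP: rx => /(_ [::] (esym e)).
have sz : size x = size y.
  by apply/eqP; rewrite -eqSS -[_.+1]/(size (i :: x)) -[(size y).+1]/(size (j :: y)) (eqP rx) (eqP ry) e.
have [ij|ij] := eqVneq i j.
  rewrite !A_word_cons ij; congr (_ * _); apply: IH (reduced_behead rx) (reduced_behead ry) _ => //.
  by apply: (mulgI (s i)); rewrite -!word_elt_cons e ij.
have [n2|n2] := leqP n 2; first by case: (reduced_head2 n2 ij rx ry e).
have sij : s i <> s j by move/simple_refl_inj => h; rewrite h eqxx in ij.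
have := refls_consP (refls_head rx (esym e)) sij => /refls_delete[z [_ szz ez]].
have ezx : elt (j :: z) = elt x.
  rewrite word_elt_cons ez -!mulgA simple_reflK -(word_elt_cons j) -e.
  by rewrite word_elt_cons simple_reflK.
have [aij|aij] := boolP (adjacent i j); last first.
  have c := simple_refl_comm aij.
  have ezy : elt (i :: z) = elt y.
    by rewrite word_elt_cons ez -c -[(_ * s j * s j)%g]mulgA simple_refl_sqr mulg1 simple_reflK.
  have -> : A_word (i :: x) = A_word (i :: j :: z).
    rewrite !(A_word_cons i); congr (_ * _); apply: IH => //; first exact: reduced_behead rx.
    by apply: reduced_eq (esym ezx) _ (reduced_behead rx); rewrite /= -szz sz.
  have -> : A_word (j :: y) = A_word (j :: i :: z).
    rewrite !(A_word_cons j); congr (_ * _); apply: IH => //; first by rewrite -sz.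
      exact: reduced_behead ry.
    exact: reduced_eq (esym ezy) _ (reduced_behead ry).
  by rewrite !A_word_cons !mulrA A_gen_comm.
have b := simple_refl_braid_adjacent n2 aij.
have e2 : elt (i :: j :: z) = elt (j :: y) by rewrite -e word_elt_cons ezx word_elt_cons.
have sjij : (s i * s j * s i <> s j)%g.
  rewrite -mulgA b => /(congr1 (fun t => s j * t)%g); rewrite simple_reflK simple_refl_sqr.
  by move/(congr1 (fun t => t * s j)%g); rewrite mul1g -mulgA simple_refl_sqr mulg1.
(* [s j] is a reflection of [i :: j :: z]; removing [i] and then [j] conjugates it into [s i], which
   is therefore a reflection of [z], and a letter of [z] can be deleted. *)
have := refls_consP (refls_head ry e2) (not_eq_sym sij).
move/refls_consP => /(_ sjij).
have -> : (s j * (s i * s j * s i) * s j = s i)%g by rewrite -!mulgA -b !simple_reflK.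
case/refls_delete => u [_ su eu].
have eux : elt (j :: i :: u) = elt x by rewrite !word_elt_cons eu simple_reflK -word_elt_cons.
have euy : elt (i :: j :: u) = elt y.
  have b' t : (s i * (s j * (s i * t)) = s j * (s i * (s j * t)))%g.
    by have := congr1 (fun a => a * t)%g b; rewrite -!mulgA.
  by rewrite !word_elt_cons eu ez -!mulgA b' !simple_reflK.
have -> : A_word (i :: x) = A_word [:: i, j, i & u].
  rewrite !(A_word_cons i); congr (_ * _); apply: IH => //; first exact: reduced_behead rx.
  by apply: reduced_eq (esym eux) _ (reduced_behead rx); rewrite /= -su -szz sz.
have -> : A_word (j :: y) = A_word [:: j, i, j & u].
  rewrite !(A_word_cons j); congr (_ * _); apply: IH => //; first by rewrite -sz.
    exact: reduced_behead ry.
  by apply: reduced_eq (esym euy) _ (reduced_behead ry); rewrite /= -su -szz.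
by rewrite !A_word_cons; exact: braid_mulr (A_gen_braid_adjacent n2 aij).
Qed.

(** By exchange the reduced tail can be rewritten to begin with the letter in front of it, which
    creates a square. *)
Lemma A_word_nonreduced x : ~~ reduced x -> A_word x = 0.
Proof.
elim: x => [/negP[]|i x IH nr]; first exact/reducedP.
rewrite A_word_cons; have [rx|nrx] := boolP (reduced x); last by rewrite IH // mulr0.
have [y [_ sy ey]] := refls_delete (exchange rx nr).
have eyx : elt (i :: y) = elt x by rewrite word_elt_cons ey simple_reflK.
rewrite -(@matsumoto (i :: y)) //; last by apply: reduced_eq (esym eyx) _ rx; rewrite sy.
by rewrite A_word_cons mulrA A_gen_sqr mul0r.
Qed.

Lemma A_elt x : reduced x -> A_ (elt x) = A_word x.
Proof.
move=> rx; rewrite /A_ -/(A_word _); have [w rw] := reduced_word_exists (elt x).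
have : [set w | reduced_word (elt x) w]%classic (xget [::] [set w | reduced_word (elt x) w]%classic).
  exact: (xgetPex [::] (ex_intro _ w rw)).
by case=> e sz; apply: matsumoto => //; apply/eqP; rewrite sz e.
Qed.

(** If [i :: x] were not reduced, [s i] would be a product of letters of [x]. A reduced subword of
    this product has length one, so it is the letter [i] itself, which does not occur in [x]. *)
Lemma uniq_reduced x : uniq x -> reduced x.
Proof.
elim: x => [|i x IH] /=; first by move=> _; apply/reducedP.
case/andP => ix /IH rx; apply/negPn/negP => nr.
have [y [yx _ ey]] := refls_delete (exchange rx nr).
have eyx : elt (x ++ rev y) = s i.
  by rewrite word_elt_cat word_elt_rev ey invgM simple_refl_inv mulgA mulgV mul1g.
have [z [zxy rz ez]] := reduced_subseq (x ++ rev y).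
have sz : size z = 1%N.
  have r1 : reduced [:: i].
    apply/reducedP => -[|//]; rewrite word_elt1 word_elt_nil => /esym.
    by move/simple_refl_neq1.
  by rewrite (eqP rz) ez eyx -word_elt1 -(eqP r1).
case: z sz zxy {rz} ez => [|j []] // _ ; rewrite sub1seq word_elt1 eyx => jx /simple_refl_inj ji.
by move: jx; rewrite mem_cat mem_rev ji (negPf ix) /= => /(mem_subseq yx); rewrite (negPf ix).
Qed.
End CoxeterTheory.

(** * Cyclically decreasing and increasing words *)

Lemma index_filter_lt (T : eqType) (p : pred T) (a b : T) (x : seq T) : p a -> p b ->
  (index a (filter p x) < index b (filter p x))%N = (index a x < index b x)%N.
Proof.
move=> pa pb; elim: x => //= c x IH; case: ifP => [pc|npc] /=.
  by case: (c == a); case: (c == b); rewrite ?ltnS ?IH.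
have -> : (c == a) = false by apply/eqP => ca; rewrite ca pa in npc.
by have -> : (c == b) = false by apply/eqP => cb; rewrite cb pb in npc.
Qed.

Lemma perm_enumP (T : finType) (J : {set T}) (w : seq T) :
  perm_eq w (enum J) <-> uniq w /\ w =i J.
Proof.
split=> [p|[u e]]; last first.
  by apply: uniq_perm; rewrite ?enum_uniq // => j; rewrite e mem_enum.
by rewrite (perm_uniq p) enum_uniq; split=> // j; rewrite (perm_mem p) mem_enum.
Qed.

Section CyclicWords.
Variable n : nat.
Implicit Types (x y z w : seq 'Z_n) (i j t : 'Z_n) (J K : {set 'Z_n}).

Local Notation s := (@simple_refl n).
Local Notation elt := (@word_elt n).

Lemma word_elt_comm i y : {in y, forall k, ~~ adjacent i k} ->
  (elt y * s i = s i * elt y)%g.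
Proof.
elim: y => [|k y IH] H; first by rewrite word_elt_nil mul1g mulg1.
rewrite word_elt_cons -mulgA IH; last by move=> l ly; apply: H; rewrite inE ly orbT.
by rewrite !mulgA (@simple_refl_comm n i k) // H // mem_head.
Qed.

Lemma word_elt_order x y : uniq x -> perm_eq x y ->
  (forall j, j \in x -> j + 1 \in x ->
     (index j x < index (j + 1)%R x)%N = (index j y < index (j + 1)%R y)%N) ->
  elt x = elt y.
Proof.
elim: x y => [|i x IH] y ux p H.
  by move: p; rewrite perm_sym => /perm_nilP ->.
have iy : i \in y by rewrite -(perm_mem p) mem_head.
have uy : uniq y by rewrite -(perm_uniq p).
case/splitPr: iy p uy H => y1 y2 p uy H.
have [iy1 iy2] : i \notin y1 /\ i \notin y2.
  by move: uy; rewrite cat_uniq /= negb_or => /and4P[_ /andP[? _] ? _].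
have comm : {in y1, forall k, ~~ adjacent i k}.
  move=> k ky1; have kx : k \in i :: x by rewrite (perm_mem p) mem_cat ky1.
  have ki : i != k by apply: contraNneq iy1 => ->.
  have ik : index k (y1 ++ i :: y2) = index k y1 by rewrite index_cat ky1.
  have ii : index i (y1 ++ i :: y2) = size y1.
    by rewrite index_cat (negPf iy1) /= eqxx addn0.
  have lt : (index k y1 < size y1)%N by rewrite index_mem.
  apply/negP => /orP[] /eqP e.
    have := H k kx; rewrite -e => /(_ (mem_head _ _)).
    by rewrite ik ii lt /= eqxx ltn0.
  have := H i (mem_head _ _); rewrite -e => /(_ kx).
  by rewrite ik ii /= eqxx (negPf ki) ltn0Sn ltnNge (ltnW lt).
rewrite word_elt_cat !word_elt_cons mulgA word_elt_comm // -mulgA -word_elt_cat.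
congr (_ * _)%g; move: ux => /= /andP[ix ux].
have ef : y1 ++ y2 = filter (predC1 i) (y1 ++ i :: y2).
  rewrite filter_cat /= eqxx /=; congr (_ ++ _); apply/esym/all_filterP/allP => k kin /=.
    by apply: contraNneq iy1 => <-.
  by apply: contraNneq iy2 => <-.
apply: IH => //.
  by rewrite -(perm_cons i) (perm_trans p) // perm_catC /= perm_cons perm_catC.
move=> j jx j1x.
have ji : i != j by apply: contraNneq ix => ->.
have j1i : i != j + 1 by apply: contraNneq ix => ->.
have := H j; rewrite !inE jx j1x !orbT => /(_ isT isT).
rewrite /= (negPf ji) (negPf j1i) ltnS => ->.
by rewrite ef index_filter_lt //= eq_sym.
Qed.

Lemma succ_exit J : J != set0 -> J != setT -> exists2 t, t \in J & t + 1 \notin J.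
Proof.
case/set0Pn => t0 t0J JT; apply/exists_inP; apply: contraNT JT.
rewrite negb_exists_in => /forall_inP H; rewrite -subTset; apply/subsetP => j _.
by apply: (Zn_succ_closed t0J) => k /H; rewrite negbK.
Qed.

Lemma pred_exit J : J != set0 -> J != setT -> exists2 t, t \in J & t - 1 \notin J.
Proof.
move=> J0 JT; have [|| c] := @succ_exit (~: J); rewrite ?inE.
- by rewrite -setCT (inj_eq (@setC_inj _)).
- by rewrite -setC0 (inj_eq (@setC_inj _)).
by rewrite negbK => cJ c1J; exists (c + 1); rewrite // addrK.
Qed.

Lemma setU1_neqT t J : t + 1 \notin J -> t |: J != setT.
Proof.
apply: contraNneq => e; have := in_setT (t + 1).
by rewrite -e !inE (negPf (Zn_S_neq t)).
Qed.

Lemma setU1_neqT' t J : t - 1 \notin J -> t |: J != setT.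
Proof.
apply: contraNneq => e; have := in_setT (t - 1); rewrite -e !inE.
by rewrite -[X in _ == X](subrK 1) eq_sym (negPf (Zn_S_neq _)).
Qed.

Let cons_perm t J w : perm_eq w (enum J) -> t \notin J ->
  perm_eq (t :: w) (enum (t |: J)).
Proof.
case/perm_enumP => u e tJ; apply/perm_enumP; rewrite /= u e tJ; split=> // j.
by rewrite !inE e.
Qed.

Let rcons_perm t J w : perm_eq w (enum J) -> t \notin J ->
  perm_eq (rcons w t) (enum (t |: J)).
Proof. by move=> p tJ; rewrite perm_rcons cons_perm. Qed.

Let index_consE t w j : j != t -> index j (t :: w) = (index j w).+1.
Proof. by move=> jt; rewrite /= eq_sym (negPf jt). Qed.

Let index_rconsE t w j : j \in w -> index j (rcons w t) = index j w.
Proof. by move=> jw; rewrite -cats1 index_cat jw. Qed.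

Let index_rconst t w : t \notin w -> index t (rcons w t) = size w.
Proof. by move=> tw; rewrite -cats1 index_cat (negPf tw) /= eqxx addn0. Qed.

Lemma dec_cons t J w : is_decreasing_word J w -> t \notin J -> t + 1 \notin J ->
  is_decreasing_word (t |: J) (t :: w).
Proof.
case=> p H tJ t1J; split; first exact: cons_perm.
move=> j; rewrite !in_setU1 => /predU1P[->|jJ].
  by rewrite (negPf t1J) (negPf (Zn_S_neq t)).
have jt : j != t by apply: contraNneq tJ => <-.
rewrite (index_consE _ jt); case/predU1P => [->|j1J]; first by rewrite /= eqxx.
by rewrite index_consE ?ltnS ?H //; apply: contraNneq tJ => <-.
Qed.

Lemma dec_rcons t J w : is_decreasing_word J w -> t \notin J -> t - 1 \notin J ->
  is_decreasing_word (t |: J) (rcons w t).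
Proof.
case=> p H tJ t1J; have [_ e] := (perm_enumP _ _).1 p; split; first exact: rcons_perm.
move=> j; rewrite !in_setU1 => jt1 /predU1P[j1t|j1J].
  case/predU1P: jt1 => [jt|jJ]; first by move/eqP: j1t; rewrite jt (negPf (Zn_S_neq t)).
  by move: t1J; rewrite -j1t addrK jJ.
rewrite index_rconsE ?e //; case/predU1P: jt1 => [jt|jJ]; last by rewrite index_rconsE ?e ?H.
by rewrite jt index_rconst ?e // index_mem e -jt.
Qed.

Lemma inc_cons t J w : is_increasing_word J w -> t \notin J -> t - 1 \notin J ->
  is_increasing_word (t |: J) (t :: w).
Proof.
case=> p H tJ t1J; split; first exact: cons_perm.
move=> j; rewrite !in_setU1 => jt1 /predU1P[j1t|j1J].
  case/predU1P: jt1 => [jt|jJ]; first by move/eqP: j1t; rewrite jt (negPf (Zn_S_neq t)).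
  by move: t1J; rewrite -j1t addrK jJ.
have jt : j + 1 != t by apply: contraNneq tJ => <-.
rewrite (index_consE _ jt); case/predU1P: jt1 => [->|jJ]; first by rewrite /= eqxx.
by rewrite index_consE ?ltnS ?H //; apply: contraNneq tJ => <-.
Qed.

Lemma inc_rcons t J w : is_increasing_word J w -> t \notin J -> t + 1 \notin J ->
  is_increasing_word (t |: J) (rcons w t).
Proof.
case=> p H tJ t1J; have [_ e] := (perm_enumP _ _).1 p; split; first exact: rcons_perm.
move=> j; rewrite !in_setU1 => /predU1P[->|jJ].
  by rewrite (negPf t1J) (negPf (Zn_S_neq t)).
rewrite (index_rconsE _ (_ : j \in w)) ?e //; case/predU1P => [jt|j1J].
  by rewrite jt index_rconst ?e // index_mem e.
by rewrite index_rconsE ?e ?H.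
Qed.

Lemma dec_word_exists J : J != setT -> exists w, is_decreasing_word J w.
Proof.
move: {2}(#|J|) (leqnn #|J|) => k; elim: k J => [|k IH] J.
  rewrite leqn0 cards_eq0 => /eqP -> _; exists [::]; split; first by rewrite enum_set0.
  by move=> j; rewrite inE.
have [-> _ _|J0 le JT] := eqVneq J set0.
  by exists [::]; split; [rewrite enum_set0|move=> j; rewrite inE].
have [t tJ t1J] := succ_exit J0 JT.
have [|| w wd] := IH (J :\ t).
- by move: le; rewrite (cardsD1 t) tJ.
- by apply: contraNneq JT => e; rewrite -subTset -e subD1set.
exists (t :: w); rewrite -(setD1K tJ); apply: dec_cons => //; rewrite !inE ?eqxx //.
by rewrite (negPf t1J) andbF.
Qed.

Lemma inc_word_exists J : J != setT -> exists w, is_increasing_word J w.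
Proof.
move: {2}(#|J|) (leqnn #|J|) => k; elim: k J => [|k IH] J.
  rewrite leqn0 cards_eq0 => /eqP -> _; exists [::]; split; first by rewrite enum_set0.
  by move=> j; rewrite inE.
have [-> _ _|J0 le JT] := eqVneq J set0.
  by exists [::]; split; [rewrite enum_set0|move=> j; rewrite inE].
have [t tJ t1J] := pred_exit J0 JT.
have [|| w wd] := IH (J :\ t).
- by move: le; rewrite (cardsD1 t) tJ.
- by apply: contraNneq JT => e; rewrite -subTset -e subD1set.
exists (t :: w); rewrite -(setD1K tJ); apply: inc_cons => //; rewrite !inE ?eqxx //.
by rewrite (negPf t1J) andbF.
Qed.

Lemma dec_word_elt J w : is_decreasing_word J w -> elt w = d_ J.
Proof.
move=> wd; have [p0 H0] : is_decreasing_word J (xget [::] [set w | is_decreasing_word J w]%classic).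
  exact: (xgetPex [::] (ex_intro _ w wd)).
case: wd => p H; have [u e] := (perm_enumP _ _).1 p; rewrite /d_; apply: word_elt_order => //.
  by rewrite (perm_trans p) // perm_sym.
move=> j; rewrite !e => jJ j1J; rewrite ltnNge (ltnW (H _ jJ j1J)).
by rewrite ltnNge (ltnW (H0 _ jJ j1J)).
Qed.

Lemma inc_word_elt J w : is_increasing_word J w -> elt w = u_ J.
Proof.
move=> wd; have [p0 H0] : is_increasing_word J (xget [::] [set w | is_increasing_word J w]%classic).
  exact: (xgetPex [::] (ex_intro _ w wd)).
case: wd => p H; have [u e] := (perm_enumP _ _).1 p; rewrite /u_; apply: word_elt_order => //.
  by rewrite (perm_trans p) // perm_sym.
by move=> j; rewrite !e => jJ j1J; rewrite H ?H0.
Qed.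

Lemma dec_word_reduced J w : is_decreasing_word J w -> reduced w.
Proof. by case=> /perm_enumP[u _] _; apply: uniq_reduced. Qed.

Lemma inc_word_reduced J w : is_increasing_word J w -> reduced w.
Proof. by case=> /perm_enumP[u _] _; apply: uniq_reduced. Qed.

Lemma size_perm_enum J w : perm_eq w (enum J) -> size w = #|J|.
Proof. by move/perm_size ->; rewrite cardE. Qed.

Lemma cox_length_d J : J != setT -> cox_length (d_ J) = #|J|.
Proof.
case/dec_word_exists => w wd; rewrite -(dec_word_elt wd) -(eqP (dec_word_reduced wd)).
by case: wd => /size_perm_enum.
Qed.

Lemma cox_length_u J : J != setT -> cox_length (u_ J) = #|J|.
Proof.
case/inc_word_exists => w wd; rewrite -(inc_word_elt wd) -(eqP (inc_word_reduced wd)).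
by case: wd => /size_perm_enum.
Qed.

Lemma A_d J w : is_decreasing_word J w -> A_ (d_ J) = A_word w.
Proof. by move=> wd; rewrite -(dec_word_elt wd) A_elt // (dec_word_reduced wd). Qed.

Lemma A_u J w : is_increasing_word J w -> A_ (u_ J) = A_word w.
Proof. by move=> wd; rewrite -(inc_word_elt wd) A_elt // (inc_word_reduced wd). Qed.

Local Opaque A_gen A_ d_ u_ A_word.

Lemma notin_neqT t J : t \notin J -> J != setT.
Proof. by apply: contraNneq => ->; rewrite inE. Qed.

Lemma A_d_consl t J : t \notin J -> t + 1 \notin J ->
  A_ (d_ (t |: J)) = A_gen t * A_ (d_ J).
Proof.
move=> tJ t1J; have [w wd] := dec_word_exists (notin_neqT tJ).
by rewrite (A_d wd) (A_d (dec_cons wd tJ t1J)) A_word_cons.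
Qed.

Lemma A_u_consl t J : t \notin J -> t - 1 \notin J ->
  A_ (u_ (t |: J)) = A_gen t * A_ (u_ J).
Proof.
move=> tJ t1J; have [w wd] := inc_word_exists (notin_neqT tJ).
by rewrite (A_u wd) (A_u (inc_cons wd tJ t1J)) A_word_cons.
Qed.

Lemma A_u_consr t J : t \notin J -> t + 1 \notin J ->
  A_ (u_ (t |: J)) = A_ (u_ J) * A_gen t.
Proof.
move=> tJ t1J; have [w wd] := inc_word_exists (notin_neqT tJ).
by rewrite (A_u wd) (A_u (inc_rcons wd tJ t1J)) -cats1 A_word_cat A_word1.
Qed.

Lemma A_d0 : A_ (d_ (set0 : {set 'Z_n})) = 1.
Proof.
have wd : is_decreasing_word (set0 : {set 'Z_n}) [::].
  by split; [rewrite enum_set0|move=> j; rewrite inE].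
by rewrite (A_d wd) A_word_nil.
Qed.

Lemma A_u0 : A_ (u_ (set0 : {set 'Z_n})) = 1.
Proof.
have wd : is_increasing_word (set0 : {set 'Z_n}) [::].
  by split; [rewrite enum_set0|move=> j; rewrite inE].
by rewrite (A_u wd) A_word_nil.
Qed.

Lemma A_ud_move t K J : t \notin K -> t \notin J -> t + 1 \notin K -> t + 1 \notin J ->
  A_ (u_ (t |: K)) * A_ (d_ J) = A_ (u_ K) * A_ (d_ (t |: J)).
Proof. by move=> tK tJ t1K t1J; rewrite (A_u_consr tK t1K) (A_d_consl tJ t1J) mulrA. Qed.

Lemma A_ud_double t K J : t \notin K -> t \notin J -> t + 1 \notin K -> t + 1 \notin J ->
  A_ (u_ (t |: K)) * A_ (d_ (t |: J)) = 0.
Proof.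
move=> tK tJ t1K t1J; rewrite (A_u_consr tK t1K) (A_d_consl tJ t1J).
by rewrite -mulrA (mulrA (A_gen t)) A_gen_sqr mul0r mulr0.
Qed.

End CyclicWords.

(** * The elements [e_r] of the Fomin-Stanley subalgebra *)

(** [Q] marks one term of each pair: marked terms are matched with unmarked ones, and no factor 2
    has to be cancelled in [V]. *)
Lemma sum_involution (I : finType) (V : zmodType) (P Q : pred I) (F : I -> V) (f : I -> I) :
    (forall p, P p -> [/\ P (f p), f (f p) = p, Q (f p) = ~~ Q p & F (f p) = - F p]) ->
  \sum_(p | P p) F p = 0.
Proof.
move=> H; rewrite (bigID Q) /= [X in _ + X](reindex_onto f f) /=; last first.
  by move=> p /andP[/H[_ -> _ _]].
rewrite [X in _ + X](eq_bigl (fun p => P p && Q p)); last first.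
  move=> p; apply/idP/idP => [/andP[/andP[Pf nQ] /eqP ff]|/andP[Pp Qp]].
    by have [Pff fff Qf _] := H _ Pf; move: Pff Qf; rewrite ff (negPf nQ) => -> ->.
  by have [-> -> -> _] := H p Pp; rewrite Qp eqxx.
by rewrite -big_split big1 //= => p /andP[/H[_ _ _ ->] _]; rewrite subrr.
Qed.

Section SubringGen.
Variables (R : pzRingType) (G : R -> Prop).

Lemma subring_gen0 : subring_gen G 0.
Proof. by rewrite -(subrr 1); apply: Subring_B; apply: Subring_1. Qed.

Lemma subring_genN x : subring_gen G x -> subring_gen G (- x).
Proof. by move=> Gx; rewrite -sub0r; apply: Subring_B => //; apply: subring_gen0. Qed.

Lemma subring_genD x y : subring_gen G x -> subring_gen G y -> subring_gen G (x + y).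
Proof. by move=> Gx Gy; rewrite -(opprK y); apply/Subring_B/subring_genN. Qed.

Lemma subring_gen_sign k x : subring_gen G x -> subring_gen G ((-1) ^+ k * x).
Proof.
move=> Gx; rewrite -signr_odd; case: (odd k); rewrite ?expr0 ?mul1r //.
by rewrite expr1 mulN1r; apply: subring_genN.
Qed.

Lemma subring_gen_sum (I : Type) (r : seq I) (P : pred I) (F : I -> R) :
  (forall i, P i -> subring_gen G (F i)) -> subring_gen G (\sum_(i <- r | P i) F i).
Proof. by move=> H; apply: big_ind => //; [exact: subring_gen0|exact: subring_genD]. Qed.

Lemma two_sided_ideal_sum (I : Type) (r : seq I) (P : pred I) (F : I -> R) :
  (forall i, P i -> two_sided_ideal G (F i)) ->
  two_sided_ideal G (\sum_(i <- r | P i) F i).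
Proof. by move=> H; apply: big_ind => //; [exact: Ideal_0|exact: two_sided_idealD]. Qed.

Lemma two_sided_idealMl a x : two_sided_ideal G x -> two_sided_ideal G (a * x).
Proof. by move=> Gx; rewrite -[a * x]mulr1; apply: Ideal_M. Qed.

Lemma two_sided_idealMr a x : two_sided_ideal G x -> two_sided_ideal G (x * a).
Proof. by move=> Gx; rewrite -[x]mul1r; apply: Ideal_M. Qed.

End SubringGen.

Definition toggle (T : finType) (t : T) (A : {set T}) :=
  if t \in A then A :\ t else t |: A.

Lemma toggleK (T : finType) (t : T) : involutive (toggle t).
Proof.
move=> A; rewrite {2}/toggle; case: ifP => tA; rewrite /toggle !inE eqxx ?tA /=.
  exact: setD1K.
exact/setU1K/negbT.
Qed.

Lemma in_toggle (T : finType) (t j : T) (A : {set T}) :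
  (j \in toggle t A) = (j == t) (+) (j \in A).
Proof.
rewrite /toggle; case: ifP => tA; rewrite !inE; case: eqP => [->|] //=.
  by rewrite tA.
by rewrite tA.
Qed.

Section FominStanley.
Variable n : nat.
Hypothesis n_gt1 : (1 < n)%N.
Implicit Types (x y z w : seq 'Z_n) (i j t : 'Z_n) (J K : {set 'Z_n}).

Local Notation elt := (@word_elt n).
Local Notation uA := (fun K : {set 'Z_n} => A_ (u_ K)).
Local Notation dA := (fun J : {set 'Z_n} => A_ (d_ J)).

Local Opaque A_gen A_ d_ u_ A_word.

Lemma card_Zn : #|'Z_n| = n.
Proof. by rewrite card_ord Zp_cast. Qed.

Lemma card_setC_Zn J : #|~: J| = (n - #|J|)%N.
Proof. by rewrite cardsCs setCK card_Zn. Qed.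

Definition e_ (r : nat) : nilCoxeter n := \sum_(K : {set 'Z_n} | #|K| == r) A_ (u_ K).

(** The letter to be toggled is a function of the union [K :|: J] alone. Toggling a letter that lies
    in exactly one of the two sets preserves the union, so the same letter is chosen again and the
    toggling is an involution. *)
Definition exit_elt (U : {set 'Z_n}) : 'Z_n := odflt 0 [pick t in U | t + 1 \notin U].

Lemma exit_eltP (U : {set 'Z_n}) : U != set0 -> U != setT ->
  exit_elt U \in U /\ exit_elt U + 1 \notin U.
Proof.
move=> U0 UT; rewrite /exit_elt; case: pickP => [t /andP[]//|H].
by have [t tU t1U] := succ_exit U0 UT; have := H t; rewrite tU t1U.
Qed.

Lemma eh_pairs_sum (r : nat) : (0 < r < n)%N ->
  \sum_(p : {set 'Z_n} * {set 'Z_n} | (#|p.1| + #|p.2| == r)%N)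
     (-1) ^+ #|p.1| * (uA p.1 * dA p.2) = 0 :> nilCoxeter n.
Proof.
case/andP=> r0 rn.
pose t (p : {set 'Z_n} * {set 'Z_n}) := exit_elt (p.1 :|: p.2).
have tP (p : {set 'Z_n} * {set 'Z_n}) : (#|p.1| + #|p.2| == r)%N ->
    [/\ (t p \in p.1) || (t p \in p.2), t p + 1 \notin p.1 & t p + 1 \notin p.2].
  move=> /eqP cp; have [||] := @exit_eltP (p.1 :|: p.2).
  - apply: contraTneq r0 => /eqP; rewrite setU_eq0 => /andP[/eqP e1 /eqP e2].
    by rewrite -cp e1 e2 !cards0.
  - apply: contraTneq rn => e; rewrite -leqNgt -card_Zn -cardsT -e -cp.
    by rewrite cardsU leq_subr.
  by rewrite !inE negb_or => -> /andP[].
rewrite (bigID (fun p => (t p \in p.1) (+) (t p \in p.2))) /= [X in _ + X]big1 ?addr0; last first.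
  move=> p /andP[cp tt]; have [] := tP p cp; move: tt.
  case: (boolP (t p \in p.1)) => t1; case: (boolP (t p \in p.2)) => t2 // _ _ n1 n2.
  rewrite -(setD1K t1) -(setD1K t2) A_ud_double ?mulr0 // !inE ?eqxx // ?(negPf n1) ?(negPf n2) ?andbF //.
pose f p := (toggle (t p) p.1, toggle (t p) p.2).
apply: (sum_involution (f := f) (Q := fun p => t p \in p.1)) => -[K J] /andP[cp tt].
have [_ t1K t1J] := tP _ cp; rewrite /f /=.
set u := t (K, J) in tt t1K t1J *; rewrite /= in tt t1K t1J cp.
have Uf : toggle u K :|: toggle u J = K :|: J.
  apply/setP => j; rewrite !inE !in_toggle; case: eqP => [->|] //=.
  by move: tt; case: (u \in K); case: (u \in J).
have tf : t (toggle u K, toggle u J) = u by rewrite /t /= Uf.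
rewrite tf !toggleK !in_toggle eqxx /=.
have Kj : u \in K -> (u \in J) = false by move: tt => /[swap] -> /negPf.
have nKj : u \notin K -> u \in J by move: tt => /[swap] /negPf ->.
case: (boolP (u \in K)) => uK.
  have uJ := Kj uK; have eK : toggle u K = K :\ u by rewrite /toggle uK.
  have eJ : toggle u J = u |: J by rewrite /toggle uJ.
  have cK : #|K| = #|K :\ u|.+1 by rewrite (cardsD1 u) uK.
  have cJ : #|u |: J| = #|J|.+1 by rewrite cardsU1 uJ.
  rewrite eK eJ; split=> //.
  - by rewrite cJ addnS -addSn -cK cp uJ.
  - rewrite -A_ud_move ?uJ //; last by rewrite !inE (negPf t1K) andbF.
      by rewrite setD1K // cK exprS mulN1r mulNr opprK.
    by rewrite !inE eqxx.
have uJ := nKj uK; have eK : toggle u K = u |: K by rewrite /toggle (negPf uK).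
have eJ : toggle u J = J :\ u by rewrite /toggle uJ.
have cJ : #|J| = #|J :\ u|.+1 by rewrite (cardsD1 u) uJ.
have cK : #|u |: K| = #|K|.+1 by rewrite cardsU1 uK.
rewrite eK eJ; split=> //.
- by rewrite cK addSnnS -cJ cp uJ.
- rewrite A_ud_move //; first last.
  + by rewrite !inE (negPf t1J) andbF.
  + by rewrite !inE eqxx.
  by rewrite setD1K // cK exprS mulN1r mulNr.
Qed.

Lemma e_h_pairs a b :
  e_ a * h_ n b = \sum_(p : {set 'Z_n} * {set 'Z_n} | (#|p.1| == a) && (#|p.2| == b)) uA p.1 * dA p.2.
Proof.
rewrite /e_ /h_ mulr_suml; under eq_bigr do rewrite mulr_sumr.
exact: pair_big.
Qed.

Lemma e_h_rel (r : nat) : (0 < r < n)%N ->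
  \sum_(a < r.+1) (-1) ^+ a * (e_ a * h_ n (r - a)) = 0.
Proof.
move=> hr; rewrite -[RHS](eh_pairs_sum hr).
rewrite (partition_big (fun p : {set 'Z_n} * {set 'Z_n} => inord #|p.1| : 'I_r.+1) predT) //=.
apply: eq_bigr => a _; rewrite e_h_pairs mulr_sumr.
rewrite [RHS](eq_bigl (fun p : {set 'Z_n} * {set 'Z_n} => (#|p.1| == a) && (#|p.2| == (r - a)%N))).
  by apply: eq_bigr => -[K J] /andP[/eqP /= -> _].
move=> [K J] /=; apply/esym.
apply/andP/andP => [[/eqP eK /eqP eJ]|[/eqP e /eqP ea]].
  have la := ltn_ord a; split; first by apply/eqP; lia.
  by apply/eqP/val_inj; rewrite /= inordK ?eK.
have Kr : (#|K| < r.+1)%N by rewrite ltnS -e leq_addr.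
by move: ea => /(congr1 val); rewrite /= inordK // => <-; split=> //; rewrite -e addKn.
Qed.

Lemma h0E : h_ n 0 = 1.
Proof.
rewrite /h_ (big_pred1 set0) ?A_d0 // => J; exact: cards_eq0.
Qed.

Lemma e0E : e_ 0 = 1.
Proof.
rewrite /e_ (big_pred1 set0) ?A_u0 // => J; exact: cards_eq0.
Qed.

Lemma e_fomin_stanley (r : nat) : (r < n)%N -> fomin_stanley (e_ r).
Proof.
elim/ltn_ind: r => r IH rn; case: r => [|r] in IH rn *; first by rewrite e0E; apply: Subring_1.
have := @e_h_rel r.+1; rewrite rn => /(_ isT); rewrite big_ord_recr /= subnn h0E mulr1.
move/eqP; rewrite addrC addr_eq0 => /eqP /(congr1 (fun c => (-1) ^+ r.+1 * c)).
rewrite signrMK => ->.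
apply/subring_gen_sign/subring_genN/subring_gen_sum => a _; apply: subring_gen_sign.
have la := ltn_ord a; apply: Subring_M; first by apply: IH => //; lia.
by apply: Subring_gen; exists (r.+1 - a)%N => //; lia.
Qed.

Lemma ribbon_word J w1 w2 : is_increasing_word (~: J) w1 -> is_decreasing_word J w2 ->
  [/\ uniq (w1 ++ w2), elt (w1 ++ w2) = ribbon_of J & w1 ++ w2 =i predT].
Proof.
move=> i1 d2; have [[/perm_enumP[u1 e1] _] [/perm_enumP[u2 e2] _]] := (i1, d2).
split.
- rewrite cat_uniq u1 u2 andbT /=; apply/hasPn => j; rewrite e2 e1 inE => ->.
  by [].
- by rewrite word_elt_cat (inc_word_elt i1) (dec_word_elt d2).
- by move=> j; rewrite mem_cat e1 e2 !inE orNb.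
Qed.

Lemma A_ribbon J : J != set0 -> J != setT ->
  A_ (ribbon_of J) = A_ (u_ (~: J)) * A_ (d_ J).
Proof.
move=> J0 JT; have [w2 d2] := dec_word_exists JT.
have [|w1 i1] := @inc_word_exists n (~: J); first by rewrite -setC0 (inj_eq (@setC_inj _)).
have [u <- _] := ribbon_word i1 d2.
by rewrite (A_elt (uniq_reduced u)) A_word_cat (A_u i1) (A_d d2).
Qed.

Variable m : nat.
Hypotheses (m_gt0 : (0 < m)%N) (m_ltn : (m < n)%N).

Local Notation ideal := (two_sided_ideal (@Amn_rel n m)).

Lemma A_d_ideal J : J != setT -> (n - m < #|J|)%N -> ideal (A_ (d_ J)).
Proof.
by move=> JT c; apply: Ideal_gen; apply: Amn_dec; [exists J|rewrite cox_length_d].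
Qed.

Lemma A_u_ideal J : J != setT -> (m < #|J|)%N -> ideal (A_ (u_ J)).
Proof.
by move=> JT c; apply: Ideal_gen; apply: Amn_inc; [exists J|rewrite cox_length_u].
Qed.

Lemma A_ud_ideal K J : #|K| = m -> #|J| = (n - m)%N -> K :|: J != setT ->
  ideal (A_ (u_ K) * A_ (d_ J)).
Proof.
move=> cK cJ UT.
have [|t] := succ_exit _ UT.
  by rewrite setU_eq0 negb_and -!cards_eq0 cK -lt0n m_gt0.
rewrite !inE negb_or => tU /andP[t1K t1J].
have t1D (A : {set 'Z_n}) : t + 1 \notin A -> t + 1 \notin A :\ t by rewrite !inE => /negPf ->; rewrite andbF.
have tD (A : {set 'Z_n}) : t \notin A :\ t by rewrite !inE eqxx.
case: (boolP (t \in K)) => tK; case: (boolP (t \in J)) => tJ.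
- rewrite -(setD1K tK) -(setD1K tJ) A_ud_double ?tD ?t1D //; exact: Ideal_0.
- rewrite -(setD1K tK) A_ud_move ?tD ?t1D //; apply/two_sided_idealMl/A_d_ideal.
    exact: setU1_neqT.
  by rewrite cardsU1 tJ cJ.
- rewrite -(setD1K tJ) -A_ud_move ?tD ?t1D //; apply/two_sided_idealMr/A_u_ideal.
    exact: setU1_neqT.
  by rewrite cardsU1 tK cK.
- by move: tU; rewrite (negPf tK) (negPf tJ).
Qed.

Lemma e_h_ideal :
  ideal (e_ m * h_ n (n - m) - \sum_(J : {set 'Z_n} | #|J| == (n - m)%N) A_ (ribbon_of J)).
Proof.
rewrite /e_ /h_ mulr_sumr -sumrB; apply: two_sided_ideal_sum => J /eqP cJ.
have J0 : J != set0 by rewrite -cards_eq0 cJ; lia.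
have JT : J != setT by apply: contraTneq m_gt0 => e; move: cJ; rewrite e cardsT card_Zn; lia.
rewrite mulr_suml (bigD1 (~: J)) /=; last first.
  by rewrite card_setC_Zn cJ subKn // ltnW.
rewrite A_ribbon // addrAC subrr add0r; apply: two_sided_ideal_sum => K /andP[/eqP cK KJ].
apply: A_ud_ideal => //; apply: contraNneq KJ => UT; rewrite eqEcard.
have cU : #|K :|: J| = n by rewrite UT cardsT card_Zn.
have cI : #|K :&: J| = 0%N.
  by apply/eqP; rewrite -(eqn_add2l n) addn0 -{1}cU cardsUI cK cJ subnKC // ltnW.
rewrite -disjoints_subset -setI_eq0 -cards_eq0 cI /=.
by rewrite card_setC_Zn cJ cK subKn // ltnW.
Qed.

Lemma ribbon_ideal J : J != set0 -> J != setT -> #|J| <> (n - m)%N -> ideal (A_ (ribbon_of J)).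
Proof.
move=> J0 JT cJ; rewrite A_ribbon //; have [lt|le] := ltnP (n - m) #|J|.
  exact/two_sided_idealMl/A_d_ideal.
apply/two_sided_idealMr/A_u_ideal; first by rewrite -setC0 (inj_eq (@setC_inj _)).
by rewrite card_setC_Zn; lia.
Qed.

End FominStanley.

(** * Grassmannian terms of [e_m h_(n-m)] *)

Section Intervals.
Variable n : nat.
Hypothesis n_gt1 : (1 < n)%N.
Implicit Types (x y z w : seq 'Z_n) (i j t : 'Z_n) (J K : {set 'Z_n}) (k l : nat).

Local Notation s := (@simple_refl n).
Local Notation elt := (@word_elt n).

Lemma val_natr_Zn k : (k < n)%N -> val (k%:R : 'Z_n) = k.
Proof. by move=> kn; rewrite [LHS]val_Zp_nat // modn_small. Qed.

Lemma val_ltn_Zn j : (val j < n)%N.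
Proof. by have := ltn_ord j; rewrite [X in (_ < X)%N]Zp_cast. Qed.

Lemma natr_val_Zn j : (val j)%:R = j.
Proof. exact: natr_Zp. Qed.

Lemma natr_n_Zn : n%:R = 0 :> 'Z_n.
Proof. exact: pchar_Zp. Qed.

Lemma natr_eq_Zn k l : (k < n)%N -> (l < n)%N -> (k%:R == l%:R :> 'Z_n) = (k == l).
Proof. by move=> kn ln; rewrite -val_eqE !val_natr_Zn. Qed.

Lemma natr_adjacent_Zn k l : (k < n)%N -> (l < n)%N ->
  adjacent (k%:R : 'Z_n) l%:R -> [|| k == l.+1, l == k.+1, (k == 0%N) && (l.+1 == n) | (l == 0%N) && (k.+1 == n)].
Proof.
have aux (a b : nat) : (a < n)%N -> (b < n)%N -> a%:R == b%:R + 1 :> 'Z_n ->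
    (a == b.+1) || (a == 0%N) && (b.+1 == n).
  move=> an bn; rewrite natr1; case: (ltngtP b.+1 n) => [lt|gt|e].
  - by rewrite natr_eq_Zn // andbF orbF.
  - by lia.
  - by rewrite e natr_n_Zn -[0]/(0%:R) natr_eq_Zn ?andbT; [move=> ->; rewrite orbT|lia|lia].
move=> kn ln /orP[/(aux _ _ kn ln)|/(aux _ _ ln kn)] /orP[->|->]; by rewrite ?orbT.
Qed.

Definition initial l : {set 'Z_n} := [set j : 'Z_n | (val j < l)%N].
Definition dec_iota l : seq 'Z_n := [seq (j : nat)%:R | j : nat <- rev (iota 0 l)].

Lemma dec_iotaS l : dec_iota l.+1 = l%:R :: dec_iota l.
Proof. by rewrite /dec_iota -(addn1 l) iotaD rev_cat. Qed.

Lemma natr_in_initial k l : (k < n)%N -> (k%:R \in initial l) = (k < l)%N.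
Proof. by move=> kn; rewrite inE [val _]val_natr_Zn. Qed.

Lemma initialS l : (l < n)%N -> initial l.+1 = l%:R |: initial l.
Proof.
move=> ln; apply/setP => j; rewrite -(natr_val_Zn j) in_setU1 !natr_in_initial ?val_ltn_Zn //.
by rewrite natr_eq_Zn ?val_ltn_Zn // ltnS leq_eqVlt.
Qed.

Lemma dec_iotaP l : (l < n)%N -> is_decreasing_word (initial l) (dec_iota l).
Proof.
elim: l => [|l IH] ln.
  have -> : initial 0 = set0 by apply/setP => j; rewrite !inE.
  by split; [rewrite enum_set0|move=> j; rewrite inE].
rewrite dec_iotaS initialS 1?ltnW //; apply: dec_cons; first exact/IH/ltnW.
  by rewrite natr_in_initial ?ltnn // ltnW.
by rewrite natr1 natr_in_initial // -leqNgt.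
Qed.

Lemma card_initial l : (l < n)%N -> #|initial l| = l.
Proof.
move/dec_iotaP => [/size_perm_enum <- _].
by rewrite size_map size_rev size_iota.
Qed.

(** Walking down from an element of [J], one can leave [J] only below [0]; so [J] contains all
    smaller residues. *)
Lemma initialP J : J != setT -> (forall i, i \in J -> i - 1 \notin J -> i = 0) ->
  J = initial #|J|.
Proof.
move=> JT H.
have down k : (k < n)%N -> k%:R \in J -> initial k.+1 \subset J.
  elim: k => [|k IH] kn kJ; rewrite initialS // subUset sub1set kJ /=.
    by apply/subsetP => j; rewrite inE.
  apply: IH; first exact: ltnW.
  case: (boolP (k%:R \in J)) => // nk; have := H _ kJ; rewrite -natr1 addrK => /(_ nk).
  by rewrite natr1 => /eqP; rewrite -[0]/(0%:R) natr_eq_Zn // ltnW.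
have cJ : (#|J| < n)%N.
  have : (#|J| < #|[set: 'Z_n]|)%N by rewrite proper_card // properT.
  by rewrite cardsT card_Zn.
apply/eqP; rewrite eqEcard card_initial // leqnn andbT; apply/subsetP => j jJ.
rewrite -(natr_val_Zn j) natr_in_initial ?val_ltn_Zn // ltnNge; apply/negP => cj.
have := @down (val j) (val_ltn_Zn j); rewrite natr_val_Zn jJ => /(_ isT) sub.
have : initial #|J|.+1 \subset J.
  apply: subset_trans sub; apply/subsetP => i; rewrite !inE !ltnS => /leq_trans; exact.
case: (ltnP #|J|.+1 n) => [lt|ge /subsetP sT].
  by move/subset_leq_card; rewrite card_initial // ltnn.
case/negP: JT; rewrite -subTset; apply/subsetP => i _; apply: sT.
by rewrite inE; apply: leq_trans ge; apply: val_ltn_Zn.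
Qed.

Definition inc_iota l : seq 'Z_n := [seq - (j : nat)%:R | j : nat <- rev (iota 1 l)].

Lemma inc_iotaP l : (l < n)%N -> is_increasing_word (~: initial (n - l)) (inc_iota l).
Proof.
elim: l => [|l IH] ln.
  have -> : ~: initial (n - 0) = set0.
    by apply/setP => j; rewrite !inE subn0 val_ltn_Zn.
  by split; [rewrite enum_set0|move=> j; rewrite inE].
have e : - l.+1%:R = (n - l.+1)%:R :> 'Z_n by rewrite natrB 1?ltnW // natr_n_Zn sub0r.
have -> : inc_iota l.+1 = (n - l.+1)%:R :: inc_iota l.
  by rewrite /inc_iota -(addn1 l) iotaD rev_cat /= add1n addn1 e.
have -> : ~: initial (n - l.+1) = (n - l.+1)%:R |: ~: initial (n - l).
  rewrite (_ : (n - l = (n - l.+1).+1)%N); last by lia.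
  rewrite initialS; last by lia.
  by rewrite setCU setUIr setUCr setTI setUC; apply/esym/setUidPl; rewrite sub1set inE natr_in_initial ?ltnn //; lia.
apply: inc_cons; first exact/IH/ltnW.
  by rewrite inE natr_in_initial ?negbK; lia.
rewrite -(_ : (n - l.+2)%:R = (n - l.+1)%:R - 1); last first.
  by apply/esym/eqP; rewrite subr_eq natr1; apply/eqP; congr (_%:R); lia.
by rewrite inE natr_in_initial ?negbK; lia.
Qed.

Lemma r_ribbon m : (0 < m)%N -> (m < n)%N -> r_ n m = ribbon_of (initial (n - m)).
Proof.
move=> m0 mn; rewrite /ribbon_of -(inc_word_elt (inc_iotaP mn)).
have lt : (n - m < n)%N by lia.
by rewrite -(dec_word_elt (dec_iotaP lt)) /word_elt /r_ !big_map.
Qed.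

End Intervals.

(** * Right descents of a reduced product [u_K d_J] *)

Section KSchur.
Variables n m : nat.
Hypotheses (n_gt1 : (1 < n)%N) (m_gt0 : (0 < m)%N) (m_ltn : (m < n)%N).
Implicit Types (x y z w : seq 'Z_n) (i j t b : 'Z_n) (J K : {set 'Z_n}) (k l : nat).

Local Notation s := (@simple_refl n).
Local Notation elt := (@word_elt n).
Local Notation lam := (n - m)%N.

Local Opaque A_gen A_ d_ u_ A_word.

(** The bound [k.+2 < n] keeps [k.+1] different from [-1], which is a cyclic neighbour of the letter
    [0]. *)
Lemma dec_iota_comm k l : (l < k.+1)%N -> (k.+2 < n)%N ->
  (elt (dec_iota n l) * s (k.+1)%:R = s (k.+1)%:R * elt (dec_iota n l))%g.
Proof.
move=> lk kn; apply: word_elt_comm => j /mapP[a]; rewrite mem_rev mem_iota => /andP[_ al] ->.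
have an : (a < n)%N by lia.
by apply/negP => /(natr_adjacent_Zn n_gt1 (ltnW kn) an); lia.
Qed.

(** A letter that crosses the decreasing word to the right meets one braid relation and comes out
    raised by one. This exhibits right descents other than [0]. *)
Lemma dec_iota_conj k l : (k.+1 < l)%N -> (l < n)%N ->
  (s k%:R * elt (dec_iota n l) = elt (dec_iota n l) * s (k.+1)%:R)%g.
Proof.
elim: l => // l IH; rewrite ltnS leq_eqVlt => /orP[/eqP <- {IH} ln|kl ln].
  have n2 : (2 < n)%N by lia.
  rewrite !dec_iotaS !word_elt_cons -!mulgA dec_iota_comm //.
  rewrite !mulgA; congr (_ * _)%g; rewrite -!mulgA -natr1.
  exact: simple_refl_braid.
rewrite dec_iotaS !word_elt_cons mulgA (@simple_refl_comm n k%:R l%:R); last first.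
  have kn : (k < n)%N by lia.
  by apply/negP => /(natr_adjacent_Zn n_gt1 kn (ltnW ln)); lia.
by rewrite -mulgA IH ?mulgA // ltnW.
Qed.

Variables (K J : {set 'Z_n}) (v : affS n) (wK wJ : seq 'Z_n).
Hypotheses (cK : #|K| = m) (cJ : #|J| = lam).
Hypotheses (iK : is_increasing_word K wK) (dJ : is_decreasing_word J wJ).
Hypotheses (red : reduced (wK ++ wJ)) (vE : elt (wK ++ wJ) = v) (vG : grassmannian0 v).

Let sizeE : size (wK ++ wJ) = n.
Proof.
have [[p1 _] [p2 _]] := (iK, dJ).
by rewrite size_cat (size_perm_enum p1) (size_perm_enum p2) cK cJ; lia.
Qed.

Let shortest y : elt y = v -> (n <= size y)%N.
Proof. by move=> e; have := (reducedP _).1 red y; rewrite sizeE; apply; rewrite e vE. Qed.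

Let last0 y b : elt (rcons y b) = v -> size y = n.-1 -> b = 0.
Proof.
move=> e sz; rewrite -(last_rcons 0 y b); apply: vG; last by case: (y).
split=> //; rewrite -vE -(eqP red) sizeE size_rcons sz; lia.
Qed.

Let JT : J != setT.
Proof. by apply: contraTneq m_gt0 => e; move: cJ; rewrite e cardsT card_Zn //; lia. Qed.

(** An [i] in [J] with [i - 1] outside [J] may be written last in [d_J]; it is then a right descent,
    hence [0]. *)
Lemma grassmannian_J : J = initial n lam.
Proof.
rewrite -cJ; apply: initialP => // i iJ i1J.
have [|w dw] := @dec_word_exists n (J :\ i).
  by apply: (@notin_neqT n i); rewrite !inE eqxx.
have dwi : is_decreasing_word J (rcons w i).
  by rewrite -(setD1K iJ); apply: dec_rcons; rewrite // !inE ?eqxx // (negPf i1J) andbF.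
have [p1 _] := iK; have [p2 _] := dw.
apply: (@last0 (wK ++ w)).
  by rewrite rcons_cat -vE !word_elt_cat (dec_word_elt dJ) (dec_word_elt dwi).
rewrite size_cat (size_perm_enum p1) (size_perm_enum p2) cK.
have -> : #|J :\ i| = lam.-1 by apply: succn_inj; rewrite -add1n -[1%N]/(nat_of_bool true) -iJ -cardsD1 cJ; lia.
by lia.
Qed.

Let dE : d_ J = elt (dec_iota n lam).
Proof. by rewrite grassmannian_J (dec_word_elt (dec_iotaP _ _)) //; lia. Qed.

Let split_end b : b \in K -> b + 1 \notin K -> exists w1,
  [/\ is_increasing_word (K :\ b) w1, v = (elt w1 * s b * elt (dec_iota n lam))%g & (size w1).+1 = m].
Proof.
move=> bK b1K; have [|w iw] := @inc_word_exists n (K :\ b).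
  by apply: (@notin_neqT n b); rewrite !inE eqxx.
have iwb : is_increasing_word K (rcons w b).
  by rewrite -(setD1K bK); apply: inc_rcons; rewrite // !inE ?eqxx // (negPf b1K) andbF.
exists w; split=> //; last by have [p _] := iwb; rewrite -(size_rcons w b) (size_perm_enum p).
by rewrite -vE word_elt_cat (inc_word_elt iK) -(inc_word_elt iwb) (dec_word_elt dJ) dE word_elt_rcons.
Qed.

Let size_dec l : size (dec_iota n l) = l.
Proof. by rewrite size_map size_rev size_iota. Qed.

(** Such a [k] may be written last in [u_K], just before [s_(lam-1) ... s_0]. If [k + 1 < lam], it
    crosses and becomes the right descent [k + 1]; if [k + 1 = lam], it cancels the next letter
    although the word is reduced; if [lam < k < n - 1], it commutes with everything and is itself a
    right descent. *)
Let K_end k : (k < n)%N -> k%:R \in K -> k%:R + 1 \notin K -> k = lam \/ k = n.-1.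
Proof.
move=> kn kK k1K; have [w [iw vw sw]] := split_end kK k1K.
have [kl|lk|->] := ltngtP k lam; last by left.
  have [lt|ge] := ltnP k.+1 lam.
    have := @last0 (w ++ dec_iota n lam) (k.+1)%:R; rewrite -cats1 -catA !word_elt_cat word_elt1.
    rewrite -dec_iota_conj // ?mulgA; last by lia.
    rewrite -vw size_cat size_dec => /(_ erefl) h.
    have {h} : (k.+1)%:R = 0 :> 'Z_n by apply: h; lia.
    by move/eqP; rewrite -[0]/(0%:R) natr_eq_Zn //; lia.
  have e : lam = k.+1 by lia.
  have := @shortest (w ++ dec_iota n k); rewrite word_elt_cat vw e dec_iotaS word_elt_cons.
  by rewrite -mulgA simple_reflK size_cat size_dec => /(_ erefl); lia.
have [->|kn1] := eqVneq k n.-1; [by right|exfalso].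
have e : (elt (rcons (w ++ dec_iota n lam) k%:R) = v)%g.
  rewrite vw word_elt_rcons word_elt_cat -mulgA.
  case: (k) lk kn kn1 => // k' lk kn kn1; rewrite dec_iota_comm ?mulgA //; lia.
have : k%:R = 0 :> 'Z_n by apply: last0 e _; rewrite size_cat size_dec; lia.
by move/eqP; rewrite -[0]/(0%:R) natr_eq_Zn //; lia.
Qed.

(** Otherwise [u_K] can end with [s_(lam-1) s_lam], followed by the [s_(lam-1)] that opens [d_J].
    The braid relation turns these three letters into [s_lam s_(lam-1) s_lam], and the last [s_lam]
    commutes with the rest, a right descent other than [0]. *)
Let K_lam : (lam < n.-1)%N -> lam%:R \in K -> lam%:R + 1 \notin K -> lam.-1%:R \notin K.
Proof.
move=> ln lK l1K; apply/negP => l0K; have [w [iw vw sw]] := split_end lK l1K.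
have El : lam = lam.-1.+1 by lia.
move: iw l0K lK l1K vw ln; rewrite El /=; set l := lam.-1 => iw lK l1K l2K vw ln.
have ln1 : (l.+1 < n)%N by clear -ln; lia.
have n2 : (2 < n)%N by clear -ln; lia.
have lK' : l%:R \in K :\ (l.+1)%:R by rewrite !inE lK andbT natr_eq_Zn ?(ltnW ln1) //; clear; lia.
have [|w2 iw2] := @inc_word_exists n (K :\ (l.+1)%:R :\ l%:R).
  by apply: (@notin_neqT n l%:R); rewrite !inE eqxx.
have iw2l : is_increasing_word (K :\ (l.+1)%:R) (rcons w2 l%:R).
  rewrite -(setD1K lK'); apply: inc_rcons; rewrite // !inE ?eqxx // natr1 eqxx /= andbF.
  by [].
have [p _] := iw2l; have [p' _] := iw.
have sz : (size w2).+1 = size w by rewrite -(size_rcons w2 l%:R) (size_perm_enum p) (size_perm_enum p').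
have /eqP : (l.+1)%:R = 0 :> 'Z_n.
  apply: (@last0 (w2 ++ (l.+1)%:R :: l%:R :: dec_iota n l)); last first.
    rewrite size_cat /= size_dec; clear -sz sw El m_gt0 m_ltn; rewrite /l in El *; lia.
  rewrite word_elt_rcons word_elt_cat !word_elt_cons -!mulgA dec_iota_comm //; last by clear -ln; lia.
  rewrite vw (inc_word_elt iw) -(inc_word_elt iw2l) word_elt_rcons.
  rewrite dec_iotaS word_elt_cons !mulgA; congr (_ * _)%g; rewrite -!mulgA; congr (_ * _)%g.
  by rewrite -natr1 simple_refl_braid.
by rewrite -[0]/(0%:R) natr_eq_Zn // (ltnW n_gt1).
Qed.

(** A letter [c < lam] of [K] would force, by [K_end] and [K_lam], all letters from [c] up to
    [n - 1] into [K]. These include [lam - 1, ..., n - 1], which are [m + 1] letters. *)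
Lemma grassmannian_K : K = ~: J.
Proof.
have cC : #|~: J| = m by rewrite card_setC_Zn // cJ subKn // ltnW.
apply/eqP; rewrite eqEcard cC cK leqnn andbT; apply/subsetP => b bK; rewrite inE.
rewrite grassmannian_J; move: bK; rewrite -(natr_val_Zn b).
move: (val b) (val_ltn_Zn n_gt1 b) => c cn cinK; rewrite natr_in_initial //; apply/negP => cl.
have up k : (c <= k)%N -> (k <= lam)%N -> k%:R \in K.
  elim: k => [|k IH] ck kl; first by move: ck; rewrite leqn0 => /eqP <-.
  move: ck; rewrite leq_eqVlt => /orP[/eqP <-//|ck].
  have kK := IH ck (ltnW kl); apply/negPn/negP; rewrite -natr1 => k1K.
  have kn : (k < n)%N by clear -kl m_ltn; lia.
  by have [e|e] := K_end kn kK k1K; clear -kl m_gt0 m_ltn e; lia.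
have top k : (lam.-1 <= k)%N -> (k < n)%N -> k%:R \in K.
  elim: k => [|k IH] lk kn; first by apply: up; clear -lk cl; lia.
  have [->|lk'] := eqVneq k.+1 lam.-1; first by apply: up; clear -cl; lia.
  have kK : k%:R \in K by apply: IH; clear -lk lk' kn; lia.
  apply/negPn/negP; rewrite -natr1 => k1K.
  have [e|e] := K_end (ltnW kn) kK k1K; last by clear -e kn; lia.
  rewrite e in kn kK k1K; have : lam.-1%:R \notin K by apply: K_lam => //; clear -kn; lia.
  by rewrite up //; clear -cl; lia.
have : (#|~: initial n lam.-1| <= #|K|)%N.
  apply: subset_leq_card; apply/subsetP => c'; rewrite inE -{1}(natr_val_Zn c').
  rewrite natr_in_initial ?val_ltn_Zn // -leqNgt => lc.
  by rewrite -(natr_val_Zn c'); apply: top => //; apply: val_ltn_Zn.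
by rewrite card_setC_Zn // card_initial ?cK; lia.
Qed.

End KSchur.

(** * Collecting words by the element they represent *)

Section Expansion.
Variable n : nat.
Implicit Types (x y z w : seq 'Z_n) (v : affS n).

Local Notation elt := (@word_elt n).
Local Opaque A_gen A_ d_ u_ A_word.

Lemma big_seq_pred1 (V : nmodType) (T : eqType) (r : seq T) (a : T) (F : T -> V) :
  uniq r -> a \in r -> \sum_(i <- r) (if a == i then F i else 0) = F a.
Proof.
move=> u ar; rewrite (big_rem a) //= eqxx big_seq big1 ?addr0 // => i.
by rewrite mem_rem_uniq // inE eq_sym => /andP[/negPf -> _].
Qed.

Lemma A_word_expand (I : eqType) (r : seq I) (c : I -> int) (x : I -> seq 'Z_n) :
  let S := undup [seq elt (x i) | i <- [seq i <- r | reduced (x i)]] in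
  \sum_(i <- r) A_word (x i) *~ c i =
  \sum_(v <- S) A_ v *~ (\sum_(i <- r | reduced (x i) && (elt (x i) == v)) c i).
Proof.
move=> S; under [RHS]eq_bigr do rewrite mulrz_sumr big_mkcond.
rewrite exchange_big /=; apply: eq_big_seq => i ir.
have [ri|nri] := boolP (reduced (x i)); last by rewrite A_word_nonreduced // mul0rz big1.
rewrite -A_elt //; apply/esym.
apply: (big_seq_pred1 (fun v => A_ v *~ c i)); first exact: undup_uniq.
by rewrite mem_undup; apply/mapP; exists i; rewrite // mem_filter ri.
Qed.

End Expansion.

Section EHkSchur.
Variables n m : nat.
Hypotheses (n_gt1 : (1 < n)%N) (m_gt0 : (0 < m)%N) (m_ltn : (m < n)%N).
Implicit Types (J K : {set 'Z_n}).

Local Notation elt := (@word_elt n).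
Local Notation lam := (n - m)%N.
Local Opaque A_gen A_ d_ u_ A_word.

Definition inc_word K : seq 'Z_n := xget [::] [set w | is_increasing_word K w]%classic.
Definition dec_word J : seq 'Z_n := xget [::] [set w | is_decreasing_word J w]%classic.

Lemma inc_wordP K : K != setT -> is_increasing_word K (inc_word K).
Proof. by case/inc_word_exists => w iw; exact: (xgetPex [::] (ex_intro _ w iw)). Qed.

Lemma dec_wordP J : J != setT -> is_decreasing_word J (dec_word J).
Proof. by case/dec_word_exists => w dw; exact: (xgetPex [::] (ex_intro _ w dw)). Qed.

Lemma card_neqT J : (#|J| < n)%N -> J != setT.
Proof. by apply: contraTneq => ->; rewrite cardsT card_Zn // ltnn. Qed.

(** The hypothesis is discharged by [r_grassmannian], where the action on the vacuum makes it
    immediate. *)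
Lemma kSchur_e_h : grassmannian0 (r_ n m) -> is_kSchur (r_ n m) (e_ n m * h_ n lam).
Proof.
move=> rG; split.
  apply: Subring_M; first exact: e_fomin_stanley.
  by apply: Subring_gen; exists lam => //; lia.
pose x (p : {set 'Z_n} * {set 'Z_n}) := inc_word p.1 ++ dec_word p.2.
pose P (p : {set 'Z_n} * {set 'Z_n}) := (#|p.1| == m) && (#|p.2| == lam).
pose r := filter P (index_enum _).
have rP p : p \in r -> [/\ #|p.1| = m, #|p.2| = lam,
    is_increasing_word p.1 (inc_word p.1) & is_decreasing_word p.2 (dec_word p.2)].
  rewrite mem_filter => /andP[/andP[/eqP c1 /eqP c2] _]; split=> //.
    by apply/inc_wordP/card_neqT; rewrite c1.
  by apply/dec_wordP/card_neqT; rewrite c2; lia.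
pose f v : int := \sum_(p <- r | reduced (x p) && (elt (x p) == v)) 1.
have E : e_ n m * h_ n lam = \sum_(v <- undup [seq elt (x p) | p <- [seq p <- r | reduced (x p)]]) A_ v *~ f v.
  rewrite -A_word_expand e_h_pairs /r big_filter; apply: eq_bigr => p Pp.
  have [|c1 c2 i1 d2] := rP p; first by rewrite mem_filter [P p]Pp mem_index_enum.
  by rewrite mulr1z A_word_cat (A_u i1) (A_d d2).
set S := undup _ in E.
(* Outside [S] no pair contributes to [f], so the default value 0 is the right one. *)
pose a : {fsfun affS n -> int with 0} := [fsfun v in seq_fset tt S => f v | 0].
have aE v : a v = f v.
  rewrite fsfun_fun seq_fsetE; case: ifP => // vS; rewrite /f big_seq_cond big1 // => p.
  case/and3P => pr rp /eqP ev; move: vS; rewrite mem_undup => /mapP[]; exists p => //.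
  by rewrite mem_filter rp pr.
have p0r : (~: initial n lam, initial n lam) \in r.
  have l : (lam < n)%N by lia.
  rewrite mem_filter mem_index_enum andbT /P /= card_setC_Zn // card_initial // eqxx andbT.
  by rewrite subKn // ltnW.
set p0 := (_, _) in p0r.
have [_ _ i0 d0] := rP _ p0r; have [u0 e0 _] := ribbon_word i0 d0.
(* A Grassmannian element can only come from the pair [p0], which occurs once in [r]: this gives the
   coefficient 1 at [r_ n m] and 0 at the other Grassmannian elements. *)
have key v p : grassmannian0 v -> p \in r -> reduced (x p) -> elt (x p) = v -> p = p0.
  move=> vG pr rp ev; have [c1 c2 i1 d2] := rP p pr.
  have eJ := grassmannian_J n_gt1 m_gt0 m_ltn c1 c2 i1 d2 rp ev vG.
  have eK := grassmannian_K n_gt1 m_gt0 m_ltn c1 c2 i1 d2 rp ev vG.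
  by rewrite [p]surjective_pairing eK eJ.
exists a; split.
- rewrite E; apply/esym; under eq_bigr do rewrite aE.
  have sub : (finsupp a `<=` seq_fset tt S)%fset by exact: finsupp_sub.
  rewrite [LHS](big_fset_incl _ sub) /=; last first.
    by move=> v _ vn; rewrite -aE fsfun_dflt // mulr0z.
  by rewrite [LHS](perm_big _ (seq_fset_perm tt S)) /= undup_id // undup_uniq.
- rewrite aE /f (big_rem p0) //= (uniq_reduced u0) e0 -r_ribbon // eqxx /=.
  rewrite big_seq_cond big1 ?addr0 // => p /and3P[pr rp /eqP ep].
  have pr' := mem_rem pr; move: pr; rewrite (key _ _ rG pr' rp ep) mem_rem_uniqF //.
  by rewrite filter_uniq // index_enum_uniq.
- move=> v vG vr; rewrite aE /f big_seq_cond big1 // => p /and3P[pr rp /eqP ep].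
  case: vr; rewrite -ep (key _ _ vG pr rp ep) -/p0 r_ribbon //.
Qed.

End EHkSchur.

(** * Particles hopping on a cycle *)

Lemma comm_mulr (R : pzRingType) (a b c : R) : a * b = b * a -> a * (b * c) = b * (a * c).
Proof. by move=> e; rewrite !mulrA e. Qed.

Section Hopping.
Variables n m : nat.
Implicit Types (x y z w : seq 'Z_n) (i j k t : 'Z_n) (S T U : {set 'Z_n}).

Local Notation elt := (@word_elt n).
Local Opaque A_gen A_ d_ u_ A_word.

(* [m] particles on the cycle: the letter [i] moves a particle from site [i] to
   the empty site [i + 1].  A word acts from its last letter to its first. *)
Definition hop i S : option {set 'Z_n} :=
  if [&& #|S| == m, i \in S & i + 1 \notin S] then Some ((i + 1) |: (S :\ i)) else None.

Definition hop_word x S := foldr (fun i => obind (hop i)) (Some S) x.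

Lemma hopP i S T : hop i S = Some T <->
  [/\ #|S| = m, i \in S, i + 1 \notin S & T = (i + 1) |: (S :\ i)].
Proof.
rewrite /hop; split=> [|[/eqP -> -> -> ->]] //.
by case: ifP => // /and3P[/eqP ? ? ?] [<-].
Qed.

Lemma hop_wordS i x S T : hop_word (i :: x) S = Some T <->
  exists2 U, hop_word x S = Some U & hop i U = Some T.
Proof.
rewrite /hop_word /= -/(hop_word x S); split=> [|[U -> //]].
by case: (hop_word x S) => //= U h; exists U.
Qed.

Lemma hop_word_cat x y S T : hop_word (x ++ y) S = Some T <->
  exists2 U, hop_word y S = Some U & hop_word x U = Some T.
Proof.
elim: x T => [|i x IH] T; first by split=> [h|[U -> //]]; exists T.
split=> [/hop_wordS[U /IH[V hy hx] hi]|[V hy /hop_wordS[U hx hi]]].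
  by exists V => //; apply/hop_wordS; exists U.
by apply/hop_wordS; exists U => //; apply/IH; exists V.
Qed.

Lemma hop_in i S T j : hop i S = Some T ->
  (j \in T) = (j == i + 1) || (j != i) && (j \in S).
Proof. by case/hopP => _ _ _ ->; rewrite !inE. Qed.

Lemma hop_src i S T : hop i S = Some T -> i \notin T /\ i + 1 \in T.
Proof.
move=> h; rewrite !(hop_in _ h) !eqxx eq_sym (negPf (Zn_S_neq i)).
by [].
Qed.

Lemma hop_prev i S T : hop i S = Some T -> S = i |: (T :\ (i + 1)).
Proof.
move=> h; have [_ iS i1S _] := (hopP _ _ _).1 h; apply/setP => j.
rewrite !inE (hop_in _ h); case: (eqVneq j i) => [->|ji] //=.
by case: (eqVneq j (i + 1)) => [->|] //=; apply/negbTE.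
Qed.

Lemma hop_card i S T : hop i S = Some T -> #|T| = m.
Proof.
case/hopP => cS iS i1S ->; rewrite cardsU1 !inE (negPf i1S) andbF add1n -cS.
by rewrite (cardsD1 i S) iS.
Qed.

Lemma hop_word_card x S T : #|S| = m -> hop_word x S = Some T -> #|T| = m.
Proof. by case: x => [|i x] cS; [case=> <-|case/hop_wordS => U _ /hop_card]. Qed.

Lemma hop_conserve i S T j : hop i S = Some T ->
  ((i == j) + (j \in T) = (i == (j - 1)%R) + (j \in S))%N.
Proof.
move=> h; have [_ iS i1S _] := (hopP _ _ _).1 h.
rewrite (hop_in _ h) eq_sym -(inj_eq (addIr 1) i) subrK [i + 1 == j]eq_sym.
case: (eqVneq j i) => [->|ji] /=.
  by rewrite eq_sym (negPf (Zn_S_neq i)) iS.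
by case: (eqVneq j (i + 1)) => [->|] //=; rewrite (negPf i1S).
Qed.

(* The occupation of site [j] changes only through the letters [j - 1], [j]. *)
Lemma hop_word_conserve x S T j : hop_word x S = Some T ->
  (count_mem j x + (j \in T) = count_mem (j - 1)%R x + (j \in S))%N.
Proof.
elim: x T => [|i x IH] T; first by case=> <-.
case/hop_wordS => U /IH e1 /(hop_conserve j) e2 /=.
by rewrite addnAC e2 -!addnA [(_ + count_mem j x)%N]addnC e1.
Qed.

Lemma hop_word_conserveS x S T j : hop_word x S = Some T ->
  (count_mem (j + 1)%R x + ((j + 1)%R \in T) = count_mem j x + ((j + 1)%R \in S))%N.
Proof. by move/(hop_word_conserve (j + 1)); rewrite addrK. Qed.

Lemma nadjacent_neq i k : ~~ adjacent i k -> i != k ->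
  [/\ (i == k + 1) = false, (k == i + 1) = false & (i + 1 == k + 1) = false].
Proof.
by rewrite negb_or => /andP[/negPf -> /negPf ->] /negPf; rewrite (inj_eq (addIr _)).
Qed.

Lemma hop_comm i k S T U : ~~ adjacent i k -> hop i S = Some T -> hop k T = Some U ->
  exists2 V, hop k S = Some V & hop i V = Some U.
Proof.
move=> ik hi hk; have [e|nik] := eqVneq i k; first by rewrite e in hi *; exists T.
have [e1 e2 e3] := nadjacent_neq ik nik.
have [cS iS i1S eT] := (hopP _ _ _).1 hi; have [cT kT k1T eU] := (hopP _ _ _).1 hk.
move: kT k1T; rewrite !(hop_in _ hi) e2 [k + 1 == i + 1]eq_sym e3 [k + 1 == i]eq_sym e1 /=.
rewrite [k == i]eq_sym nik /= => kS k1S.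
have hk' : hop k S = Some ((k + 1) |: (S :\ k)) by apply/hopP.
exists ((k + 1) |: (S :\ k)) => //; apply/hopP; split.
- exact: hop_card hk'.
- by rewrite (hop_in _ hk') e1 nik iS.
- by rewrite (hop_in _ hk') e3 [i + 1 == k]eq_sym e2 (negPf i1S).
apply/setP => j; rewrite eU eT !inE; do ![case: eqP => //= ?]; subst.
all: by rewrite ?eqxx // in e1 e2 e3 nik *.
Qed.

Lemma hop_word_comm i x S T U : {in x, forall k, ~~ adjacent i k} ->
  hop i S = Some T -> hop_word x T = Some U ->
  exists2 V, hop_word x S = Some V & hop i V = Some U.
Proof.
elim: x U => [|k x IH] U H hi; first by case=> <-; exists S.
case/hop_wordS => V hx hk; have [|W hW hiW] := IH V _ hi hx.
  by move=> l lx; apply: H; rewrite inE lx orbT.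
have [|V' hk' hi'] := hop_comm _ hiW hk; first by apply: H; rewrite mem_head.
by exists V' => //; apply/hop_wordS; exists W.
Qed.

Lemma A_word_comm i x : {in x, forall k, ~~ adjacent i k} ->
  A_word x * A_gen i = A_gen i * A_word x.
Proof.
elim: x => [|k x IH] H; first by rewrite A_word_nil mul1r mulr1.
rewrite A_word_cons -mulrA IH; last by move=> l lx; apply: H; rewrite inE lx orbT.
by apply/comm_mulr/esym/A_gen_comm/H/mem_head.
Qed.

Lemma first_occurrence (X : eqType) (a : X) (r : seq X) : a \in r ->
  exists r1 r2, r = r1 ++ a :: r2 /\ a \notin r1.
Proof.
elim: r => // b r IH; case: (eqVneq b a) => [->|ba]; first by exists [::], r.
rewrite inE eq_sym (negPf ba) => /IH[r1 [r2 [-> ar1]]].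
by exists (b :: r1), r2; rewrite inE negb_or eq_sym ba.
Qed.

Lemma nadjacent_count i x : (i + 1 \notin x) -> (i - 1 \notin x) -> {in x, forall k, ~~ adjacent i k}.
Proof.
move=> p1 m1 k kx; rewrite negb_or; apply/andP; split.
  by apply: contraNneq m1 => ->; rewrite addrK.
by apply: contraNneq p1 => <-.
Qed.

Lemma count0_notin x k : count_mem k x = 0%N -> k \notin x.
Proof. by move/eqP; rewrite eqn0Ngt -has_count has_pred1. Qed.

(* A letter that can be undone on the final state can be brought to the left. *)
Lemma hop_peel i y S T : hop_word y S = Some T -> i \in y -> i \notin T -> i + 1 \in T ->
  exists y', [/\ elt y = elt (i :: y'), A_word y = A_word (i :: y'), perm_eq y (i :: y') &
                 hop_word y' S = Some (i |: (T :\ (i + 1)))].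
Proof.
move=> h iy iT i1T; have [y1 [y2 [ey iy1]]] := first_occurrence iy.
move: h; rewrite ey => /hop_word_cat[U1 /hop_wordS[U h2 hi] h1].
have [iU1 i1U1] := hop_src hi.
have ci : count_mem i y1 = 0%N by apply/count_memPn.
have := hop_word_conserve i h1; rewrite ci (negPf iT) (negPf iU1) !addn0 => /esym /count0_notin m1.
have := hop_word_conserveS i h1; rewrite ci i1T i1U1 add0n -[RHS]add0n => /addIn /count0_notin p1.
have comm := nadjacent_count p1 m1.
have [V hV hi'] := hop_word_comm comm hi h1.
exists (y1 ++ y2); split.
- rewrite word_elt_cat !word_elt_cons mulgA word_elt_comm // -mulgA -word_elt_cat.
  by [].
- by rewrite A_word_cat !A_word_cons A_word_cat; exact: comm_mulr (A_word_comm comm).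
- by rewrite perm_catC /= perm_cons perm_catC.
- by rewrite -(hop_prev hi'); apply/hop_word_cat; exists U.
Qed.

Lemma size_sum_count x : size x = (\sum_(j : 'Z_n) count_mem j x)%N.
Proof.
elim: x => [|i x IH] /=; first by rewrite big1.
by rewrite big_split /= -IH (bigD1 i) //= eqxx big1 // => j /negPf; rewrite eq_sym => ->.
Qed.

(** By conservation the numbers of uses of two neighbouring letters differ by an amount fixed by [S]
    and [T]. So one letter used more often in [x] than in [y] means that all are, against the
    equality of lengths. *)
Lemma hop_count_eq x y S T j : hop_word x S = Some T -> hop_word y S = Some T ->
  size x = size y -> count_mem j x = count_mem j y.
Proof.
have aux x' y' : hop_word x' S = Some T -> hop_word y' S = Some T ->
    size x' = size y' -> (count_mem j x' <= count_mem j y')%N.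
  move=> hx hy sz; rewrite leqNgt; apply/negP => lt.
  have all_lt : forall k, (count_mem k y' < count_mem k x')%N.
    apply: (Zn_succ_closed lt) => k /= ltk.
    rewrite -(ltn_add2r ((k + 1)%R \in T)) (hop_word_conserveS k hx).
    by rewrite (hop_word_conserveS k hy) ltn_add2r.
  suff : (size y' < size x')%N by rewrite sz ltnn.
  rewrite !size_sum_count (bigD1 0) // [X in (_ < X)%N](bigD1 0) //= -addSn.
  by apply: leq_add => //; apply: leq_sum => k _; apply: ltnW.
by move=> hx hy sz; apply/eqP; rewrite eqn_leq !aux.
Qed.

(** The first letter of [x] occurs in [y] because the counts agree, and it can be undone on the
    common final state, so [hop_peel] brings it to the front of [y]. Equal lengths exclude words
    that differ by full turns of the particles. *)
Lemma hop_word_inj x y S T : hop_word x S = Some T -> hop_word y S = Some T ->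
  size x = size y -> elt x = elt y.
Proof.
elim: x y T => [|i x IH] y T hx hy sz; first by case: y sz {hy}.
have : i \in y.
  rewrite -has_pred1 has_count -(hop_count_eq i hx hy sz) /= eqxx //.
have [U hU hi] := (hop_wordS _ _ _ _).1 hx; have [iT i1T] := hop_src hi.
move=> iy; have [y' [-> _ p hy']] := hop_peel hy iy iT i1T.
rewrite !word_elt_cons (IH y' U) //; first by rewrite (hop_prev hi).
by move: (perm_size p); rewrite -sz => -[].
Qed.

(** Between two consecutive uses of [i], site [i] has to be refilled, which only the letter [i - 1]
    does, and site [i + 1] has to be emptied, which only the letter [i + 1] does. *)
Lemma hop_word_between i x y z S T : i \notin y -> hop_word (x ++ i :: y ++ i :: z) S = Some T ->
  count_mem (i + 1) y = 1%N /\ count_mem (i - 1) y = 1%N.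
Proof.
move=> iy /hop_word_cat[U1 /hop_wordS[U2 /hop_word_cat[U3 /hop_wordS[U4 _ h4] h3] h2] _].
have [iU i1U] := hop_src h4; have [_ iV i1V _] := (hopP _ _ _).1 h2.
have ci : count_mem i y = 0%N by apply/count_memPn.
have := hop_word_conserve i h3; have := hop_word_conserveS i h3.
by rewrite ci iV (negPf iU) (negPf i1V) i1U !addn0 !add0n => -> <-.
Qed.

(** No letter of the word touches the sites [a] and [b], so the particle resting at [a] may rest at
    [b] instead. This passes from one state on which a word acts to another. *)
Lemma hop_word_swap a b x S T : hop_word x S = Some T -> a \in S -> b \notin S ->
  a \notin x -> a - 1 \notin x -> b \notin x -> b - 1 \notin x ->
  [/\ hop_word x (b |: (S :\ a)) = Some (b |: (T :\ a)), a \in T & b \notin T].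
Proof.
move=> h aS bS; have ab : a != b by apply: contraNneq bS => <-.
elim: x T h => [|i x IH] T; first by case=> <-.
case/hop_wordS => U hx hi; rewrite !inE !negb_or => /andP[ai ax] /andP[a1i a1x] /andP[bi bx] /andP[b1i b1x].
have [h aU bU] := IH U hx ax a1x bx b1x; have [cU iU i1U _] := (hopP _ _ _).1 hi.
have a1 : a != i + 1 by apply: contraNneq a1i => ->; rewrite addrK.
have b1 : b != i + 1 by apply: contraNneq b1i => ->; rewrite addrK.
have aT : a \in T by rewrite (hop_in _ hi) aU ai orbT.
have bT : b \notin T by rewrite (hop_in _ hi) (negPf bU) (negPf b1) andbF.
split=> //; apply/hop_wordS; exists (b |: (U :\ a)) => //; apply/hopP; split.
- by rewrite cardsU1 !inE (negPf bU) andbF add1n -cU (cardsD1 a U) aU.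
- by rewrite !inE iU andbT [i == a]eq_sym ai orbT.
- by rewrite !inE (negPf i1U) andbF orbF eq_sym.
apply/setP => j; rewrite !inE (hop_in _ hi).
case: (eqVneq j b) => [->|jb] /=; first by rewrite bi orbT.
case: (eqVneq j a) => [->|ja] /=; first by rewrite (negPf a1) andbF.
by [].
Qed.

End Hopping.

Lemma prodr_seq2 (R : pzRingType) (I : Type) (F : I -> R) (a b : I) :
  \prod_(k <- [:: a; b]) F k = F a * F b.
Proof. by rewrite !big_cons big_nil mulr1. Qed.

Lemma prodr_seq3 (R : pzRingType) (I : Type) (F : I -> R) (a b c : I) :
  \prod_(k <- [:: a; b; c]) F k = F a * F b * F c.
Proof. by rewrite !big_cons big_nil mulr1 mulrA. Qed.

(** * Matrix coefficients of the particle module *)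

Section HopRepresentation.
Variables n m : nat.
Implicit Types (x y z w : seq 'Z_n) (i j k t : 'Z_n) (S T U : {set 'Z_n}) (a b c : nilCoxeter n).

Local Notation elt := (@word_elt n).
Local Notation hop := (@hop n m).
Local Notation hop_word := (@hop_word n m).

(** Row [T], column [S] of the matrix by which a word acts; products of words become matrix
    products. *)
Definition word_entry T S (k : fmonom 'Z_n) : {poly int} :=
  if hop_word k S == Some T then 'X^(size k) else 0.

Definition free_entry T S (p : free_alg n) : {poly int} :=
  mmap (@polyC int) (word_entry T S) p.

Lemma word_entryM T S (k l : fmonom 'Z_n) :
  word_entry T S (mmul k l) = \sum_U word_entry T U k * word_entry U S l.
Proof.
rewrite /word_entry fmM; case h: (hop_word l S) => [V|].
  rewrite (bigD1 V) //= eqxx big1 ?addr0; last first.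
    move=> U UV; have -> : (Some V == Some U) = false.
      by apply/eqP => -[e]; rewrite e eqxx in UV.
    by rewrite mulr0.
  have -> : (hop_word (fmonom_val k ++ fmonom_val l) S == Some T) = (hop_word k V == Some T).
    apply/eqP/eqP => [/hop_word_cat[V']|hk]; first by rewrite h => -[->].
    by apply/hop_word_cat; exists V.
  by case: ifP => _; rewrite ?mul0r // size_cat exprD.
rewrite big1; last by move=> U _; rewrite mulr0.
by case: eqP => // /hop_word_cat[V']; rewrite h.
Qed.

Lemma free_entryM T S (p q : free_alg n) :
  free_entry T S (p * q) = \sum_U free_entry T U p * free_entry U S q.
Proof.
rewrite /free_entry malgME raddf_sum /=.
under eq_bigr do rewrite raddf_sum /=.
under eq_bigr do under eq_bigr do rewrite mmapU /= polyCM word_entryM mulr_sumr.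
under eq_bigr do rewrite exchange_big.
rewrite exchange_big /=; apply: eq_bigr => U _.
rewrite /mmap mulr_suml; apply: eq_bigr => k _; rewrite mulr_sumr; apply: eq_bigr => l _.
by rewrite mulrACA.
Qed.

Lemma free_gen_prod x : \prod_(i <- x) free_gen i = << FMonom x >> :> free_alg n.
Proof.
elim: x => [|i x IH]; first by rewrite big_nil -fmoneE.
rewrite big_cons IH [LHS]malgM_def fgmulUU mulr1; congr << _ >>.
by rewrite [mmul _ _]fmmulE fmuE.
Qed.

Lemma free_entry_word x T S :
  free_entry T S (\prod_(i <- x) free_gen i) = if hop_word x S == Some T then 'X^(size x) else 0.
Proof.
rewrite free_gen_prod.
by rewrite /free_entry mmapU mul1r.
Qed.

Lemma hop_word_sqr i S : hop_word [:: i; i] S = None.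
Proof.
case h: hop_word => [T|//]; have [//|+ _] := @hop_word_between n m i [::] [::] [::] S T _ h.
by [].
Qed.

(** Two different letters [i - 1] and [i + 1] would have to fit between the two uses of [i]. Hence
    both sides of a braid relation act by zero. *)
Lemma hop_word_braid i S : (2 < n)%N -> hop_word [:: i; i + 1; i] S = None.
Proof.
move=> n2; case h: hop_word => [T|//].
have [|_] := @hop_word_between n m i [::] [:: i + 1] [::] S T _ h.
  by rewrite inE eq_sym Zn_S_neq.
rewrite /= addn0 -(inj_eq (addIr 1) (i + 1)) subrK.
by rewrite (negPf (Zn_SS_neq _ n2)).
Qed.

Lemma hop_word_braid' i S : (2 < n)%N -> hop_word [:: i + 1; i; i + 1] S = None.
Proof.
move=> n2; case h: hop_word => [T|//].
have [|+ _] := @hop_word_between n m (i + 1) [::] [:: i] [::] S T _ h.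
  by rewrite inE Zn_S_neq.
by rewrite /= addn0 eq_sym (negPf (Zn_SS_neq _ n2)).
Qed.

Lemma hop_word_nadjacent i j S : ~~ adjacent i j -> hop_word [:: i; j] S = hop_word [:: j; i] S.
Proof.
have aux (k l : 'Z_n) T : ~~ adjacent k l -> hop_word [:: k; l] S = Some T -> hop_word [:: l; k] S = Some T.
  move=> kl /hop_wordS[U /hop_wordS[V [<-] hl] hk]; rewrite adjacentC in kl.
  have [W hk' hl'] := hop_comm kl hl hk.
  by apply/hop_wordS; exists W => //; apply/hop_wordS; exists S.
move=> ij; case h: (hop_word [:: j; i] S) => [T|].
  by apply: aux h; rewrite adjacentC.
by case h': hop_word => [T|//]; rewrite (aux _ _ _ ij h') in h.
Qed.

Lemma free_entry_ideal T S p : two_sided_ideal (@nilCoxeter_rel n) p -> free_entry T S p = 0.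
Proof.
move=> Ip; elim: Ip T S => {p} [p|T S|p q _ IHp _ IHq T S|a p b _ IH T S].
- have E (x : seq 'Z_n) T S := free_entry_word x T S.
  case=> [i|i n2|i j h1 h2] T S.
  + by rewrite -(prodr_seq2 _ i i) free_entry_word hop_word_sqr.
  + have e1 := E [:: i; i + 1; i] T S; have e2 := E [:: i + 1; i; i + 1] T S.
    rewrite prodr_seq3 (hop_word_braid _ _ n2) /= in e1.
    rewrite prodr_seq3 (hop_word_braid' _ _ n2) /= in e2.
    by rewrite /free_entry raddfB /= [X in X - _]e1 [X in _ - X]e2 subrr.
  + have e1 := E [:: i; j] T S; have e2 := E [:: j; i] T S.
    have ij : ~~ adjacent i j.
      apply/negP => /orP[] /eqP e; [move: h1|move: h2]; rewrite e.
        by rewrite addrAC subrr add0r eqxx.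
      by rewrite opprD addrA subrr add0r eqxx.
    rewrite prodr_seq2 (hop_word_nadjacent _ ij) /= in e1; rewrite prodr_seq2 in e2.
    by rewrite /free_entry raddfB /= [X in X - _]e1 [X in _ - X]e2 subrr.
- by rewrite /free_entry raddf0.
- by rewrite /free_entry raddfB /= [X in X - _]IHp [X in _ - X]IHq subrr.
- rewrite !free_entryM big1 // => U _; rewrite !free_entryM big1 ?mul0r // => V _.
  by rewrite IH mulr0.
Qed.

Definition entry T S a : {poly int} := free_entry T S (of_quot a).

Lemma entry_quot T S p : entry T S (to_quot (@nilCoxeter_rel n) p) = free_entry T S p.
Proof.
apply/eqP; rewrite -subr_eq0; apply/eqP.
have := free_entry_ideal T S (to_quotK (@nilCoxeter_rel n) p).
by rewrite /free_entry raddfB.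
Qed.

Lemma entryB T S : zmod_morphism (entry T S).
Proof.
elim/ring_quotW => p; elim/ring_quotW => q.
rewrite -[_ - _](rmorphB (to_quot (@nilCoxeter_rel n))) !entry_quot /free_entry.
exact: raddfB.
Qed.

HB.instance Definition _ T S :=
  GRing.isZmodMorphism.Build (nilCoxeter n) {poly int} (entry T S) (@entryB T S).

Lemma entryM T S a b : entry T S (a * b) = \sum_U entry T U a * entry U S b.
Proof.
elim/ring_quotW: a => p; elim/ring_quotW: b => q.
rewrite -[_ * _](rmorphM (to_quot (@nilCoxeter_rel n))) !entry_quot free_entryM.
by apply: eq_bigr => U _; rewrite !entry_quot.
Qed.

Lemma A_word_quot x : A_word x = to_quot (@nilCoxeter_rel n) (\prod_(i <- x) free_gen i).
Proof. by rewrite rmorph_prod. Qed.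

Lemma entry_word x T S :
  entry T S (A_word x) = if hop_word x S == Some T then 'X^(size x) else 0.
Proof. by rewrite A_word_quot entry_quot free_entry_word. Qed.

(** Through this lemma [matsumoto] reaches the particles: reduced words of one element act alike on
    states. *)
Lemma hop_word_A x y S : A_word x = A_word y -> size x = size y -> hop_word x S = hop_word y S.
Proof.
have X0 (k : nat) : 'X^k <> 0 :> {poly int} by apply/eqP; rewrite monic_neq0 // monicXn.
move=> e sz; case h: (hop_word x S) => [T|].
  have := entry_word x T S; rewrite e entry_word h eqxx; case: eqP => [->//|_].
  by move=> /esym eX; case: (X0 _ eX).
case h': (hop_word y S) => [T|//]; have := entry_word y T S.
by rewrite -e entry_word h h' eqxx => /esym eX; case: (X0 _ eX).
Qed.

End HopRepresentation.

Lemma mulr3A (R : pzRingType) (a b c d : R) : a * (b * (c * d)) = a * b * c * d.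
Proof. by rewrite !mulrA. Qed.

(** * Words that act by zero on all states with [m] particles *)

Section Faithful.
Variables n m : nat.
Hypotheses (n_gt1 : (1 < n)%N) (m_gt0 : (0 < m)%N) (m_ltn : (m < n)%N).
Implicit Types (x y z w : seq 'Z_n) (i j k t : 'Z_n) (S T U J K : {set 'Z_n}).

Local Notation elt := (@word_elt n).
Local Notation hop := (@hop n m).
Local Notation hop_word := (@hop_word n m).
Local Notation ideal := (two_sided_ideal (@Amn_rel n m)).

Local Opaque A_gen A_ d_ u_ A_word.

(** The letters of [K] are pulled to the front one by one, always a [j] with [j - 1] outside [K]. By
    the last hypothesis the site of such a [j] is empty in the final state, as [hop_peel]
    requires. *)
Lemma peel_inc K y S T : K != setT -> hop_word y S = Some T ->
  {in K, forall k, k + 1 \in T /\ k \in y} -> {in K, forall k, k \in T -> k - 1 \in K} ->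
  exists y', A_word y = A_ (u_ K) * A_word y'.
Proof.
move: {2}#|K| (leqnn #|K|) => c; elim: c K y T => [|c IH] K y T.
  by rewrite leqn0 cards_eq0 => /eqP -> _ _ _ _; exists y; rewrite A_u0 mul1r.
have [-> _ _ _ _ _|K0 cK KT h H1 H2] := eqVneq K set0.
  by exists y; rewrite A_u0 mul1r.
have [j jK j1K] := pred_exit K0 KT; have [j1T jy] := H1 j jK.
have jT : j \notin T by apply: contra j1K; apply: H2.
have [y1 [_ -> p h1]] := hop_peel h jy jT j1T.
have [||k kK||y2 e2] := IH (K :\ j) y1 _ _ _ h1.
- by move: cK; rewrite (cardsD1 j) jK.
- by apply: (@notin_neqT n j); rewrite !inE eqxx.
- move: kK; rewrite !inE => /andP[kj kK]; have [k1T ky] := H1 k kK.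
  rewrite (inj_eq (addIr _)) kj k1T orbT; split=> //.
  by move: ky; rewrite (perm_mem p) inE (negPf kj).
- move=> k; rewrite !inE => /andP[kj kK]; rewrite (negPf kj) /= => /andP[kj1 kT].
  by rewrite (H2 k kK kT) andbT -(inj_eq (addIr 1)) subrK.
have n1 : j \notin K :\ j by rewrite !inE eqxx.
have n2 : j - 1 \notin K :\ j by rewrite !inE (negPf j1K) andbF.
have := A_u_consl n1 n2; rewrite setD1K // => eu.
by exists y2; rewrite A_word_cons e2 eu; exact: mulrA.
Qed.

(** The mirror image of [peel_inc]: the next letter is a [j] with [j + 1] outside [J], and the last
    hypothesis makes its target site occupied. *)
Lemma peel_dec J y S T : J != setT -> hop_word y S = Some T ->
  {in J, forall k, k \notin T /\ k \in y} -> {in J, forall k, k + 1 \notin T -> k + 1 \in J} ->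
  exists y', A_word y = A_ (d_ J) * A_word y'.
Proof.
move: {2}#|J| (leqnn #|J|) => c; elim: c J y T => [|c IH] J y T.
  by rewrite leqn0 cards_eq0 => /eqP -> _ _ _ _; exists y; rewrite A_d0 mul1r.
have [-> _ _ _ _ _|J0 cJ JT h H1 H2] := eqVneq J set0.
  by exists y; rewrite A_d0 mul1r.
have [j jJ j1J] := succ_exit J0 JT; have [jT jy] := H1 j jJ.
have j1T : j + 1 \in T by apply: contraR j1J; apply: H2.
have [y1 [_ -> p h1]] := hop_peel h jy jT j1T.
have [||k kJ||y2 e2] := IH (J :\ j) y1 _ _ _ h1.
- by move: cJ; rewrite (cardsD1 j) jJ.
- by apply: (@notin_neqT n j); rewrite !inE eqxx.
- move: kJ; rewrite !inE => /andP[kj kJ]; have [kT ky] := H1 k kJ.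
  rewrite (negPf kj) (negPf kT) andbF; split=> //.
  by move: ky; rewrite (perm_mem p) inE (negPf kj).
- move=> k; rewrite !inE => /andP[kj kJ]; rewrite negb_or negb_and negbK (inj_eq (addIr _)) (negPf kj) /=.
  by case/andP => -> /(H2 k kJ) ->.
have n1 : j \notin J :\ j by rewrite !inE eqxx.
have n2 : j + 1 \notin J :\ j by rewrite !inE (negPf j1J) andbF.
have := A_d_consl n1 n2; rewrite setD1K // => eu.
by exists y2; rewrite A_word_cons e2 eu; exact: mulrA.
Qed.

Lemma braid_ideal i j (a : nilCoxeter n) : (2 < n)%N -> adjacent i j ->
  ideal (A_gen i * (A_gen j * (A_gen i * a))).
Proof.
move=> n2; have G k : ideal (A_gen k * (A_gen (k + 1) * (A_gen k * a))).
  by rewrite mulr3A; apply/two_sided_idealMr/Ideal_gen/Amn_braid.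
case/orP => /eqP ->; last exact: G.
by rewrite -(braid_mulr a (A_gen_braid j n2)).
Qed.

Lemma hop_untouched_in y S T p : hop_word y S = Some T -> p \in S -> p \notin y -> p - 1 \notin y.
Proof.
move=> h pS py; have := hop_word_conserve p h; rewrite (count_memPn py) pS => e.
apply: count0_notin; move: e; case: (p \in T); rewrite /= ?addn1 ?addn0 => //.
by case.
Qed.

Lemma hop_untouched_out y S T h : hop_word y S = Some T -> h \notin S -> h - 1 \notin y -> h \notin y.
Proof.
move=> hh hS hy; have := hop_word_conserve h hh; rewrite (count_memPn hy) (negPf hS) => e.
by apply: count0_notin; case: (count_mem h y) e.
Qed.

Lemma card_swap S (a b : 'Z_n) : a \in S -> b \notin S -> #|b |: (S :\ a)| = #|S|.
Proof. by move=> aS bS; rewrite cardsU1 !inE (negPf bS) andbF [RHS](cardsD1 a) aS. Qed.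

(** By induction, [y] may be assumed to act on some state, so the obstruction comes from [i]: no
    image [T] of [y] has [i] occupied and [i + 1] empty. If [i] occurs in [y], this produces a
    square or a braid; otherwise it produces a cyclically increasing or decreasing factor that is
    too long. *)
Lemma hop_vanish x : (forall S, #|S| = m -> hop_word x S = None) -> ideal (A_word x).
Proof.
elim: x => [|i y IH] H.
  have [S _ cS] : exists2 S : {set 'Z_n}, S \subset setT & #|S| = m.
    by exists (initial n m); rewrite ?subsetT // card_initial.
  by have := H S cS.
rewrite A_word_cons.
have [[S [T [cS h]]]|none] := pselect (exists S T, #|S| = m /\ hop_word y S = Some T); last first.
  apply/two_sided_idealMl/IH => S cS; case h: hop_word => [T|//]; case: none.
  by exists S, T.
have stuck S' T' : #|S'| = m -> hop_word y S' = Some T' -> ~~ ((i \in T') && (i + 1 \notin T')).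
  move=> cS' h'; have := H S' cS'; rewrite /hop_word /= -/(hop_word y S') h' /= /hop.
  by rewrite (hop_word_card cS' h') eqxx /=; case: ifP.
have [iy|iy] := boolP (i \in y).
  have [y1 [y2 [ey iy1]]] := first_occurrence iy.
  have := stuck S T cS h; move: h; rewrite ey => /hop_word_cat[U1 /hop_wordS[U h2 hi] h1].
  have [iU1 i1U1] := hop_src hi.
  have := hop_word_conserve i h1; have := hop_word_conserveS i h1.
  rewrite (count_memPn iy1) (negPf iU1) i1U1 !add0n addn0 => cp cm stk.
  rewrite A_word_cat A_word_cons.
  (* Since [i] cannot act on [T], one of its neighbours is missing between the two leftmost letters
     [i], and the other occurs at most once there. Commuting the rest away leaves [A_i A_i] or
     [A_i A_j A_i]. *)
  have both : (count_mem (i + 1) y1 == 0%N) || (count_mem (i - 1) y1 == 0%N).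
    move: stk; rewrite -cm; case: (i \in T); rewrite ?orbT //= negbK => i1T.
    by move: cp; rewrite i1T -[RHS]add0n => /addIn ->.
  have le1 : (count_mem (i + 1)%R y1 <= 1)%N by rewrite -[1%N]/(nat_of_bool true) -cp leq_addr.
  have le2 : (count_mem (i - 1)%R y1 <= 1)%N by rewrite -cm; case: (i \in T).
  have main (j : 'Z_n) : adjacent i j -> (forall k, adjacent i k -> k \in y1 -> k = j) ->
      (count_mem j y1 <= 1)%N -> (j \in y1 -> (2 < n)%N) ->
      ideal (A_gen i * (A_word y1 * (A_gen i * A_word y2))).
    move=> aij uj cj n2; have [jy|jy] := boolP (j \in y1); last first.
      rewrite -(comm_mulr _ (A_word_comm _)); last first.
        by move=> k ky; apply: contra jy => aik; rewrite -(uj k aik ky).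
      rewrite [A_gen i * (A_gen i * _)]mulrA A_gen_sqr mul0r mulr0; exact: Ideal_0.
    have [z1 [z2 [e1 jz1]]] := first_occurrence jy.
    have jz2 : j \notin z2.
      apply: count0_notin; move: cj; rewrite e1 count_cat /= eqxx addnCA add1n ltnS leqn0.
      by rewrite addn_eq0 => /andP[_ /eqP].
    have c1 : {in z1, forall k, ~~ adjacent i k}.
      move=> k kz; apply: contra jz1 => aik; rewrite -(uj k aik) //.
      by rewrite e1 mem_cat kz.
    have c2 : {in z2, forall k, ~~ adjacent i k}.
      move=> k kz; apply: contra jz2 => aik; rewrite -(uj k aik) //.
      by rewrite e1 mem_cat inE kz !orbT.
    rewrite e1 A_word_cat A_word_cons -!mulrA.
    rewrite (comm_mulr _ (esym (A_word_comm c1))) (comm_mulr (A_word y2) (A_word_comm c2)).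
    exact/two_sided_idealMl/braid_ideal/aij/n2.
  have adjE k : adjacent i k -> k = i + 1 \/ k = i - 1.
    by case/orP => /eqP ->; [right; rewrite addrK|left].
  have n2 : i + 1 <> i - 1 -> (2 < n)%N.
    move=> ne; rewrite ltnNge; apply/negP => le; case: ne.
    apply/esym; apply: Zn_two => //.
    by rewrite -(inj_eq (addIr 1)) subrK Zn_S_neq.
  case/orP: both => /eqP c0.
    apply: (main (i - 1)) => //.
    - by rewrite /adjacent subrK eqxx.
    - by move=> k /adjE[->|->//]; rewrite (negPf (count0_notin c0)).
    - move=> ky; apply: n2 => e; move: c0; rewrite e => /count0_notin.
      by rewrite ky.
  apply: (main (i + 1)) => //.
  - by rewrite /adjacent eqxx orbT.
  - by move=> k /adjE[->//|->]; rewrite (negPf (count0_notin c0)).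
  - move=> ky; apply: n2 => e; move: c0; rewrite -e => /count0_notin.
    by rewrite ky.
have cT := hop_word_card cS h.
have [[allp im]|nU] := pselect ({in S, forall p, p \in y} /\ i - 1 \notin y).
  pose K := [set s - 1 | s in T].
  have KP k : (k \in K) = (k + 1 \in T).
    apply/imsetP/idP => [[s sT ->]|k1T]; first by rewrite subrK.
    by exists (k + 1); rewrite ?addrK.
  have cK : #|K| = m by rewrite card_imset //; apply: addIr.
  have Ky k : k \in K -> k \in y.
    rewrite KP => k1T; have := hop_word_conserveS k h; rewrite k1T => e.
    apply: contraT => ky; move: e; rewrite (count_memPn ky) add0n addn1.
    have [k1S|//] := boolP (k + 1 \in S).
    have := allp _ k1S; rewrite -has_pred1 has_count.
    by case: (count_mem _ _).
  have iK : i \notin K by apply: contra iy; apply: Ky.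
  have i1K : i - 1 \notin K by apply: contra im; apply: Ky.
  have [|k kK|k kK kT|y' ->] := peel_inc _ h (K := K).
  - exact: notin_neqT iK.
  - by rewrite -KP; split=> //; apply: Ky.
  - by rewrite KP subrK.
  rewrite mulrA -(A_u_consl iK i1K); apply/two_sided_idealMr/A_u_ideal.
    exact: setU1_neqT'.
  by rewrite cardsU1 iK cK.
have [[allh ip]|nD] := pselect ((forall q, q \notin S -> q - 1 \in y) /\ i + 1 \notin y).
  have Jy k : k \in ~: T -> k \in y.
    rewrite inE => kT; have := hop_word_conserve k h; rewrite (negPf kT) addn0 => e.
    rewrite -has_pred1 has_count e; have [kS|kS] := boolP (k \in S); first by rewrite addn1.
    by rewrite addn0 -has_count has_pred1 allh.
  have iJ : i \notin ~: T by apply: contra iy; apply: Jy.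
  have i1J : i + 1 \notin ~: T by apply: contra ip; apply: Jy.
  have [|k kJ|k kJ kT|y' ->] := peel_dec _ h (J := ~: T).
  - exact: notin_neqT iJ.
  - by have := Jy _ kJ; move: kJ; rewrite inE.
  - by rewrite inE.
  rewrite mulrA -(A_d_consl iJ i1J); apply/two_sided_idealMr/A_d_ideal.
    exact: setU1_neqT.
  by rewrite cardsU1 iJ card_setC_Zn // cT.
(* Otherwise two swaps contradict [stuck]: a particle that never moves is put at [i], unless [i] is
   occupied in the image anyway; then the particle resting at [i + 1] is exchanged with a hole that
   is never filled. *)
exfalso.
have [S1 [T1 [cS1 h1 iT1 hole]]] : exists S1 T1, [/\ #|S1| = m, hop_word y S1 = Some T1, i \in T1 &
    i + 1 \in y \/ exists2 q, q \notin S1 & q - 1 \notin y].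
  have hole : i + 1 \in y \/ exists2 q, q \notin S & q - 1 \notin y.
    have [|ip] := boolP (i + 1 \in y); [by left|right].
    apply: contrapT => no; apply: nD; split=> // q qS; apply/negPn/negP => qy.
    by apply: no; exists q.
  have [iT|iT] := boolP (i \in T); first by exists S, T.
  have ci := hop_word_conserve i h; rewrite (count_memPn iy) (negPf iT) in ci.
  have im : i - 1 \notin y by apply: count0_notin; case: (count_mem _ _) ci.
  have iS : i \notin S by move: ci; case: (i \in S) => //; rewrite addn1.
  have [p pS py] : exists2 p, p \in S & p \notin y.
    apply: contrapT => no; apply: nU; split=> // p pS; apply/negPn/negP => py.
    by apply: no; exists p.
  have py1 := hop_untouched_in h pS py.
  have [h' pT iT'] := hop_word_swap h pS iS py py1 iy im.
  exists (i |: (S :\ p)), (i |: (T :\ p)); rewrite card_swap // setU11; split=> //.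
  right; exists p; rewrite // !inE eqxx orbF.
  by apply: contraNneq iS => <-.
have i1T1 : i + 1 \in T1 by have := stuck _ _ cS1 h1; rewrite iT1 negbK.
have ci := hop_word_conserveS i h1; rewrite (count_memPn iy) i1T1 in ci.
have i1S : i + 1 \in S1 by move: ci; case: (i + 1 \in S1) => //; rewrite addn1.
have ip : i + 1 \notin y by apply: count0_notin; move: ci; rewrite i1S => /addIn.
case: hole => [|[q qS qy]]; first by rewrite (negPf ip).
have qy' := hop_untouched_out h1 qS qy.
have [|h' _ qT] := hop_word_swap h1 i1S qS ip _ qy' qy; first by rewrite addrK.
have := stuck _ _ _ h'; rewrite card_swap // !inE eqxx iT1 andbT.
have iq : i != q by apply: contraNneq qT => <-.
have i1q : i + 1 != q by apply: contraNneq qS => <-.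
by rewrite (negPf iq) (negPf i1q) eq_sym Zn_S_neq => /(_ cS1).
Qed.

End Faithful.

Section EntryFaithful.
Variables n m : nat.
Hypotheses (n_gt1 : (1 < n)%N) (m_gt0 : (0 < m)%N) (m_ltn : (m < n)%N).
Implicit Types (x y z w : seq 'Z_n) (i j k t : 'Z_n) (S T U J K : {set 'Z_n}) (b : nilCoxeter n).

Local Notation elt := (@word_elt n).
Local Notation hop_word := (@hop_word n m).
Local Notation entry := (@entry n m).
Local Notation ideal := (two_sided_ideal (@Amn_rel n m)).

Local Opaque A_gen A_ d_ u_.

Lemma nilCoxeter_words b : exists c : fmonom 'Z_n -> int, exists r : seq (fmonom 'Z_n),
  b = \sum_(k <- r) A_word k *~ c k.
Proof.
elim/ring_quotW: b => p; exists (fun k : fmonom 'Z_n => mcoeff k (p : free_alg n)), (msupp (p : free_alg n)).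
rewrite {1}[p]monalgE [LHS]rmorph_sum; apply: eq_bigr => k _.
rewrite A_word_quot free_gen_prod -[RHS]rmorphMz; congr to_quot.
by apply/malgP => l; rewrite raddfMz /= !mcoeffU fmK; case: (k == l); rewrite ?mul0rz ?mulr0n // intz.
Qed.

(** Let a reduced word [x] of [v] lead from [S] to [T]. In the entry at [T], [S] the coefficient of
    ['X^(size x)] receives a contribution from [v] alone, by [hop_word_inj]; so it is the
    coefficient of [A_ v] in [b]. *)
Lemma entry_faithful b : (forall S T, #|S| = m -> entry T S b = 0) -> ideal b.
Proof.
have [c [r ->]] := nilCoxeter_words b; rewrite A_word_expand.
set V := undup _; pose f v := \sum_(k <- r | reduced k && (elt k == v)) c k.
rewrite -/(f _) => H.
have uV : uniq V by apply: undup_uniq.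
have VP v : v \in V -> exists2 x, reduced x & elt x = v.
  by rewrite mem_undup => /mapP[k]; rewrite mem_filter => /andP[rk _] ->; exists k.
rewrite big_seq; apply: two_sided_ideal_sum => v vV; have [x rx ev] := VP v vV.
have [[S [T [cS h]]]|none] := pselect (exists S T, #|S| = m /\ hop_word x S = Some T); last first.
  rewrite -mulrzl; apply: two_sided_idealMl; rewrite -ev A_elt //; apply: hop_vanish => // S cS.
  by case h: hop_word => [T|//]; case: none; exists S, T.
suff -> : \sum_(k <- r | reduced k && (elt k == v)) c k = 0 by rewrite mulr0z; exact: Ideal_0.
rewrite -/(f v); have /(congr1 (fun p : {poly int} => p`_(size x))) := H S T cS.
rewrite raddf_sum /= coef_sum coef0 => <-; apply/esym.
rewrite -(big_seq_pred1 f uV vV); apply: eq_big_seq => v' v'V.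
have [x' rx' ev'] := VP v' v'V.
rewrite raddfMz /= -ev' A_elt // entry_word; case: eqP => [h'|nh]; last first.
  rewrite mul0rz coef0; case: eqP => // e; case: nh.
  rewrite -ev in e; rewrite -(@hop_word_A n m x x') //; first exact: matsumoto.
  by rewrite (eqP rx) (eqP rx') e.
have -> (p : {poly int}) (q : int) (d : nat) : (p *~ q)`_d = p`_d *~ q by exact: (raddfMz (coefp d)).
rewrite coefXn; case: (eqVneq (size x) (size x')) => [sz|sz].
  by rewrite -ev (hop_word_inj h h' sz) eqxx intz.
case: eqP => [e|_]; last by rewrite mul0rz.
by move: sz; rewrite (eqP rx) (eqP rx') ev e eqxx.
Qed.

End EntryFaithful.

(** * Commutation and cyclicity *)

Section Commutation.
Variables n m : nat.
Hypothesis n_gt1 : (1 < n)%N.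
Implicit Types (x y z w : seq 'Z_n) (i j k t : 'Z_n) (S T U J K R : {set 'Z_n}) (b : nilCoxeter n).

Local Notation elt := (@word_elt n).
Local Notation hop_word := (@hop_word n m).
Local Notation entry := (@entry n m).

Local Opaque mul_quot add_quot opp_quot to_quot of_quot A_gen A_ d_ u_ A_word.

(* The first return map of [j |-> j + 1] to [R]. *)
Lemma return_perm R : exists p : {perm 'Z_n},
  (forall j, (p j \in R) = (j \in R)) /\ (forall j, j \in R -> j + 1 \in R -> p j = j + 1).
Proof.
pose a j := fun k : nat => j + k.+1%:R \in R.
pose steps j := find (a j) (iota 0 n).
(* The search always succeeds: after [n] steps the walk is back at [j]. *)
have steps_lt j : j \in R -> (steps j < n)%N.
  move=> jR; rewrite -[X in (_ < X)%N](size_iota 0) -has_find; apply/hasP; exists n.-1.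
    by rewrite mem_iota; lia.
  by rewrite /a (ltn_predK n_gt1) (natr_n_Zn n_gt1) addr0.
have steps_in j : j \in R -> j + (steps j).+1%:R \in R.
  move=> jR; have lt := steps_lt j jR; have : has (a j) (iota 0 n) by rewrite has_find size_iota.
  by move/(nth_find 0%N); rewrite nth_iota.
have steps_min j (k : nat) : j \in R -> (k < steps j)%N -> j + k.+1%:R \notin R.
  move=> jR lt; have := before_find 0%N lt; rewrite nth_iota ?add0n.
    by rewrite /a => ->.
  exact: ltn_trans (steps_lt j jR).
pose g j := if j \in R then j + (steps j).+1%:R else j.
have gR j : (g j \in R) = (j \in R) by rewrite /g; case: ifP => // /steps_in.
(* If two walks end at the same place, the longer one passes through the starting point of the
   shorter one, which lies in [R], before its first return. *)
have aux j j' : j \in R -> j' \in R -> (steps j <= steps j')%N ->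
    j + (steps j).+1%:R = j' + (steps j').+1%:R -> j = j'.
  move=> jR j'R; rewrite leq_eqVlt => /orP[/eqP -> /addIr //|lt e].
  have ej : j = j' + (steps j' - steps j)%:R.
    apply: (addIr (steps j).+1%:R); rewrite e -addrA -natrD; congr (_ + _%:R); lia.
  have lt' : ((steps j' - steps j).-1 < steps j')%N by lia.
  have := steps_min j' _ j'R lt'; rewrite prednK ?subn_gt0 //.
  by rewrite -ej jR.
have ginj : injective g.
  move=> j j' e; have := gR j; rewrite e gR => jj'.
  move: e; rewrite /g jj'; case: ifP => // jR; have [le|le] := leqP (steps j) (steps j').
    by apply: aux; rewrite ?jj'.
  by move/esym => e; apply/esym; apply: aux e; rewrite ?jj' // ltnW.
exists (perm ginj); split=> j; rewrite permE // /g => jR j1R; rewrite jR.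
case s0 : (steps j) => [//|k]; have := @steps_min j 0%N jR.
by rewrite s0 j1R => /(_ isT).
Qed.

(** In [u_K d_J] the order of [j] and [j + 1] is decided by the set containing [j]; in [d_J u_K] it
    is decided by the set containing [j + 1] ([du_order]). Rotating both sets by one step inside
    their union therefore exchanges the two kinds of product. *)
Lemma ud_order K J wK wJ j : is_increasing_word K wK -> is_decreasing_word J wJ ->
  [disjoint K & J] -> j \in K :|: J -> j + 1 \in K :|: J ->
  (index j (wK ++ wJ) < index (j + 1)%R (wK ++ wJ))%N = (j \in K).
Proof.
move=> [pK HK] [pJ HJ] dKJ; have [_ eK] := (perm_enumP _ _).1 pK; have [_ eJ] := (perm_enumP _ _).1 pJ.
rewrite !inE !index_cat !eK => jU j1U.
have iK k : k \in K -> (index k wK < size wK)%N by rewrite index_mem eK.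
have [jK|njK] := boolP (j \in K); have [j1K|nj1K] := boolP (j + 1 \in K).
- exact: HK.
- by apply: ltn_addr; apply: iK.
- by apply/negbTE; rewrite -leqNgt ltnW // ltn_addr // iK.
- move: jU j1U; rewrite (negPf njK) (negPf nj1K) /= => jJ j1J.
  by rewrite ltn_add2l ltnNge ltnW // HJ.
Qed.

Lemma du_order K J wK wJ j : is_increasing_word K wK -> is_decreasing_word J wJ ->
  [disjoint K & J] -> j \in K :|: J -> j + 1 \in K :|: J ->
  (index j (wJ ++ wK) < index (j + 1)%R (wJ ++ wK))%N = (j + 1 \in K).
Proof.
move=> [pK HK] [pJ HJ] dKJ; have [_ eK] := (perm_enumP _ _).1 pK; have [_ eJ] := (perm_enumP _ _).1 pJ.
have dis k : k \in K -> (k \in J) = false by move=> kK; apply: (disjointFr dKJ kK).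
rewrite !inE !index_cat !eJ => jU j1U.
have iJ k : k \in J -> (index k wJ < size wJ)%N by rewrite index_mem eJ.
case/orP: jU => [jK|jJ]; case/orP: j1U => [j1K|j1J].
- by rewrite (dis _ jK) (dis _ j1K) ltn_add2l HK.
- rewrite (dis _ jK) j1J (_ : (j + 1 \in K) = false) ?(disjointFl dKJ j1J) //.
  by apply/negbTE; rewrite -leqNgt ltnW // ltn_addr // iJ.
- by rewrite jJ (dis _ j1K) j1K ltn_addr // iJ.
- by rewrite jJ j1J (disjointFl dKJ j1J) ltnNge ltnW // HJ.
Qed.

Lemma disjoint_cat_perm K J wK wJ : perm_eq wK (enum K) -> perm_eq wJ (enum J) ->
  [disjoint K & J] -> uniq (wK ++ wJ) /\ wK ++ wJ =i K :|: J.
Proof.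
move=> /perm_enumP[uK eK] /perm_enumP[uJ eJ] dKJ; split; last first.
  by move=> j; rewrite mem_cat eK eJ inE.
rewrite cat_uniq uK uJ andbT; apply/hasPn => j; rewrite eJ => jJ.
by rewrite /= eK (disjointFl dKJ jJ).
Qed.

Lemma A_ud_rotate (p : {perm 'Z_n}) K J :
  (forall j, (p j \in K :|: J) = (j \in K :|: J)) ->
  (forall j, j \in K :|: J -> j + 1 \in K :|: J -> p j = j + 1) ->
  [disjoint K & J] -> K != setT -> J != setT ->
  A_ (u_ K) * A_ (d_ J) = A_ (d_ (p @: J)) * A_ (u_ (p @: K)).
Proof.
move=> pR pS dKJ KT JT.
have imT (A : {set 'Z_n}) : A != setT -> p @: A != setT.
  apply: contraNneq => e; rewrite -(inj_eq (imset_inj (@perm_inj _ p))) e eq_sym.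
  by apply/eqP/setP => j; rewrite !inE; apply/imsetP; exists ((p^-1)%g j); rewrite ?inE // permKV.
have mem (A : {set 'Z_n}) j : (p j \in p @: A) = (j \in A) by rewrite mem_imset //; apply: perm_inj.
have eU : p @: K :|: p @: J = K :|: J.
  apply/setP => j; rewrite -[j](permKV p) pR inE !mem -in_setU.
  by [].
have dp : [disjoint p @: K & p @: J] by rewrite -setI_eq0 -imsetI ?imset_eq0 ?setI_eq0 //; move=> ? ? _ _; apply: perm_inj.
have [wK iK] := inc_word_exists KT; have [wJ dJ] := dec_word_exists JT.
have [wK' iK'] := inc_word_exists (imT _ KT); have [wJ' dJ'] := dec_word_exists (imT _ JT).
have [p1 _] := iK; have [p2 _] := dJ; have [p3 _] := iK'; have [p4 _] := dJ'.
have [u1 e1] := disjoint_cat_perm p1 p2 dKJ.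
have [u2 e2] := disjoint_cat_perm p4 p3 (etrans (disjoint_sym _ _) dp).
rewrite (A_u iK) (A_d dJ) (A_u iK') (A_d dJ') -!A_word_cat.
apply: matsumoto; try exact: uniq_reduced.
apply: word_elt_order => //.
  by apply: uniq_perm => // j; rewrite e1 e2 [in RHS]setUC eU.
move=> j; rewrite !e1 => jU j1U.
rewrite (ud_order iK dJ) // (du_order iK' dJ') // ?eU // -(pS j jU j1U) mem.
by [].
Qed.

Lemma inc_word_split K w1 i w2 : is_increasing_word K (w1 ++ i :: w2) ->
  [/\ i \notin w1, i \notin w2, i - 1 \notin w2 & i + 1 \notin w1].
Proof.
case=> /perm_enumP[u e] H.
have [i1 i2 d] : [/\ i \notin w1, i \notin w2 & forall k, k \in w2 -> k \notin w1].
  move: u; rewrite cat_uniq /= negb_or => /and4P[_ /andP[-> h] -> _]; split=> // k kw.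
  by have := hasPn h k kw.
have ii : index i (w1 ++ i :: w2) = size w1 by rewrite index_cat (negPf i1) /= eqxx addn0.
have iK : i \in K by rewrite -e mem_cat mem_head orbT.
split=> //.
  apply/negP => iw; have kK : i - 1 \in K by rewrite -e mem_cat inE iw !orbT.
  have := H _ kK; rewrite subrK => /(_ iK); rewrite ii index_cat (negPf (d _ iw)).
  by rewrite ltnNge leq_addr.
apply/negP => iw; have kK : i + 1 \in K by rewrite -e mem_cat iw.
have := H _ iK kK; rewrite ii index_cat iw ltnNge ltnW //.
by rewrite index_mem.
Qed.

Lemma dec_word_split J w1 i w2 : is_decreasing_word J (w1 ++ i :: w2) ->
  [/\ i \notin w1, i \notin w2, i - 1 \notin w1 & i + 1 \notin w2].
Proof.
case=> /perm_enumP[u e] H.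
have [i1 i2 d] : [/\ i \notin w1, i \notin w2 & forall k, k \in w2 -> k \notin w1].
  move: u; rewrite cat_uniq /= negb_or => /and4P[_ /andP[-> h] -> _]; split=> // k kw.
  by have := hasPn h k kw.
have ii : index i (w1 ++ i :: w2) = size w1 by rewrite index_cat (negPf i1) /= eqxx addn0.
have iJ : i \in J by rewrite -e mem_cat mem_head orbT.
split=> //.
  apply/negP => iw; have kJ : i - 1 \in J by rewrite -e mem_cat iw.
  have := H _ kJ; rewrite subrK => /(_ iJ); rewrite ii index_cat iw ltnNge ltnW //.
  by rewrite index_mem.
apply/negP => iw; have kJ : i + 1 \in J by rewrite -e mem_cat inE iw !orbT.
have := H _ iJ kJ; rewrite ii index_cat (negPf (d _ iw)).
by rewrite ltnNge leq_addr.
Qed.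

Lemma mem_splitE (X : eqType) (a : X) (r : seq X) : a \in r -> exists r1 r2, r = r1 ++ a :: r2.
Proof. by case/splitPr => r1 r2; exists r1, r2. Qed.

(** Between the two uses of a common letter [i] both [i - 1] and [i + 1] would be needed, but
    [u_K d_J] has no [i - 1] there and [d_J u_K] no [i + 1]. *)
Lemma entry_overlap K J T S : K != setT -> J != setT -> ~~ [disjoint K & J] ->
  entry T S (A_ (u_ K) * A_ (d_ J)) = 0 /\ entry T S (A_ (d_ J) * A_ (u_ K)) = 0.
Proof.
move=> KT JT; rewrite -setI_eq0 => /set0Pn[i]; rewrite inE => /andP[iK iJ].
have [wK inc] := inc_word_exists KT; have [wJ dec] := dec_word_exists JT.
have [[/perm_enumP[_ eK] _] [/perm_enumP[_ eJ] _]] := (inc, dec).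
rewrite (A_u inc) (A_d dec) -!A_word_cat !entry_word.
move: iK iJ; rewrite -eK -eJ => /mem_splitE[k1 [k2 e1]] /mem_splitE[j1 [j2 e2]].
rewrite e1 e2 in inc dec *.
have [a1 a2 a3 a4] := inc_word_split inc; have [b1 b2 b3 b4] := dec_word_split dec.
split; case: eqP => //.
  have -> : (k1 ++ i :: k2) ++ j1 ++ i :: j2 = k1 ++ i :: (k2 ++ j1) ++ i :: j2 by rewrite /= -!catA.
  case/hop_word_between; first by rewrite mem_cat negb_or a2.
  by move=> _; rewrite count_cat !(count_memPn _).
have -> : (j1 ++ i :: j2) ++ k1 ++ i :: k2 = j1 ++ i :: (j2 ++ k1) ++ i :: k2 by rewrite /= -!catA.
case/hop_word_between; first by rewrite mem_cat negb_or b2.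
by rewrite count_cat (count_memPn b4) (count_memPn a4).
Qed.

Lemma entry_e_h_comm r l T S : (r < n)%N -> (l < n)%N ->
  entry T S (e_ n r * h_ n l) = entry T S (h_ n l * e_ n r).
Proof.
move=> rn ln; rewrite e_h_pairs.
have -> : h_ n l * e_ n r = \sum_(p : {set 'Z_n} * {set 'Z_n} | (#|p.1| == r) && (#|p.2| == l))
    A_ (d_ p.2) * A_ (u_ p.1).
  rewrite /e_ /h_ mulr_suml; under eq_bigr do rewrite mulr_sumr.
  by rewrite exchange_big; apply: pair_big.
have dis (F : {set 'Z_n} * {set 'Z_n} -> nilCoxeter n) :
    (forall p : {set 'Z_n} * {set 'Z_n}, #|p.1| == r -> #|p.2| == l -> ~~ [disjoint p.1 & p.2] -> entry T S (F p) = 0) ->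
    entry T S (\sum_(p : {set 'Z_n} * {set 'Z_n} | (#|p.1| == r) && (#|p.2| == l)) F p) =
    entry T S (\sum_(p : {set 'Z_n} * {set 'Z_n} | [&& #|p.1| == r, #|p.2| == l & [disjoint p.1 & p.2]]) F p).
  move=> H; rewrite !raddf_sum /= (bigID (fun p : {set 'Z_n} * {set 'Z_n} => [disjoint p.1 & p.2])) /= addrC big1 ?add0r.
    by apply: eq_bigl => p; rewrite andbA.
  by move=> p /andP[/andP[c1 c2] d]; apply: H.
have cT (A : {set 'Z_n}) (q : nat) : (q < n)%N -> #|A| == q -> A != setT.
  by move=> qn /eqP cA; apply: card_neqT => //; rewrite cA.
rewrite [LHS](dis (fun p => A_ (u_ p.1) * A_ (d_ p.2))); last first.
  by move=> p /(cT _ _ rn) KT /(cT _ _ ln) JT /(entry_overlap T S KT JT)[].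
rewrite [RHS](dis (fun p => A_ (d_ p.2) * A_ (u_ p.1))); last first.
  by move=> p /(cT _ _ rn) KT /(cT _ _ ln) JT /(entry_overlap T S KT JT)[].
apply: (congr1 (entry T S)).
(* One rotation is fixed for each union. It preserves the union, so the inverse of [f] can use the
   same rotation, and it preserves the cardinals [r] and [l]. *)
have /choice[q qP] := return_perm.
pose U (p : {set 'Z_n} * {set 'Z_n}) := p.1 :|: p.2.
pose f (p : {set 'Z_n} * {set 'Z_n}) := (q (U p) @: p.1, q (U p) @: p.2).
pose f' (p : {set 'Z_n} * {set 'Z_n}) := ((q (U p))^-1%g @: p.1, (q (U p))^-1%g @: p.2).
have imq R : q R @: R = R.
  apply/setP => j; rewrite -[j](permKV (q R)) mem_imset ?(qP R).1 //; exact: perm_inj.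
have imq' R : (q R)^-1%g @: R = R.
  by rewrite -{2}(imq R) -imset_comp -[RHS]imset_id; apply: eq_imset => j /=; rewrite permK.
have Uf p : U (f p) = U p by rewrite /U /f /= -imsetU imq.
have Uf' p : U (f' p) = U p by rewrite /U /f' /= -imsetU imq'.
have fK p : f' (f p) = p.
  rewrite {1}/f' Uf /f /= -!imset_comp; case: p => K J /=.
  by congr (_, _); rewrite -[RHS]imset_id; apply: eq_imset => j /=; rewrite permK.
have f'K p : f (f' p) = p.
  rewrite {1}/f Uf' /f' /= -!imset_comp; case: p => K J /=.
  by congr (_, _); rewrite -[RHS]imset_id; apply: eq_imset => j /=; rewrite permKV.
rewrite [RHS](reindex_onto f f') /=; last by move=> p _; apply: f'K.
apply: eq_big => [[K J]|[K J]] /=.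
  rewrite fK eqxx andbT !card_imset; try exact: perm_inj.
  by rewrite -!setI_eq0 -imsetI ?imset_eq0 //; move=> ? ? _ _; apply: perm_inj.
case/and3P => c1 c2 d; apply: A_ud_rotate => //.
- exact: (qP _).1.
- exact: (qP _).2.
- exact: cT c1.
- exact: cT c2.
Qed.

Local Opaque e_ h_.

(** Commutation is stated for matrix coefficients: [entryM] carries it from the generators [h_l] to
    products. *)
Lemma fomin_stanley_e_comm b r T S : fomin_stanley b -> (r < n)%N ->
  entry T S (b * e_ n r) = entry T S (e_ n r * b).
Proof.
move=> Bb rn; elim: Bb T S => {b} [b [l hl ->] T S|T S|a b _ IHa _ IHb T S|a b _ IHa _ IHb T S].
- by apply/esym/entry_e_h_comm => //; clear -hl n_gt1; lia.
- by rewrite mul1r mulr1.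
- rewrite (mulrBl (e_ n r) a b).
  rewrite (mulrBr (e_ n r) a b).
  apply: (etrans (entryB m T S (a * e_ n r) (b * e_ n r))).
  apply: esym; apply: (etrans (entryB m T S (e_ n r * a) (e_ n r * b))).
  exact: (congr2 (fun p q => p - q) (esym (IHa T S)) (esym (IHb T S))).
- have e1 : entry T S (a * b * e_ n r) = entry T S (a * (e_ n r * b)).
    rewrite -(mulrA a b (e_ n r)); apply: etrans (entryM _ _ _ _ _) _.
    apply: esym; apply: etrans (entryM _ _ _ _ _) _; apply: eq_bigr => U _.
    exact: (congr1 (fun q => entry T U a * q) (esym (IHb U S))).
  apply: (etrans e1); rewrite (mulrA a (e_ n r) b) (mulrA (e_ n r) a b).
  apply: etrans (entryM _ _ _ _ _) _; apply: esym; apply: etrans (entryM _ _ _ _ _) _.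
  apply: eq_bigr => U _; exact: (congr1 (fun q => q * entry U S b) (esym (IHa T U))).
Qed.

End Commutation.

(** * The vacuum, and an order on the states *)

Section Vacuum.
Variables n m : nat.
Hypotheses (n_gt1 : (1 < n)%N) (m_gt0 : (0 < m)%N) (m_ltn : (m < n)%N).
Implicit Types (x y z w : seq 'Z_n) (i j k t s : 'Z_n) (S T U J K N : {set 'Z_n}) (b : nilCoxeter n).

Local Notation hop := (@hop n m).
Local Notation hop_word := (@hop_word n m).
Local Notation entry := (@entry n m).

Local Opaque mul_quot add_quot opp_quot to_quot of_quot A_gen A_ d_ u_ A_word.

Lemma val_succ j : val (j + 1) = if val j == n.-1 then 0%N else (val j).+1.
Proof.
rewrite -{1}(natr_val_Zn j) natr1; case: eqP => [->|ne].
  by rewrite (ltn_predK n_gt1) natr_n_Zn.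
by rewrite val_natr_Zn //; have := val_ltn_Zn n_gt1 j; move: ne; lia.
Qed.

(** Positions are counted from site [-(m - 1)], so that the vacuum fills the positions below [m] and
    its foremost particle is at site [0]. *)
Definition pos s : nat := val (s + m.-1%:R).
Definition site (k : nat) : 'Z_n := k%:R - m.-1%:R.
Definition vacuum : {set 'Z_n} := [set s | (pos s < m)%N].

Lemma pos_lt s : (pos s < n)%N.
Proof. exact: val_ltn_Zn. Qed.

Lemma pos_site (k : nat) : (k < n)%N -> pos (site k) = k.
Proof. by move=> kn; rewrite /pos subrK val_natr_Zn. Qed.

Lemma site_pos s : site (pos s) = s.
Proof. by rewrite /site /pos natr_val_Zn addrK. Qed.

Lemma pos_inj : injective pos.
Proof. by move=> s t e; rewrite -(site_pos s) e site_pos. Qed.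

Lemma pos_succ s : pos (s + 1) = if pos s == n.-1 then 0%N else (pos s).+1.
Proof. by rewrite /pos addrAC val_succ. Qed.

Lemma pos_pred s : (0 < pos s)%N -> pos (s - 1) = (pos s).-1.
Proof. by have := pos_succ (s - 1); rewrite subrK; case: ifP => _ ->. Qed.

Lemma pos_pred0 s : pos s = 0%N -> pos (s - 1) = n.-1.
Proof. by have := pos_succ (s - 1); rewrite subrK; case: eqP => // _ ->. Qed.

Lemma card_vacuum : #|vacuum| = m.
Proof.
have -> : vacuum = [set j - m.-1%:R | j in initial n m].
  apply/setP => s; rewrite inE; apply/idP/imsetP => [lt|[j]].
    by exists (s + m.-1%:R); rewrite ?addrK // inE.
  by rewrite inE => lt ->; rewrite /pos subrK.
by rewrite card_imset ?card_initial //; apply: addIr.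
Qed.

Lemma hop_vacuum i T : hop i vacuum = Some T -> i = 0.
Proof.
case/hopP => _; rewrite !inE pos_succ => im; case: eqP => [e|_]; first by rewrite m_gt0.
rewrite -leqNgt => mi _; apply: pos_inj; rewrite [RHS](_ : _ = m.-1); first by move: im mi; lia.
by rewrite /pos add0r val_natr_Zn //; lia.
Qed.

(** The first empty position. In a state with [m] particles it counts those that have not moved from
    their place in the vacuum, so a smaller gap is a longer first column. *)
Definition gap S := find (fun k : nat => site k \notin S) (iota 0 n).

Lemma gap_le S : (gap S <= n)%N.
Proof. by rewrite -[X in (_ <= X)%N](size_iota 0) find_size. Qed.

Lemma gap_in S s : (pos s < gap S)%N -> s \in S.
Proof.
move=> lt; have := before_find 0%N lt; rewrite nth_iota ?pos_lt // add0n site_pos.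
by move/negbFE.
Qed.

Lemma gap_leq S s : s \notin S -> (gap S <= pos s)%N.
Proof. by move=> sS; rewrite leqNgt; apply: contra sS; apply: gap_in. Qed.

Lemma gap_out S s : pos s = gap S -> s \notin S.
Proof.
move=> e; have lt := pos_lt s; rewrite e in lt.
have : has (fun k : nat => site k \notin S) (iota 0 n) by rewrite has_find size_iota.
by move/(nth_find 0%N); rewrite nth_iota // add0n -/(gap S) -e site_pos.
Qed.

(** The conservation law summed against a weight [F]: the weight 1 counts particles, and the weight
    [pos] computes the change of energy. *)
Lemma transport K U N (F : 'Z_n -> nat) :
  (forall j, ((j \in K) + (j \in U) = ((j - 1)%R \in K) + (j \in N))%N) ->
  (\sum_(j in U) F j + \sum_(k in K) F k = \sum_(j in N) F j + \sum_(k in K) F (k + 1)%R)%N.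
Proof.
have E (A : {set 'Z_n}) (G : 'Z_n -> nat) : (\sum_(j in A) G j = \sum_j (j \in A) * G j)%N.
  by rewrite big_mkcond; apply: eq_bigr => j _; case: (j \in A); rewrite ?mul1n ?mul0n.
move=> H; rewrite !E [X in (_ = _ + X)%N](reindex_inj (addIr (- 1))) /=.
rewrite -!big_split; apply: eq_bigr => j _ /=.
by rewrite subrK -!mulnDl addnC H addnC.
Qed.

Definition energy S := (\sum_(s in S) pos s)%N.
(** The lexicographic order on energy and gap as a single number; the factor [n.+1] exceeds every
    gap. Up to a constant, the energy is the size of the partition. *)
Definition measure S := (energy S * n.+1 + gap S)%N.

Lemma measure_energy S T : (energy S < energy T)%N -> (measure S < measure T)%N.
Proof.
move=> lt; rewrite /measure; apply: (@leq_trans ((energy S).+1 * n.+1)).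
  by rewrite mulSn [X in (_ < X)%N]addnC ltn_add2l ltnS gap_le.
by apply: leq_trans (leq_addr _ _); rewrite leq_mul2r lt orbT.
Qed.

Lemma measure_gap S T : (energy S <= energy T)%N -> (gap S < gap T)%N -> (measure S < measure T)%N.
Proof. by move=> le lt; rewrite /measure -addnS leq_add // leq_mul2r le orbT. Qed.

Lemma count_perm_enum K w j : perm_eq w (enum K) -> count_mem j w = (j \in K).
Proof. by case/perm_enumP => u e; rewrite count_uniq_mem // e. Qed.

Lemma hop_perm_conserve K w S T j : perm_eq w (enum K) -> hop_word w S = Some T ->
  ((j \in K) + (j \in T) = ((j - 1)%R \in K) + (j \in S))%N.
Proof. by move=> p /(hop_word_conserve j); rewrite !(count_perm_enum _ p). Qed.

(** In an increasing word [k - 1] acts after [k], so the particle moved by [k] was at site [k] from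
    the start. Dually, in [hop_dec_sub], the target [k + 1] was empty from the start. *)
Lemma hop_inc_sub K w S T : is_increasing_word K w -> hop_word w S = Some T -> K \subset S.
Proof.
move=> iw h; apply/subsetP => k kK; have [/perm_enumP[_ e] _] := iw.
move: kK; rewrite -e => /mem_splitE[w1 [w2 ew]]; rewrite ew in iw h.
have [_ k2 k3 _] := inc_word_split iw.
have [U1 /hop_wordS[U h2 hk] _] := (hop_word_cat _ _ _ _ _).1 h.
have [_ kU _ _] := (hopP _ _ _ _).1 hk; have := hop_word_conserve k h2.
by rewrite (count_memPn k2) (count_memPn k3) kU; case: (k \in S).
Qed.

Lemma hop_dec_sub J w S T : is_decreasing_word J w -> hop_word w S = Some T ->
  {in J, forall j, j + 1 \notin S}.
Proof.
move=> dw h k kJ; have [/perm_enumP[_ e] _] := dw.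
move: kJ; rewrite -e => /mem_splitE[w1 [w2 ew]]; rewrite ew in dw h.
have [_ k2 _ k3] := dec_word_split dw.
have [U1 /hop_wordS[U h2 hk] _] := (hop_word_cat _ _ _ _ _).1 h.
have [_ _ kU _] := (hopP _ _ _ _).1 hk; have := hop_word_conserveS k h2.
by rewrite (count_memPn k2) (count_memPn k3) (negPf kU); case: (k + 1 \in S).
Qed.

(** A letter [t] of [K] with [t + 1] outside [K] may act first: its target is empty by the last
    hypothesis. *)
Lemma hop_inc_some K w S : is_increasing_word K w -> #|S| = m -> K \subset S ->
  {in K, forall k, k + 1 \in S -> k + 1 \in K} -> exists T, hop_word w S = Some T.
Proof.
move: {2}#|K| (leqnn #|K|) => c; elim: c K w S => [|c IH] K w S cK iw cS KS H.
  have [p _] := iw; have := size_perm_enum p; move: cK; rewrite leqn0 => /eqP -> /size0nil ->.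
  by exists S.
have [K0|K0] := eqVneq K set0.
  have [p _] := iw; have := size_perm_enum p; rewrite K0 cards0 => /size0nil ->.
  by exists S.
have KT : K != setT.
  by apply: card_neqT => //; apply: leq_ltn_trans m_ltn; rewrite -cS subset_leq_card.
have [t tK t1K] := succ_exit K0 KT.
have [|w0 iw0] := @inc_word_exists n (K :\ t).
  by apply: (@notin_neqT n t); rewrite !inE eqxx.
have iw1 : is_increasing_word K (rcons w0 t).
  by rewrite -(setD1K tK); apply: inc_rcons; rewrite // !inE ?eqxx // (negPf t1K) andbF.
have [p _] := iw; have [p1 _] := iw1.
rewrite (@hop_word_A n m w (rcons w0 t)); last 2 first.
- by rewrite -(A_u iw) (A_u iw1).
- by rewrite (size_perm_enum p) (size_perm_enum p1).
have tS : t \in S by apply: (subsetP KS).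
have t1S : t + 1 \notin S by apply: contra t1K; apply: H.
have ht : hop t S = Some ((t + 1) |: (S :\ t)) by apply/hopP.
have [|||||T hT] := IH (K :\ t) w0 ((t + 1) |: (S :\ t)).
- by move: cK; rewrite (cardsD1 t) tK.
- by [].
- exact: hop_card ht.
- by apply/subsetP => k; rewrite !inE => /andP[-> /(subsetP KS) ->]; rewrite orbT.
- move=> k; rewrite !inE (inj_eq (addIr _)) => /andP[kt kK]; rewrite (negPf kt) /=.
  by case/andP => -> k1S; rewrite H.
exists T; rewrite -cats1; apply/hop_word_cat; exists ((t + 1) |: (S :\ t)) => //.
Qed.

Lemma entry_e r T S : (r < n)%N -> entry T S (e_ n r) =
  \sum_(K : {set 'Z_n} | #|K| == r) if hop_word (inc_word K) S == Some T then 'X^r else 0.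
Proof.
move=> rn; rewrite /e_ raddf_sum /=; apply: eq_bigr => K /eqP cK.
have iK : is_increasing_word K (inc_word K) by apply/inc_wordP/card_neqT; rewrite // cK.
have [p _] := iK.
by rewrite (A_u iK) entry_word (size_perm_enum p) cK.
Qed.

End Vacuum.

Section Cyclicity.
Variables n m : nat.
Hypotheses (n_gt1 : (1 < n)%N) (m_gt0 : (0 < m)%N) (m_ltn : (m < n)%N).
Implicit Types (i j k t s : 'Z_n) (S T U J K N : {set 'Z_n}) (b : nilCoxeter n).

Local Notation hop_word := (@hop_word n m).
Local Notation entry := (@entry n m).
Local Notation pos := (@pos n m).
Local Notation gap := (@gap n m).
Local Notation energy := (@energy n m).
Local Notation measure := (@measure n m).
Local Notation vacuum := (vacuum n m).

(* In terms of partitions: [N] is [S] with its first column removed, and [S] is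
   the only state of [e_l N], with [l] the length of that column, which is not
   smaller in size or, failing that, longer. *)
Lemma remove_column S : #|S| = m -> S <> vacuum ->
  exists l N, [/\ (l < n)%N, #|N| = m, (measure N < measure S)%N,
    exists2 K : {set 'Z_n}, #|K| = l & hop_word (inc_word K) N = Some S &
    forall (K U : {set 'Z_n}), #|K| = l -> hop_word (inc_word K) N = Some U -> U <> S ->
      #|U| = m /\ (measure U < measure S)%N].
Proof.
move=> cS Sv; pose a := gap S.
(* The particles beyond the gap are those that have moved; [K0] consists of the letters that made
   their last step. The condition on [n.-1] excludes a step from the last position to the first. *)
pose K0 := [set k | [&& (a <= pos k)%N, pos k != n.-1 & k + 1 \in S]].
have K0P k : (k \in K0) = [&& (a <= pos k)%N, pos k != n.-1 & k + 1 \in S] by rewrite inE.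
have top j : j \in S -> (a <= pos j)%N -> j - 1 \in K0.
  move=> jS; rewrite leq_eqVlt => /orP[/eqP/esym /gap_out e|lt]; first by rewrite jS in e; case/negP: (e n_gt1).
  have p0 : (0 < pos j)%N by apply: leq_ltn_trans lt.
  have pn := pos_lt m n_gt1 j.
  rewrite K0P pos_pred // subrK jS andbT; apply/andP; split.
    by rewrite -ltnS (ltn_predK lt).
  by apply/eqP; move: p0 pn; lia.
have K0n : K0 != set0.
  apply/eqP => e; case: Sv.
  have SE s : (s \in S) = (pos s < a)%N.
    apply/idP/idP => [sS|]; last by apply: gap_in.
    by rewrite ltnNge; apply/negP => /(top s sS); rewrite e inE.
  have cv := card_vacuum n_gt1 m_ltn.
  have [le|/ltnW le] := leqP a m; apply/eqP; [|rewrite eq_sym]; rewrite eqEcard cS cv leqnn andbT;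
    apply/subsetP => s; rewrite inE SE => /leq_trans; exact.
have K0T : K0 != setT.
  have [s0 ps] : exists s, pos s = n.-1.
    by exists (site n m n.-1); apply: pos_site; rewrite // ltn_predL ltnW.
  by apply: (@notin_neqT n s0); rewrite K0P ps eqxx andbF.
(* [S] with each particle beyond the gap moved back by one site. *)
pose N := [set j | (j \in K0) || ((j - 1 \notin K0) && (j \in S))].
have cons j : ((j \in K0) + (j \in S) = ((j - 1)%R \in K0) + (j \in N))%N.
  rewrite [j \in N]inE; have b1 : j - 1 \in K0 -> j \in S by rewrite K0P subrK => /and3P[].
  have b2 : j \in K0 -> j \in S -> j - 1 \in K0.
    by rewrite {1}K0P => /and3P[aj _ _] jS; apply: top.
  by move: b1 b2; case: (j \in K0); case: (j \in S); case: (j - 1 \in K0) => //= h1 h2;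
    [have := h2 isT isT|have := h1 isT|have := h1 isT].
have cN : #|N| = m.
  have := transport (fun=> 1%N) cons; rewrite !sum1_card => /addIn.
  by rewrite cS.
have K0pos k : k \in K0 -> pos (k + 1) = (pos k).+1.
  by rewrite K0P => /and3P[_ /negPf kn _]; rewrite pos_succ // kn.
have eS : energy S = (energy N + #|K0|)%N.
  have := transport pos cons; rewrite [X in (_ = _ + X)%N](eq_bigr (fun k => 1 + pos k)%N) //.
  by rewrite big_split /= sum1_card addnA => /addIn.
have wP (K : {set 'Z_n}) : (#|K| < n)%N -> is_increasing_word K (inc_word K).
  by move=> cK; apply/inc_wordP/card_neqT.
have cK0 : (#|K0| < n)%N.
  have : (#|K0| < #|[set: 'Z_n]|)%N by rewrite proper_card // properT.
  by rewrite cardsT card_Zn.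
have hN : hop_word (inc_word K0) N = Some S.
  have i0 := wP _ cK0.
  have [|k kK|U hU] := hop_inc_some n_gt1 m_ltn i0 cN; last 1 first.
  - rewrite hU; congr Some; apply/setP => j; have [p _] := i0.
    have := hop_perm_conserve j p hU; rewrite -(cons j) => /addnI.
    by case: (j \in U); case: (j \in S).
  - by apply/subsetP => k kK; rewrite inE kK.
  - by rewrite inE addrK kK /= orbF.
exists #|K0|, N; split=> //.
- by apply: measure_energy => //; rewrite eS -[X in (X < _)%N]addn0 ltn_add2l card_gt0.
- by exists K0.
move=> K U cK hU US; have cU := hop_word_card cN hU; split=> //.
have iK : is_increasing_word K (inc_word K) by apply: wP; rewrite cK.
have [pK _] := iK; have KN := subsetP (hop_inc_sub iK hU).
have eU := transport pos (fun j => hop_perm_conserve j pK hU).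
have posS k : (pos (k + 1)%R <= (pos k).+1)%N by rewrite pos_succ //; case: ifP.
have leK : (\sum_(k in K) pos (k + 1)%R <= \sum_(k in K) pos k + #|K|)%N.
  rewrite addnC -sum1_card -big_split /=; apply: leq_sum => k _; exact: posS.
(* A particle stepping from the last position to the first loses energy, while each other step of
   [K] gains at most 1; so [U] has less energy than [S]. *)
have [cross|ncross] := pselect (exists2 k, k \in K & pos k = n.-1).
  case: cross => k kK pk; apply: measure_energy => //.
  have ltK : (\sum_(k in K) pos (k + 1)%R < \sum_(k in K) pos k + #|K|)%N.
    rewrite addnC -sum1_card -big_split /= (bigD1 k) //= [X in (_ < X)%N](bigD1 k) //=.
    rewrite -addSn leq_add //; first by rewrite pos_succ // pk eqxx add1n.
    by apply: leq_sum => i _; apply: posS.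
  by rewrite eS -cK -(ltn_add2r (\sum_(k in K) pos k)) -/(energy U) eU -addnA ltn_add2l [X in (_ < X)%N]addnC.
have leE : (energy U <= energy S)%N.
  by rewrite eS -cK -(leq_add2r (\sum_(k in K) pos k)) eU -addnA leq_add2l [X in (_ <= X)%N]addnC.
apply: measure_gap => //.
(* Without such a step, some letter of [K] lies below the gap of [S], since otherwise [K = K0]. The
   lowest such letter empties its site and no letter refills it, so the gap of [U] is smaller. *)
have [k0 k0K k0a] : exists2 k, k \in K & (pos k < a)%N.
  apply: contrapT => no; apply: US.
  have KK0 : K \subset K0.
    apply/subsetP => k kK; have ak : (a <= pos k)%N.
      by rewrite leqNgt; apply/negP => lt; apply: no; exists k.
    by have := KN k kK; rewrite inE => /orP[//|/andP[k1 kS]]; rewrite (top k kS ak) in k1.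
  have eK : K = K0 by apply/eqP; rewrite eqEcard KK0 cK leqnn.
  by move: hU; rewrite eK hN => -[].
case: (arg_minnP pos k0K) => k kinK kmin; have kK : k \in K := kinK.
have ka : (pos k < a)%N by apply: leq_ltn_trans k0a; apply: kmin.
have k1K : k - 1 \notin K.
  apply/negP => k1K; have [p0|p0] := posnP (pos k).
    by apply: ncross; exists (k - 1) => //; apply: pos_pred0.
  by have := kmin _ k1K; rewrite pos_pred //; move: p0; case: (pos k) => // q _; rewrite ltnn.
apply: leq_ltn_trans ka; apply: gap_leq => //.
have := hop_perm_conserve k pK hU; rewrite kK (negPf k1K) add0n (KN k kK).
by case: (k \in U).
Qed.

Lemma vacuum_cyclic b : (forall r T S, (r < n)%N -> entry T S (b * e_ n r) = entry T S (e_ n r * b)) ->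
  (forall T, entry T vacuum b = 0) -> forall S T, #|S| = m -> entry T S b = 0.
Proof.
move=> comm b0 S; have [k] := ubnP (measure S); elim: k S => // k IH S; rewrite ltnS => lt T cS.
have [->|Sv] := pselect (S = vacuum); first exact: b0.
have [l [N [ln cN mN [K cK hK] other]]] := remove_column cS Sv.
have N0 U : entry U N b = 0 by apply: IH => //; apply: leq_trans lt.
have : \sum_U entry T U b * entry U N (e_ n l) = 0.
  rewrite -entryM comm // entryM big1 // => U _; rewrite N0 mulr0.
  by [].
rewrite (bigD1 S) //= big1 ?addr0; last first.
  move=> U /eqP US.
  have [[K' cK' hK']|none] := pselect (exists2 K' : {set 'Z_n}, #|K'| = l & hop_word (inc_word K') N = Some U).
    have [cU mU] := other _ _ cK' hK' US.
    by rewrite IH ?mul0r //; apply: leq_trans lt.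
  rewrite entry_e // big1 ?mulr0 // => K' /eqP cK'; case: eqP => // hK'.
  by case: none; exists K'.
(* The entry of [e_l] from [N] to [S] is ['X^l] times the number of sets [K] leading there. This
   number is positive, and the entry can be cancelled in the domain [{poly int}]. *)
move/eqP; rewrite mulf_eq0 => /orP[/eqP //|/eqP].
rewrite entry_e // -big_mkcondr sumr_const => /(congr1 (fun p : {poly int} => p`_l)).
rewrite coefMn coefXn eqxx coef0 => /eqP; rewrite Num.Theory.pnatr_eq0 => /eqP c0.
suff : (0 < #|[pred K : {set 'Z_n} | (#|K| == l) && (hop_word (inc_word K) N == Some S)]|)%N by rewrite c0.
by apply/card_gt0P; exists K; rewrite inE cK eqxx hK eqxx.
Qed.

End Cyclicity.

(** * Ribbons *)

Section Ribbons.
Variables n m : nat.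
Hypotheses (n_gt1 : (1 < n)%N) (m_gt0 : (0 < m)%N) (m_ltn : (m < n)%N).
Implicit Types (x y z w : seq 'Z_n) (i j k : 'Z_n) (S T U J K : {set 'Z_n}) (a b c : nilCoxeter n).

Local Notation elt := (@word_elt n).
Local Notation lam := (n - m)%N.
Local Notation hop := (@hop n m).
Local Notation hop_word := (@hop_word n m).
Local Notation entry := (@entry n m).
Local Notation vacuum := (vacuum n m).
Local Notation ideal := (two_sided_ideal (@Amn_rel n m)).

Local Opaque mul_quot add_quot opp_quot to_quot of_quot A_gen A_ d_ u_ A_word.

Lemma mem_suffix_index y i z k : uniq (y ++ i :: z) -> k != i -> k \in y ++ i :: z ->
  (k \in z) = (index i (y ++ i :: z) < index k (y ++ i :: z))%N.
Proof.
move=> u ki; have [iy d] : i \notin y /\ forall l, l \in z -> l \notin y.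
  move: u; rewrite cat_uniq /= negb_or => /and4P[_ /andP[-> h] _ _]; split=> // l lz.
  by have := hasPn h l lz.
rewrite mem_cat inE (negPf ki) /= !index_cat (negPf iy) /= eqxx addn0.
rewrite [i == k]eq_sym (negPf ki); case: (boolP (k \in y)) => [ky _|ky /= ->].
  have -> : (k \in z) = false by apply/negP => /d; rewrite ky.
  by apply/esym/negbTE; rewrite -leqNgt ltnW // index_mem.
by rewrite addnS ltnS leq_addr.
Qed.

(** The only state on which the ribbon of [J] acts. Each letter acts once, and [i - 1] acts before
    [i] exactly when [i - 1 \in J]; in the other case site [i] must be occupied from the start. *)
Definition ribbon_source J : {set 'Z_n} := [set i | i - 1 \notin J].

Lemma ribbon_source_inj : injective ribbon_source.
Proof.
move=> J J' e; apply/setP => j; have := congr1 (fun A : {set 'Z_n} => j + 1 \in A) e.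
by rewrite !inE addrK => /negb_inj.
Qed.

Lemma card_ribbon_source J : #|J| = lam -> #|ribbon_source J| = m.
Proof.
move=> cJ; have -> : ribbon_source J = [set k + 1 | k in ~: J].
  apply/setP => i; rewrite inE; apply/idP/imsetP => [iJ|[k]].
    by exists (i - 1); rewrite ?inE // subrK.
  by rewrite inE => kJ ->; rewrite addrK.
by rewrite card_imset ?card_setC_Zn ?cJ ?subKn // 1?ltnW //; apply: addIr.
Qed.

Section RibbonWord.
Variables (J : {set 'Z_n}) (w1 w2 : seq 'Z_n).
Hypotheses (cJ : #|J| = lam) (i1 : is_increasing_word (~: J) w1) (d2 : is_decreasing_word J w2).

Let split_order y i z : w1 ++ w2 = y ++ i :: z ->
  (i - 1 \in z) = (i - 1 \in J) /\ (i + 1 \in z) = (i \notin J).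
Proof.
move=> e; have [u _ eT] := ribbon_word i1 d2.
have dis : [disjoint ~: J & J] by rewrite -setI_eq0 setIC setICr.
have ord j := ud_order (j := j) i1 d2 dis; rewrite setUC setUCr in ord.
have neq j : j + 1 != j := Zn_S_neq j.
have ii : i - 1 != i by rewrite -(inj_eq (addIr 1)) subrK eq_sym.
split.
  rewrite (@mem_suffix_index y i z) -?e ?u ?eT // ltnNge leq_eqVlt negb_or.
  have -> : (index (i - 1) (w1 ++ w2) == index i (w1 ++ w2)) = false.
    apply/negP => /eqP ee; case/negP: ii; apply/eqP.
    by rewrite -(nth_index 0 (eT (i - 1))) ee nth_index // eT.
  by have := ord (i - 1); rewrite subrK !inE => -> //; rewrite negbK.
by rewrite (@mem_suffix_index y i z) -?e ?u ?eT // ord ?inE.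
Qed.

Lemma ribbon_hop : exists T, hop_word (w1 ++ w2) (ribbon_source J) = Some T.
Proof.
have [u _ _] := ribbon_word i1 d2.
suff H z y : w1 ++ w2 = y ++ z -> exists T, hop_word z (ribbon_source J) = Some T by exact: (H _ [::]).
elim: z y => [|i z IH] y e; first by exists (ribbon_source J).
have [|T hT] := IH (rcons y i); first by rewrite cat_rcons.
have [o1 o2] := split_order e.
have [iz uz] : i \notin z /\ uniq z.
  by move: u; rewrite e cat_uniq /= => /and4P[_ _ -> ->].
exists ((i + 1) |: (T :\ i)); apply/hop_wordS; exists T => //; apply/hopP; split=> //.
- exact: hop_word_card (card_ribbon_source cJ) hT.
- have := hop_word_conserve i hT; rewrite (count_memPn iz) count_uniq_mem // o1 inE.
  by case: (i - 1 \in J); case: (i \in T).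
- have := hop_word_conserveS i hT; rewrite (count_memPn iz) count_uniq_mem // o2 inE addrK.
  by case: (i \in J); case: (i + 1 \in T).
Qed.

Lemma ribbon_hop_source S T : hop_word (w1 ++ w2) S = Some T -> S = ribbon_source J.
Proof.
move=> h; have [u _ eT] := ribbon_word i1 d2; apply/setP => i; rewrite inE.
have [y [z e]] : exists y z, w1 ++ w2 = y ++ i :: z by apply: mem_splitE; rewrite eT.
have [o1 _] := split_order e; rewrite e in u h.
have [iz uz] : i \notin z /\ uniq z by move: u; rewrite cat_uniq /= => /and4P[_ _ -> ->].
have [U1 /hop_wordS[U hz hi] _] := (hop_word_cat _ _ _ _ _).1 h.
have [_ iU _ _] := (hopP _ _ _ _).1 hi; have := hop_word_conserve i hz.
rewrite (count_memPn iz) count_uniq_mem // o1 iU.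
by case: (i - 1 \in J); case: (i \in S).
Qed.

End RibbonWord.

Lemma lam_proper J : #|J| = lam -> J != set0 /\ J != setT.
Proof.
move=> cJ; split; first by rewrite -cards_eq0 cJ; clear -m_ltn; lia.
by apply: card_neqT; rewrite // cJ; clear -m_gt0 m_ltn; lia.
Qed.

Lemma ribbon_words J : #|J| = lam -> exists w1 w2,
  is_increasing_word (~: J) w1 /\ is_decreasing_word J w2.
Proof.
move=> cJ; have [J0 JT] := lam_proper cJ; have [w2 d2] := dec_word_exists JT.
have [|w1 i1] := @inc_word_exists n (~: J); first by rewrite -setC0 (inj_eq (@setC_inj _)).
by exists w1, w2.
Qed.

(** The element determines the state on which it acts, and this state determines [J]. Hence the sum
    over distinct ribbons is the sum over the sets [J]. *)
Lemma ribbon_of_inj J J' : #|J| = lam -> #|J'| = lam -> ribbon_of J = ribbon_of J' -> J = J'.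
Proof.
move=> cJ cJ' e; have [w1 [w2 [i1 d2]]] := ribbon_words cJ.
have [w1' [w2' [i1' d2']]] := ribbon_words cJ'.
have [u eJ _] := ribbon_word i1 d2; have [u' eJ' _] := ribbon_word i1' d2'.
have [T hT] := ribbon_hop cJ i1 d2.
apply: ribbon_source_inj; apply: (@ribbon_hop_source J' w1' w2' i1' d2' _ T).
have ee : elt (w1 ++ w2) = elt (w1' ++ w2') by rewrite eJ eJ'.
have r := uniq_reduced u; have r' := uniq_reduced u'.
rewrite -(@hop_word_A n m (w1 ++ w2)) //; first exact: matsumoto.
by rewrite (eqP r) (eqP r') ee.
Qed.

Lemma ribbon_source_initial : ribbon_source (initial n lam) = vacuum.
Proof.
have lt : (lam < n)%N by clear -m_gt0 m_ltn; lia.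
apply/eqP; rewrite eqEcard card_vacuum // card_ribbon_source ?card_initial // leqnn andbT.
apply/subsetP => i; rewrite !inE -leqNgt => le; rewrite ltnNge; apply/negP => mi.
have e : i - 1 = (pos m i - m)%:R :> 'Z_n.
  rewrite natrB // -{1}(site_pos m i) /site -addrA -opprD natr1.
  by rewrite (ltn_predK m_gt0).
move: le; rewrite e [val _]val_natr_Zn //; have := pos_lt m n_gt1 i; clear -mi; lia.
Qed.

Lemma r_word : exists x, [/\ elt x = r_ n m, reduced x & exists T, hop_word x vacuum = Some T].
Proof.
have lt : (lam < n)%N by clear -m_gt0 m_ltn; lia.
have cJ := card_initial n_gt1 lt; have [w1 [w2 [i1 d2]]] := ribbon_words cJ.
have [u eJ _] := ribbon_word i1 d2.
exists (w1 ++ w2); rewrite eJ r_ribbon // uniq_reduced // -ribbon_source_initial; split=> //.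
exact: ribbon_hop.
Qed.

(** All reduced words of [r_ n m] act on the vacuum, where only the letter [0] can act first. *)
Lemma r_grassmannian : grassmannian0 (r_ n m).
Proof.
have [x [ex rx [T hT]]] := r_word; move=> w [ew sw].
have rw : reduced w by rewrite /reduced ew sw.
case/lastP: w ew sw rw => // w i ew sw rw _; rewrite last_rcons.
have : hop_word (rcons w i) vacuum = Some T.
  rewrite -(@hop_word_A n m x) //; first by apply: matsumoto => //; rewrite ex ew.
  by rewrite (eqP rx) (eqP rw) ex ew.
by rewrite -cats1 => /hop_word_cat[U /hop_wordS[V [<-] /hop_vacuum] H _]; apply: H.
Qed.

Lemma hop_word_source_card x S T : x <> [::] -> hop_word x S = Some T -> #|S| = m.
Proof.
case/lastP: x => // x i _; rewrite -cats1 => /hop_word_cat[U /hop_wordS[V [<-] hi] _].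
by case/hopP: hi.
Qed.

(** Divisibility by ['X^(n+1)]. The bound is chosen because [r_ n m] has [n] letters, so that its
    entry ['X^n] is not low. *)
Definition low (p : {poly int}) := forall k : nat, (k <= n)%N -> p`_k = 0.

Lemma low0 : low 0. Proof. by move=> k _; rewrite coef0. Qed.

Lemma lowMr p q : low p -> low (p * q).
Proof.
move=> lp k kn; rewrite coefM big1 // => j _; rewrite lp ?mul0r //.
by apply: leq_trans kn; rewrite -ltnS.
Qed.

Lemma low_sum (I : finType) (F : I -> {poly int}) : (forall u, low (F u)) -> low (\sum_u F u).
Proof. by move=> H k kn; rewrite coef_sum big1 // => i _; apply: H. Qed.

(* For [n = 2] the words [i, i + 1, i] do not vanish on states; they only
   increase the degree beyond [n]. *)
Lemma ideal_low c T S : ideal c -> low (entry T S c).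
Proof.
move=> Ic; elim: Ic T S => {c} [c|T S|c c' _ IH _ IH' T S|a c b _ IH T S].
- case=> [i|v [J JT ->]|v [J JT ->]].
  + have -> : A_gen i * A_gen (i + 1) * A_gen i = A_word [:: i; i + 1; i].
      by rewrite !A_word_cons A_word_nil mulr1; exact/esym/mulrA.
    move=> T S; rewrite entry_word; have [n2|n2] := leqP n 2; last by rewrite hop_word_braid //; apply: low0.
    case: ifP => _; last exact: low0.
    by move=> k kn; rewrite coefXn; case: eqP => // e; move: kn n2; rewrite e /=; clear; lia.
  + rewrite cox_length_d // => lt T S; have [w dw] := dec_word_exists JT; rewrite (A_d dw) entry_word.
    case: eqP => h; last exact: low0.
    have cS : #|S| = m.
      apply: hop_word_source_card h => w0; have [p _] := dw; move: lt.
      by rewrite -(size_perm_enum p) w0.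
    exfalso; have sub : [set k + 1 | k in J] \subset ~: S.
      by apply/subsetP => j /imsetP[k kJ ->]; rewrite inE (hop_dec_sub dw h kJ).
    move: (subset_leq_card sub); rewrite card_imset; last exact: addIr.
    by rewrite card_setC_Zn // cS leqNgt lt.
  + rewrite cox_length_u // => lt T S; have [w iw] := inc_word_exists JT; rewrite (A_u iw) entry_word.
    case: eqP => h; last exact: low0.
    have cS : #|S| = m.
      apply: hop_word_source_card h => w0; have [p _] := iw; move: lt.
      by rewrite -(size_perm_enum p) w0.
    by exfalso; move: (subset_leq_card (hop_inc_sub iw h)); rewrite cS leqNgt lt.
- by rewrite raddf0; apply: low0.
- move=> k kn; rewrite [entry T S _]entryB coefB IH // IH' //.
- rewrite entryM; apply: low_sum => U; apply: lowMr; rewrite entryM; apply: low_sum => V.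
  by rewrite mulrC; apply: lowMr.
Qed.

Lemma A_r_nonzero : ~ ideal (A_ (r_ n m)).
Proof.
have [x [ex rx [T hT]]] := r_word; rewrite -ex A_elt // => /(ideal_low T vacuum).
have sz : size x = n.
  have lt : (lam < n)%N by clear -m_gt0 m_ltn; lia.
  have cJ := card_initial n_gt1 lt; have [w1 [w2 [i1 d2]]] := ribbon_words cJ.
  have [u eJ _] := ribbon_word i1 d2.
  rewrite (eqP rx) ex r_ribbon // -eJ -(eqP (uniq_reduced u)) size_cat.
  have [p1 _] := i1; have [p2 _] := d2.
  by rewrite (size_perm_enum p1) (size_perm_enum p2) card_setC_Zn // cJ subnK // ltnW.
rewrite entry_word hT eqxx sz => /(_ n (leqnn n)).
by rewrite coefXn eqxx.
Qed.

(** An element that is not Grassmannian has a reduced word ending with a letter other than [0], and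
    such a word kills the vacuum. *)
Lemma kSchur_entry s T : is_kSchur (r_ n m) s -> entry T vacuum s = entry T vacuum (A_ (r_ n m)).
Proof.
case=> _ [a [-> ar aG]]; rewrite raddf_sum /=.
have rs : r_ n m \in finsupp a by rewrite mem_finsupp ar.
rewrite (big_rem (r_ n m)) //= ar mulr1z big_seq big1 ?addr0 // => v.
rewrite mem_rem_uniq ?fset_uniq // inE => /andP[/eqP vr _].
have [G|nG] := pselect (grassmannian0 v); first by rewrite aG // mulr0z raddf0.
rewrite raddfMz /=; suff -> : entry T vacuum (A_ v) = 0 by rewrite mul0rz.
have [w [rw w0 l0]] : exists w, [/\ reduced_word v w, w <> [::] & last 0 w <> 0].
  apply: contrapT => no; apply: nG => w rw w0; apply: contrapT => l0; apply: no.
  by exists w.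
have r := reduced_word_reduced rw; case: rw => <- _; rewrite A_elt // entry_word.
case/lastP: w w0 l0 {r} => // w i _; rewrite last_rcons => i0; case: eqP => //.
by rewrite -cats1 => /hop_word_cat[U /hop_wordS[V [<-] /hop_vacuum] H _]; case: i0; apply: H.
Qed.

Lemma kSchur_ideal s : is_kSchur (r_ n m) s -> ideal (s - e_ n m * h_ n lam).
Proof.
move=> ks; have ks1 := kSchur_e_h n_gt1 m_gt0 m_ltn r_grassmannian.
move: (e_ n m * h_ n lam) ks1 => s1 ks1.
have Bs : fomin_stanley (s - s1) by apply: Subring_B; [case: ks|case: ks1].
apply: (entry_faithful n_gt1 m_ltn) => S T cS.
apply: (@vacuum_cyclic n m n_gt1 m_gt0 m_ltn (s - s1) _ _ S T cS) => [r T' S' rn|T'].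
  exact: (fomin_stanley_e_comm m n_gt1 T' S' Bs rn).
apply: etrans (entryB m T' vacuum s s1) _.
have e := kSchur_entry T' ks1; have e' := kSchur_entry T' ks.
by apply/eqP; rewrite subr_eq0; apply/eqP; exact: etrans e' (esym e).
Qed.

Lemma initial_ribbon J : #|J| = lam -> grassmannian0 (ribbon_of J) -> J = initial n lam.
Proof.
move=> cJ G; have [w1 [w2 [i1 d2]]] := ribbon_words cJ; have [u eJ _] := ribbon_word i1 d2.
have [p1 _] := i1.
apply: (grassmannian_J (K := ~: J) n_gt1 m_gt0 m_ltn _ cJ i1 d2 (uniq_reduced u) eJ G).
by rewrite card_setC_Zn // cJ subKn // ltnW.
Qed.

End Ribbons.

Theorem theorem6 (m n : nat) (hm : (0 < m)%N) (hmn : (m < n)%N) :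
  kSchur_mn m (r_ n m) = \sum_(v <- ribbons_of_size n (n - m)) to_Amn m (A_ v)
  /\ (forall v : affS n,
        [/\ connected_ribbon v, grassmannian0 v & to_Amn m (A_ v) != 0]
        <-> v = r_ n m).
Proof.
have n_gt1 : (1 < n)%N by exact: leq_ltn_trans hm hmn.
have toP (a b : nilCoxeter n) : to_Amn m a = to_Amn m b <-> two_sided_ideal (@Amn_rel n m) (a - b).
  exact: eq_to_quot.
have to0 (a : nilCoxeter n) : to_Amn m a = 0 <-> two_sided_ideal (@Amn_rel n m) a.
  by rewrite -(rmorph0 (to_quot (@Amn_rel n m))) -{2}(subr0 a); exact: toP.
split.
  have ks : is_kSchur (r_ n m) (kSchur (r_ n m)).
    exact: (xgetPex 0 (ex_intro _ _ (kSchur_e_h n_gt1 hm hmn (r_grassmannian n_gt1 hm hmn)))).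
  have /toP e1 := kSchur_ideal n_gt1 hm hmn ks; have /toP e2 := e_h_ideal n_gt1 hm hmn.
  rewrite /kSchur_mn e1 e2 [LHS]rmorph_sum /ribbons_of_size undup_id; last first.
    rewrite map_inj_in_uniq ?enum_uniq // => J J'; rewrite !mem_enum !inE.
    by move=> /and3P[_ _ /eqP cJ] /and3P[_ _ /eqP cJ']; apply: ribbon_of_inj hmn _ _ cJ cJ'.
  rewrite big_map big_enum_cond /=; apply: eq_bigl => J; rewrite !inE andbT.
  have [cJ|] := eqVneq #|J| (n - m)%N; last by rewrite !andbF.
  by have [-> ->] := lam_proper n_gt1 hm hmn cJ.
have lt : (n - m < n)%N by clear -hm hmn; lia.
move=> v; split=> [[[J [J0 JT ->]] G /eqP nz]|->].
  have cJ : #|J| = (n - m)%N.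
    by apply: contrapT => cJ; apply/nz/to0/ribbon_ideal.
  by rewrite (initial_ribbon n_gt1 hm hmn cJ G) r_ribbon.
have [J0 JT] := lam_proper n_gt1 hm hmn (card_initial n_gt1 lt).
split; last by apply/eqP => /to0; apply: A_r_nonzero.
- by exists (initial n (n - m)); rewrite r_ribbon.
- exact: r_grassmannian.
Qed.
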